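(* Let $\mathbb{F}=\mathbb{Q}$. (a) For $\Sigma^{[k]}\Pi\Sigma\wedge$ circuits of size $s$ over $\mathbb{F}[x_1,\dots,x_n]$ there is a blackbox PIT algorithm running in time $s^{O(k\log\log s)}$; i.e., one can construct in time $s^{O(k\log\log s)}$ a set $\mathcal{H}\subseteq\mathbb{F}^n$ such that every nonzero polynomial computed by such a circuit is nonzero at some point of $\mathcal{H}$. (b) For $\Sigma^{[k]}\Pi\Sigma\Pi^{[\delta]}$ circuits of size $s$ over $\mathbb{F}[x_1,\dots,x_n]$ there is a blackbox PIT algorithm running in time $s^{O(\delta^2 k\log s)}$; i.e., one can construct in time $s^{O(\delta^2 k\log s)}$ a set $\mathcal{H}\subseteq\mathbb{F}^n$ such that every nonzero polynomial computed by such a circuit is nonzero at some point of $\mathcal{H}$.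
   Context: A $\Sigma^{[k]}\Pi\Sigma\wedge$ circuit computes a polynomial $\sum_{i=1}^{k}\prod_{j}\big(g_{ij1}(x_1)+\cdots+g_{ijn}(x_n)\big)$ with each $g_{ij\ell}\in\mathbb{F}[x_\ell]$ univariate. A $\Sigma^{[k]}\Pi\Sigma\Pi^{[\delta]}$ circuit computes a polynomial $\sum_{i=1}^{k}\prod_{j} g_{ij}(x_1,\dots,x_n)$ where each $g_{ij}$ is a polynomial (given as a sum of monomials) of degree at most $\delta$. Size: a product $h_1\cdots h_m$ has size $\sum_i(\mathrm{sp}(h_i)+\deg(h_i))$, where $\mathrm{sp}$ is the number of nonzero monomials, and the circuit size is the sum of the sizes of its $k$ product terms. Blackbox means the algorithm may only evaluate the circuit at points of $\mathbb{F}^n$ (equivalently, it outputs a hitting set).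
   Formalization: Assumes 1 ≤ n ≤ s (each point has n coordinates, so no bound in s alone can hold for unbounded n; otherwise use max(n,s) for s), with k, δ ≥ 1, s ≥ 4 in (a) and s ≥ 2 in (b), where the exponents are positive. *)

(* Defs.v *)
From mathcomp Require Import all_boot all_order all_algebra.
From mathcomp Require Import mpoly.

Set Implicit Arguments.
Unset Strict Implicit.
Unset Printing Implicit Defensive.

Import GRing.Theory.
Local Open Scope ring_scope.

(** * Depth-4 circuits over the rationals *)

(* [sparsity h] is sp(h); [tdeg h] is deg(h), with tdeg 0 = 0 (msize is
   degree + 1). *)
Definition sparsity n (h : {mpoly rat[n]}) : nat := size (msupp h).
Definition tdeg n (h : {mpoly rat[n]}) : nat := (msize h).-1.

(* A product gate is the list of its factors; a circuit with top fan-in k is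
   the k-tuple of its product gates.  A gate may contain the factor 0 (of
   size 0), so fewer than k nonzero summands are covered as well. *)
Definition product_gate n := seq {mpoly rat[n]}.
Definition circuit k n := k.-tuple (product_gate n).

Definition gate_poly n (T : product_gate n) : {mpoly rat[n]} :=
  \prod_(h <- T) h.
Definition gate_size n (T : product_gate n) : nat :=
  (\sum_(h <- T) (sparsity h + tdeg h))%N.

Definition circuit_poly k n (c : circuit k n) : {mpoly rat[n]} :=
  \sum_(i < k) gate_poly (tnth c i).
Definition circuit_size k n (c : circuit k n) : nat :=
  (\sum_(i < k) gate_size (tnth c i))%N.

(* g_1(x_1) + ... + g_n(x_n); [horner_alg 'X_l g] is g evaluated at x_l. *)
Definition sum_of_univariates n (h : {mpoly rat[n]}) : Prop :=
  exists g : 'I_n -> {poly rat}, h = \sum_(l < n) horner_alg 'X_l (g l).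

Definition SigmaPiSigmaWedge k n (c : circuit k n) : Prop :=
  forall i h, h \in tnth c i -> sum_of_univariates h.

Definition SigmaPiSigmaPi k delta n (c : circuit k n) : Prop :=
  forall i h, h \in tnth c i -> (tdeg h <= delta)%N.

Definition hitting_set n (H : seq (n.-tuple rat))
    (computed : {mpoly rat[n]} -> Prop) : Prop :=
  forall f, computed f -> f != 0 -> exists2 v, v \in H & f.@[tnth v] != 0.

(** * Model of computation *)

(* The random access machine of Cook and Reckhow, with structured control in
   place of jumps: integer registers addressed by integers, constants,
   addition, subtraction, indirect loads and stores, sign tests and a
   write-only output.  There is no multiplication, so register contents gain
   at most one bit per step (beyond those of the inputs and of the constants
   of the program) and unit cost is polynomially related to Turing machine
   time. *)
Inductive cmd : Type :=
| Skip
| Const of int & int          (* Const x c   : M[x] := c *)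
| Add of int & int & int      (* Add x y z   : M[x] := M[y] + M[z] *)
| Sub of int & int & int      (* Sub x y z   : M[x] := M[y] - M[z] *)
| LoadAt of int & int         (* LoadAt x y  : M[x] := M[M[y]] *)
| StoreAt of int & int        (* StoreAt x y : M[M[x]] := M[y] *)
| Output of int               (* Output x    : output M[x] *)
| Seq of cmd & cmd
| IfPos of int & cmd & cmd    (* IfPos x p q : if M[x] > 0 then p else q *)
| WhilePos of int & cmd.      (* WhilePos x p : while M[x] > 0 do p *)

Definition mem := int -> int.
Definition upd (M : mem) (x v : int) : mem := fun y => if y == x then v else M y.

(* [exec p M t M' out]: started in memory M, the program p halts after t
   steps in memory M', having output the sequence out. *)
Inductive exec : cmd -> mem -> nat -> mem -> seq int -> Prop :=
| ExSkip M : exec Skip M 1 M [::]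
| ExConst x c M : exec (Const x c) M 1 (upd M x c) [::]
| ExAdd x y z M : exec (Add x y z) M 1 (upd M x (M y + M z)) [::]
| ExSub x y z M : exec (Sub x y z) M 1 (upd M x (M y - M z)) [::]
| ExLoadAt x y M : exec (LoadAt x y) M 1 (upd M x (M (M y))) [::]
| ExStoreAt x y M : exec (StoreAt x y) M 1 (upd M (M x) (M y)) [::]
| ExOutput x M : exec (Output x) M 1 M [:: M x]
| ExSeq p q M M1 M2 t1 t2 o1 o2 :
    exec p M t1 M1 o1 -> exec q M1 t2 M2 o2 ->
    exec (Seq p q) M (t1 + t2) M2 (o1 ++ o2)
| ExIfTrue x p q M M1 t o :
    0 < M x -> exec p M t M1 o -> exec (IfPos x p q) M t.+1 M1 o
| ExIfFalse x p q M M1 t o :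
    M x <= 0 -> exec q M t M1 o -> exec (IfPos x p q) M t.+1 M1 o
| ExWhileStop x p M : M x <= 0 -> exec (WhilePos x p) M 1 M [::]
| ExWhileLoop x p M M1 M2 t1 t2 o1 o2 :
    0 < M x -> exec p M t1 M1 o1 -> exec (WhilePos x p) M1 t2 M2 o2 ->
    exec (WhilePos x p) M (t1 + t2).+1 M2 (o1 ++ o2).

(* The inputs are placed in registers 0, 1, 2, ...; all others hold 0. *)
Definition init_mem (inp : seq nat) : mem :=
  fun a => if a is Posz i then Posz (nth 0%N inp i) else 0.

Definition outputs_in_time (p : cmd) (inp : seq nat) (t : nat) (out : seq int)
    : Prop :=
  exists M : mem, exec p (init_mem inp) t M out.

(* Points of Q^n are printed coordinate by coordinate, each rational as its
   numerator followed by its denominator in lowest terms. *)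
Definition encode_point n (v : n.-tuple rat) : seq int :=
  flatten [seq [:: numq q; denq q] | q <- v].
Definition encode_points n (H : seq (n.-tuple rat)) : seq int :=
  flatten [seq encode_point v | v <- H].

(* Rounded-down binary logarithm.  For s >= 2 it is within a factor 2 of the
   real one, and for s >= 4 so is [log2 (log2 s)], which is what makes it
   interchangeable with the real logarithm under an O(.). *)
Definition log2 (s : nat) : nat := trunc_log 2 s.

(* Main.v *)
From HB Require Import structures.
From Stdlib Require Import Classical FunctionalExtensionality.
From mathcomp Require Import all_boot all_order all_algebra perm.
From mathcomp Require Import mpoly ring zify.
Require Import Defs.
Set Implicit Arguments.
Unset Strict Implicit.
Unset Printing Implicit Defensive.
Import Order.TTheory GRing.Theory Num.Theory.
Local Open Scope ring_scope.

(** Let f = T_1 + ... + T_k be nonzero, M a maximal nonzero minor of the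
    Jacobian of the T_i, and C its columns, at most min(k, n) many.  Where M
    does not vanish, f is not constant zero along the coordinates in C, so it
    suffices to hit M and to add few free coordinates.

    At a point al where no factor of the T_i vanishes (powers of one integer
    with exponents reduced modulo a small number), the factors can be inverted
    as truncated power series, so up to a constant the lowest homogeneous part
    of M(x + al) is that of the determinant of the logarithmic derivatives.
    This determinant has low complexity.

    For factors of degree at most delta it lies in a small span of products of
    powers; counting shifted partial derivatives shows that it has a monomial
    with O(delta * (delta + k log s)) variables, and M is hit by points with few
    free coordinates near al.

    For sums of univariates it is, for every set A of variables, a sum of
    s^O(k) products of a polynomial in A with one outside A.  Hence O(log log s)
    levels of weights, merging blocks of variables in pairs, isolate the slices
    that span all others on any set of O(k log s) variables.  A shift along an
    isolating curve then leaves a monomial of such small support, which a hash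
    function spreads over buckets of at most k variables; a second use of the
    isolating weights hits what remains.

    Every rational parameter is finally replaced by a bounded natural number,
    because it enters through a univariate polynomial of bounded degree. *)

(** * Evaluation at powers and small integer grids *)

(** The minor is hard to hit directly because a gate may have [s] factors, so its derivatives are
    sums of long products. Dividing each row by its gate leaves sums of dg/g, but clearing these
    denominators would bring the long products back. A truncated geometric series for 1/g is a
    polynomial in the single factor g, and this is what keeps the complexity at s^O(k). It is
    faithful only in the lowest degree, so a hit has to be carried back to the minor: by a surviving
    monomial for bounded degree, along a ray for sums of univariates.

    Origin of the exponents. Separation width s^O(k) makes each modulus s^O(k), and rank
    concentrates on O(k log s) variables because a polynomial vanishing on l hyperplanes X_i = 1 has
    at least 2^l monomials. Blocks of about k variables then need only log log s + O(1) merging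
    levels, each multiplying the weights by s^O(k). For bounded degree, 2^m must exceed a span of
    dimension s^O(k) times O(delta), and supports of size O(delta m) are reached; hence delta^2 k
    log s. The number of seeds is constant, nine and three, so enumerating them costs only a
    constant factor in the exponent. *)

Lemma meval_horner n (f : {mpoly rat[n]}) (pp : 'I_n -> {poly rat}) u :
  f.@[fun i => (pp i).[u]] = (mmap (@polyC rat) pp f).[u].
Proof.
rewrite mevalE /mmap horner_sum; apply: eq_bigr => m _.
rewrite hornerM hornerC /mmap1 horner_prod; congr (_ * _).
by apply: eq_bigr => i _; rewrite horner_exp.
Qed.

Lemma size_mmap1 n (pp : 'I_n -> {poly rat}) (m : 'X_{1..n}) d :
  (forall i, size (pp i) <= d.+1)%N -> (size (mmap1 pp m) <= (mdeg m * d).+1)%N.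
Proof.
move=> hd; rewrite /mmap1 mdegE big_distrl /=.
elim/big_ind2: _ => [|q b p a ha hb|i _]; first by rewrite size_poly1.
  apply: leq_trans (size_polyMleq b a) _.
  by move: (size b) (size a) ha hb => x y; lia.
apply: leq_trans (size_poly_exp_leq _ _) _; rewrite ltnS mulnC leq_mul2l.
by apply/orP; right; rewrite -subn1 leq_subLR add1n.
Qed.

Lemma size_mmap n (f : {mpoly rat[n]}) (pp : 'I_n -> {poly rat}) d S :
  (forall i, size (pp i) <= d.+1)%N -> (msize f <= S.+1)%N ->
  (size (mmap (@polyC rat) pp f) <= (S * d).+1)%N.
Proof.
move=> hd hS; rewrite /mmap; apply: (leq_trans (size_sum _ _ _)).
apply/bigmax_leqP_seq => m mf _; rewrite mul_polyC.
apply: leq_trans (size_scale_leq _ _) _.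
apply: leq_trans (size_mmap1 _ hd) _; rewrite ltnS leq_mul2r.
by apply/orP; right; rewrite -ltnS; exact: leq_trans (msize_mdeg_lt mf) hS.
Qed.

Lemma poly_nat_nonroot (p : {poly rat}) d :
  p != 0 -> (size p <= d.+1)%N -> exists2 u : nat, (u <= d)%N & p.[u%:R] != 0.
Proof.
move=> p0 hp; case: (pickP (fun u : 'I_d.+1 => p.[(u : nat)%:R] != 0)) => [u hu|h].
  by exists u => //; rewrite -ltnS.
have := @max_poly_roots _ p [seq (i%:R : rat) | i <- iota 0 d.+1] p0.
rewrite size_map size_iota => hh; suff: (d.+1 < size p)%N by lia.
apply: hh.
  apply/allP => x /mapP[i]; rewrite mem_iota /= => hi ->.
  by have := h (Ordinal hi) => /= /negbFE.
by rewrite map_inj_uniq ?iota_uniq // => i j /eqP; rewrite eqr_nat => /eqP.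
Qed.

(** Along the curve [pp] the polynomial is univariate of degree at most [S * d], and the seed [u0]
    shows that it is not zero. *)
Lemma natural_seed n (f : {mpoly rat[n]}) (pp : 'I_n -> {poly rat}) d S u0 :
  (forall i, size (pp i) <= d.+1)%N -> (msize f <= S.+1)%N ->
  f.@[fun i => (pp i).[u0]] != 0 ->
  exists2 u : nat, (u <= S * d)%N & f.@[fun i => (pp i).[u%:R]] != 0.
Proof.
move=> hd hS; rewrite meval_horner => h0.
have p0 : mmap (@polyC rat) pp f != 0 by apply: contraNneq h0 => ->; rewrite horner0.
have [u hu hu0] := poly_nat_nonroot p0 (size_mmap hd hS).
by exists u => //; rewrite meval_horner.
Qed.

(** The coordinates are replaced one at a time. Those where [x] vanishes are kept at zero, so the
    set of free coordinates, which is later encoded in a seed, does not grow. *)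
Lemma natural_grid n (f : {mpoly rat[n]}) S (a x : 'I_n -> rat) :
  (msize f <= S.+1)%N -> f.@[fun i => a i + x i] != 0 ->
  exists y : 'I_n -> nat, [/\ forall i, (y i <= S)%N, forall i, x i = 0 -> y i = 0%N
    & f.@[fun i => a i + (y i)%:R] != 0].
Proof.
move=> hS hx.
suff: forall s : seq 'I_n, exists y : 'I_n -> nat,
   [/\ forall i, (y i <= S)%N, forall i, x i = 0 -> y i = 0%N
    & f.@[fun i => a i + (if i \in s then (y i)%:R else x i)] != 0].
  case/(_ (enum 'I_n)) => y [h1 h2 h3]; exists y; split=> //.
  by erewrite meval_eq; [exact: h3|by move=> i; rewrite mem_enum].
elim=> [|j s [y [h1 h2 h3]]].
  by exists (fun _ => 0%N); split=> //.
have [js|js] := boolP (j \in s).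
  exists y; split=> //; erewrite meval_eq; first exact: h3.
  by move=> i; rewrite inE; case: eqP => [->|//]; rewrite js.
have [xj|xj] := eqVneq (x j) 0.
  exists y; split=> //; erewrite meval_eq; first exact: h3.
  by move=> i; rewrite inE; case: eqP => [->|//]; rewrite (negbTE js) xj h2.
pose pp i : {poly rat} := if i == j then (a i)%:P + 'X else
  (a i + (if i \in s then (y i)%:R else x i))%:P.
have [||u hu hu0] := @natural_seed n f pp 1 S (x j) _ hS.
- move=> i; rewrite /pp; case: eqP => _; last by rewrite size_polyC; case: (_ != _).
  by rewrite addrC size_XaddC.
- erewrite meval_eq; first exact: h3.
  move=> i; rewrite /pp; case: eqP => [->|_]; last by rewrite hornerC.
  by rewrite hornerD hornerC hornerX (negbTE js).
exists (fun i => if i == j then u else y i); split=> [i|i xi|].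
- by case: eqP => // _; rewrite muln1 in hu.
- by case: eqP => [e|_]; [move: xj; rewrite -e xi eqxx|exact: h2].
erewrite meval_eq; first exact: hu0.
move=> i; rewrite /pp inE; case: eqP => [->|_] /=; last by rewrite hornerC.
by rewrite hornerD hornerC hornerX.
Qed.

Definition wdeg n (w : 'I_n -> nat) (m : 'X_{1..n}) : nat := (\sum_i m i * w i)%N.

Lemma wdegD n (w : 'I_n -> nat) m1 m2 : wdeg w (m1 + m2)%MM = (wdeg w m1 + wdeg w m2)%N.
Proof. by rewrite /wdeg -big_split; apply: eq_bigr => i _; rewrite mnmDE mulnDl. Qed.

(** Only [a] contributes to the coefficient at its own weight, so nothing can cancel it. *)
Lemma weight_poly_neq0 n (f : {mpoly rat[n]}) (w : 'I_n -> nat) a :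
  a \in msupp f -> (forall m, m \in msupp f -> wdeg w m = wdeg w a -> m = a) ->
  mmap (@polyC rat) (fun i => 'X^(w i)) f != 0.
Proof.
move=> af ha; apply/negP => /eqP /(congr1 (fun p : {poly rat} => p`_(wdeg w a))).
rewrite coef0 /mmap coef_sum (bigD1_seq a) ?msupp_uniq //= big_seq_cond big1 => [|m /andP[mf ma]].
  rewrite addr0 coefCM /mmap1; under eq_bigr do rewrite -exprM mulnC.
  rewrite prodrXr coefXn eqxx mulr1 => /eqP.
  by rewrite mcoeff_eq0 af.
rewrite coefCM /mmap1; under eq_bigr do rewrite -exprM mulnC.
rewrite prodrXr coefXn; case: eqP => [/esym e|_]; last by rewrite mulr0.
by rewrite (ha m mf e) eqxx in ma.
Qed.

Lemma base_digits_inj D n (a b : nat -> nat) :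
  (forall i, (i < n)%N -> (a i < D)%N) -> (forall i, (i < n)%N -> (b i < D)%N) ->
  (\sum_(i < n) a i * D ^ i = \sum_(i < n) b i * D ^ i)%N ->
  forall i, (i < n)%N -> a i = b i.
Proof.
move=> ha hb.
have lt (c : nat -> nat) : (forall i, (i < n)%N -> (c i < D)%N) ->
    forall k, (k <= n)%N -> (\sum_(i < k) c i * D ^ i < D ^ k)%N.
  move=> hc; elim=> [|k IH] kn; first by rewrite big_ord0.
  rewrite big_ord_recr /= expnS; have := IH (ltnW kn); have := hc k kn.
  move=> h1 h2; apply: (@leq_trans ((c k).+1 * D ^ k)); last by rewrite leq_mul2r h1 orbT.
  by rewrite mulSn ltn_add2r.
suff: forall k, (k <= n)%N -> (\sum_(i < k) a i * D ^ i = \sum_(i < k) b i * D ^ i)%N ->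
  forall i, (i < k)%N -> a i = b i by apply.
elim=> [//|k IH] kn; rewrite !big_ord_recr /= => e i ik.
have lta := lt a ha k (ltnW kn); have ltb := lt b hb k (ltnW kn).
have D0 : (0 < D ^ k)%N by case: (D ^ k)%N lta.
have ek : a k = b k.
  have := congr1 (divn^~ (D ^ k)%N) e; rewrite /= ![(_ + _ * D ^ k)%N]addnC.
  by rewrite !divnMDl // !divn_small // !addn0.
move: ik; rewrite ltnS leq_eqVlt => /orP[/eqP -> //|ik].
by apply: IH => //; [exact: ltnW|move: e; rewrite ek => /addIn].
Qed.

Lemma kronecker_inj n D (m1 m2 : 'X_{1..n}) :
  (mdeg m1 < D)%N -> (mdeg m2 < D)%N ->
  wdeg (fun i => D ^ i)%N m1 = wdeg (fun i => D ^ i)%N m2 -> m1 = m2.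
Proof.
case: n m1 m2 => [|n] m1 m2 h1 h2 e; first by apply/mnmP => -[].
have lt (m : 'X_{1..n.+1}) i : (m i <= mdeg m)%N by rewrite mdegE (bigD1 i) //= leq_addr.
apply/mnmP => i; rewrite -[i]inord_val.
apply: (@base_digits_inj D n.+1 (fun i => m1 (inord i)) (fun i => m2 (inord i))) => //.
- by move=> j _; apply: leq_ltn_trans (lt _ _) h1.
- by move=> j _; apply: leq_ltn_trans (lt _ _) h2.
move: e; rewrite /wdeg => e.
rewrite (eq_bigr (fun i : 'I_n.+1 => m1 i * D ^ i)%N); last by move=> j _; rewrite inord_val.
by rewrite e; apply: eq_bigr => j _; rewrite inord_val.
Qed.

Lemma wdeg_kronecker_lt n D (m : 'X_{1..n}) : (mdeg m < D)%N ->
  (wdeg (fun i => D ^ i)%N m < D ^ n.+1)%N.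
Proof.
move=> h; apply: (@leq_ltn_trans (mdeg m * D ^ n)).
  rewrite mdegE /wdeg big_distrl /=; apply: leq_sum => i _.
  by rewrite leq_mul2l leq_pexp2l ?orbT //; [case: D h|exact/ltnW].
by rewrite expnS ltn_mul2r h andbT expn_gt0; case: D h.
Qed.

Lemma mpoly_nonroot n (f : {mpoly rat[n]}) : f != 0 -> exists x, f.@[x] != 0.
Proof.
move=> f0; pose w (i : 'I_n) := (msize f ^ i)%N.
have p0 : mmap (@polyC rat) (fun i => 'X^(w i)) f != 0.
  apply: (weight_poly_neq0 (mlead_supp f0)) => m mf.
  apply: kronecker_inj; first exact: msize_mdeg_lt.
  exact/msize_mdeg_lt/mlead_supp.
have [u _ hu] := poly_nat_nonroot p0 (leqnSn _).
by exists (fun i => ('X^(w i)).[u%:R]); rewrite meval_horner.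
Qed.

Lemma mpoly_eq0_meval n (f : {mpoly rat[n]}) : (forall x, f.@[x] = 0) -> f = 0.
Proof. by move=> h; apply/eqP; apply/negPn/negP => /mpoly_nonroot[x]; rewrite h eqxx. Qed.

Lemma poly_common_nonroot (I : finType) (P : I -> {poly rat}) :
  (forall i, P i != 0) -> exists u : rat, forall i, (P i).[u] != 0.
Proof.
move=> hP; have Q0 : \prod_i P i != 0 by apply/prodf_neq0 => i _.
have [u _ hu] := poly_nat_nonroot Q0 (leqnSn _); exists u%:R => i.
by apply: contraNneq hu => e; rewrite horner_prod (bigD1 i) //= e mul0r.
Qed.

(** * Small non-divisors *)

(** By Legendre's formula the valuation is the sum of the differences between the floor of 2m/p^k
    and twice the floor of m/p^k. Each difference is 0 or 1, and it is 0 once p^k exceeds 2m. *)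
Lemma logn_central_bin p m : prime p -> (0 < m)%N ->
  (logn p 'C(m.*2, m) <= trunc_log p m.*2)%N.
Proof.
move=> pp m0; have p1 := prime_gt1 pp.
have e : ('C(m.*2, m) * (m`! * m`!) = m.*2`!)%N.
  by rewrite -(@bin_fact m.*2 m) ?leq_addr -?addnn ?leq_addr // addnK.
have := congr1 (logn p) e.
rewrite !lognM ?muln_gt0 ?fact_gt0 ?bin_gt0 -?addnn ?leq_addr // addnn !logn_fact //.
(* The Legendre sums of [m] and [m.*2] are brought to a common range; the added terms are zero. *)
have wid : (\sum_(1 <= k < m.+1) m %/ p ^ k = \sum_(1 <= k < m.*2.+1) m %/ p ^ k)%N.
  rewrite [RHS](@big_cat_nat _ _ _ m.+1) //=; last by rewrite ltnS -addnn leq_addr.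
  rewrite [X in (_ = _ + X)%N]big_nat_cond [X in (_ = _ + X)%N]big1 ?addn0 // => k /andP[/andP[mk _] _].
  by rewrite divn_small // (leq_trans _ (ltnW (ltn_expl k p1))) // .
rewrite wid => h.
have le : (\sum_(1 <= k < m.*2.+1) m.*2 %/ p ^ k <=
  \sum_(1 <= k < m.*2.+1) (2 * (m %/ p ^ k) + (p ^ k <= m.*2)))%N.
  rewrite leq_sum // => k _.
  have pk : (0 < p ^ k)%N by rewrite expn_gt0 ltnW.
  have [le|lt] := leqP (p ^ k) m.*2; last by rewrite divn_small.
  rewrite -ltnS ltn_divLR // -mul2n.
  have := ltn_pmod m pk; rewrite {2}(divn_eq m (p ^ k)).
  by move: (m %/ p ^ k)%N (p ^ k)%N (m %% p ^ k)%N => x y z; nia.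
have {le}: (logn p 'C(m.*2, m) <= \sum_(1 <= k < m.*2.+1) (p ^ k <= m.*2))%N.
  move: le h; rewrite big_split /= -big_distrr /=.
  move: (\sum_(1 <= i < _) m %/ _)%N (\sum_(1 <= i < _) (_ <= _))%N (\sum_(1 <= i < _) _ %/ _)%N; lia.
move/leq_trans; apply.
have tl : (trunc_log p m.*2 <= m.*2)%N.
  by rewrite (leq_trans (ltnW (ltn_expl _ p1))) // trunc_logP // double_gt0.
rewrite (@big_cat_nat _ _ _ (trunc_log p m.*2).+1) //=.
rewrite [X in (_ + X)%N]big_nat_cond [X in (_ + X)%N]big1 ?addn0 => [|k /andP[/andP[lk _] _]].
  apply: (@leq_trans (\sum_(1 <= i < (trunc_log p m.*2).+1) 1)).
    by apply: leq_sum => i _; exact: leq_b1.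
  by rewrite sum_nat_const_nat subSS subn0 muln1.
by apply/eqP; rewrite eqb0 -ltnNge; rewrite (leq_trans (trunc_log_ltn _ p1)) // leq_pexp2l // ltnW.
Qed.

Lemma central_bin_ge m : (2 ^ m <= 'C(m.*2, m))%N.
Proof.
elim: m => [|m IH]; first by rewrite bin0.
rewrite doubleS expnS -[m.*2.+2]/(m.*2.+1).+1 binS.
have h : ('C(m.*2, m) <= 'C(m.*2.+1, m))%N.
  by case: m {IH} => [|m]; rewrite ?bin0 // binS leq_addr.
have h2 : ('C(m.*2, m) <= 'C(m.*2.+1, m.+1))%N by rewrite binS leq_addl.
by rewrite mul2n -addnn leq_add // (leq_trans IH).
Qed.

(* The hypothesis forces every prime power occurring in [lcm(1..2m)^e] to
   divide N, and by Kummer's theorem 'C(2m, m) divides lcm(1..2m). *)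
Lemma common_multiple_ge N m e : (0 < N)%N ->
  (forall q, (0 < q <= m.*2)%N -> (q ^ e %| N)%N) -> (2 ^ (m * e) <= N)%N.
Proof.
move=> N0 hq; have [->|m0] := posnP m; first by rewrite mul0n.
apply: (@leq_trans ('C(m.*2, m) ^ e)); first by have [->|e0] := posnP e; rewrite ?muln0 // expnM leq_exp2r ?central_bin_ge.
apply: dvdn_leq => //.
have b0 : (0 < 'C(m.*2, m))%N by rewrite bin_gt0 -addnn leq_addr.
have be0 : (0 < 'C(m.*2, m) ^ e)%N by rewrite expn_gt0 b0.
apply/dvdn_partP => // p; rewrite mem_primes => /and3P[pp _ _].
rewrite p_part lognX.
apply: (@dvdn_trans (p ^ (trunc_log p m.*2 * e))).
  by apply: dvdn_exp2l; rewrite mulnC leq_mul2r logn_central_bin ?orbT.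
rewrite expnM; apply: hq; rewrite expn_gt0 prime_gt0 //=.
by rewrite trunc_logP ?prime_gt1 // double_gt0.
Qed.

Lemma exists_nondivisor N m : (0 < N < 2 ^ m)%N ->
  exists q, (0 < q <= m.*2)%N /\ ~~ (q %| N)%N.
Proof.
case/andP=> N0 lt; apply: NNPP => h.
have : (2 ^ (m * 1) <= N)%N.
  apply: common_multiple_ge => // q hq; rewrite expn1; apply/negPn/negP => hn.
  by apply: h; exists q.
by rewrite muln1 leqNgt lt.
Qed.

(** * Slices of Jacobian rank *)

(** Identities between ring morphisms and derivations then need checking only on constants and
    variables. *)
Lemma mpoly_alg_ind n (R : comNzRingType) (P : {mpoly R[n]} -> Prop) :
  (forall c, P c%:MP) -> (forall i, P 'X_i) ->
  (forall p q, P p -> P q -> P (p + q)) -> (forall p q, P p -> P q -> P (p * q)) ->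
  forall p, P p.
Proof.
move=> hC hX hD hM; elim/mpolyind => [|c m p _ _ IH]; first by rewrite -mpolyC0.
apply: (hD) => //; rewrite -mul_mpolyC; apply: (hM) => //.
rewrite mpolyXE_id; elim/big_ind: _ => [||i _]; [by rewrite -mpolyC1|by move=> *; apply: hM|].
elim: (m i) => [|k IHk]; first by rewrite expr0 -mpolyC1.
by rewrite exprS; apply: hM.
Qed.

Fact subst_key : unit. Proof. by []. Qed.

(* [mmap] under a lock: unification would otherwise unfold it. *)
Definition subst n (R S : comNzRingType) (f : {rmorphism R -> S}) (h : 'I_n -> S) :
  {mpoly R[n]} -> S := locked_with subst_key (mmap f h).

Lemma substE n (R S : comNzRingType) (f : {rmorphism R -> S}) (h : 'I_n -> S) p :
  subst f h p = mmap f h p.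
Proof. by rewrite /subst unlock. Qed.

Section Subst.
Variables (n : nat) (R S : comNzRingType) (f : {rmorphism R -> S}) (h : 'I_n -> S).

Lemma subst_is_zmod : zmod_morphism (subst f h).
Proof. by move=> p q; rewrite !substE mmapB. Qed.

Lemma subst_is_monoid : monoid_morphism (subst f h).
Proof. by split=> [|p q]; rewrite !substE ?rmorph1 ?rmorphM. Qed.

HB.instance Definition _ := GRing.isZmodMorphism.Build _ _ (subst f h) subst_is_zmod.
HB.instance Definition _ := GRing.isMonoidMorphism.Build _ _ (subst f h) subst_is_monoid.

Lemma substC c : subst f h c%:MP = f c.
Proof. by rewrite substE mmapC. Qed.

Lemma substX i : subst f h 'X_i = h i.
Proof. by rewrite substE mmapX mmap1U. Qed.

End Subst.

Lemma mderivXU n (R : comNzRingType) (i c : 'I_n) : ('X_i : {mpoly R[n]})^`M(c) = (i == c)%:R.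
Proof.
rewrite mderivX mnm1E; case: eqP => [->|_]; last by rewrite scale0r.
rewrite scale1r -[X in 'X_[X]](_ : 0%MM = _) ?mpolyX0 //.
by apply/mnmP => j; rewrite mnmBE subnn mnm0E.
Qed.

(* Cramer's rule: the coefficients [b] do not depend on [i]. *)
Lemma jacobian_cramer n k (T : 'I_k -> {mpoly rat[n]}) r (R : 'I_r -> 'I_k) (C : 'I_r -> 'I_n) c :
  (forall (R' : 'I_r.+1 -> 'I_k) (C' : 'I_r.+1 -> 'I_n),
     \det (\matrix_(u, v) (T (R' u))^`M(C' v)) = 0) ->
  exists b : 'I_r -> {mpoly rat[n]}, forall i,
    \det (\matrix_(u, v) (T (R u))^`M(C v)) * (T i)^`M(c) = \sum_u b u * (T i)^`M(C u).
Proof.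
(* [ext] borders the minor: the row of [i] and the column of [c] are placed last. *)
move=> h; pose ext A (g : 'I_r -> A) a (u : 'I_r.+1) := if unlift ord_max u is Some u' then g u' else a.
have extl A (g : 'I_r -> A) a u : ext A g a (lift ord_max u) = g u by rewrite /ext liftK.
have extm A (g : 'I_r -> A) a : ext A g a ord_max = a by rewrite /ext unlift_none.
have wl (u : 'I_r) : widen_ord (leqnSn r) u = lift ord_max u by apply: val_inj; rewrite /= /bump leqNgt ltn_ord.
pose N v : 'M[{mpoly rat[n]}]_r := \matrix_(u, w) (T (R u))^`M(ext _ C c (lift v w)).
exists (fun u : 'I_r => - ((-1) ^+ (r + u) * \det (N (lift ord_max u)))) => i.
(* The bordered minor vanishes. Its cofactors along the last row involve only the rows [R], so they
   do not depend on [i]. *)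
have := h (ext _ R i) (ext _ C c).
rewrite (expand_det_row _ ord_max) big_ord_recr /= => /eqP; rewrite addrC addr_eq0 => /eqP e.
have cof v : cofactor (\matrix_(u, v) (T (ext _ R i u))^`M(ext _ C c v)) ord_max v =
  (-1) ^+ (r + v) * \det (N v).
  by rewrite /cofactor; congr (_ * \det _); apply/matrixP => u w; rewrite !mxE extl.
have Nm : N ord_max = \matrix_(u, v) (T (R u))^`M(C v).
  by apply/matrixP => u w; rewrite !mxE extl.
move: e; rewrite cof Nm mxE !extm /= -signr_odd oddD addbb expr0 mul1r mulrC => ->.
rewrite -sumrN; apply: eq_bigr => u _.
by rewrite cof mxE wl extm extl mulrC mulNr /= /bump leqNgt ltn_ord.
Qed.

Section Slice.
Variables (n : nat) (psi : 'I_n -> rat) (C : {pred 'I_n}).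

(** The new variable scales the coordinates outside [C]: its value 0 gives the slice through [psi],
    its value 1 the whole space. *)
Definition slice_map : {mpoly rat[n]} -> {poly {mpoly rat[n]}} :=
  subst (polyC \o @mpolyC n rat)
    (fun i => (psi i)%:MP%:P + (if i \in C then ('X_i)%:P else ('X_i)%:P * 'X)).

HB.instance Definition _ := GRing.RMorphism.on slice_map.

Lemma slice_mapC c : slice_map c%:MP = c%:MP%:P.
Proof. exact: substC. Qed.

Lemma slice_mapX i : slice_map 'X_i =
  (psi i)%:MP%:P + (if i \in C then ('X_i)%:P else ('X_i)%:P * 'X).
Proof. exact: substX. Qed.

Lemma deriv_slice_map p : (slice_map p)^`() =
  \sum_(c | c \notin C) ('X_c)%:P * slice_map p^`M(c).
Proof.
elim/mpoly_alg_ind: p => [c|i|p q hp hq|p q hp hq].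
- rewrite slice_mapC derivC big1 // => i _.
  by rewrite mderivC rmorph0 mulr0.
- rewrite slice_mapX derivD derivC add0r.
  have e c : slice_map ('X_i)^`M(c) = (i == c)%:R by rewrite mderivXU; case: eqP; rewrite ?rmorph0 ?rmorph1.
  under eq_bigr do rewrite e.
  case: ifP => iC.
    rewrite derivC big1 // => c cC; case: eqP => [ic|_]; last by rewrite mulr0.
    by rewrite -ic iC in cC.
  rewrite derivM derivC mul0r add0r derivX mulr1 (bigD1 i) ?iC //= eqxx mulr1 big1 ?addr0 //.
  by move=> c /andP[_ ci]; rewrite eq_sym (negbTE ci) mulr0.
- rewrite rmorphD derivD hp hq -big_split /=; apply: eq_bigr => c _.
  by rewrite mderivD rmorphD mulrDr.
rewrite rmorphM derivM hp hq big_distrl big_distrr -big_split /=; apply: eq_bigr => c _.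
by rewrite mderivM rmorphD !rmorphM /=; ring.
Qed.

(** Directions in [C] are not scaled, so differentiating along them respects the order in the
    scaling variable: a vanishing coefficient of the image of [p] also vanishes for its
    derivative. *)
Lemma coef_slice_map_deriv c p j : c \in C ->
  (slice_map p^`M(c))`_j = ((slice_map p)`_j)^`M(c).
Proof.
move=> cC; elim/mpoly_alg_ind: p j => [a|i|p q hp hq|p q hp hq] j.
- rewrite (mderivC c a).
  have -> : slice_map 0 = 0 by exact: rmorph0.
  rewrite slice_mapC.
  etransitivity; first exact: coef0.
  symmetry; rewrite coefC; case: (j == 0%N); first exact: mderivC.
  exact: mderiv0.
- apply: (@eq_trans _ _ ((i == c) && (j == 0%N))%:R).
    rewrite mderivXU; case: eqP => _ /=; last by rewrite (_ : slice_map _ = 0) ?coef0 // rmorph0.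
    by rewrite (_ : slice_map _ = 1) ?coef1 // rmorph1.
  symmetry; rewrite slice_mapX coefD mderivD.
  have -> : (((psi i)%:MP_[n])%:P)`_j^`M(c) = 0.
    by rewrite coefC; case: (j == 0%N); rewrite ?mderivC ?mderiv0.
  rewrite add0r; case: (boolP (i \in C)) => iC.
    by rewrite coefC; case: (j == 0%N); rewrite ?andbF ?mderiv0 // mderivXU andbT.
  rewrite coefCM coefX; have -> : (i == c) = false by apply: contraNF iC => /eqP ->.
  case: (j == 1%N); rewrite ?mulr0 ?mderiv0 // mulr1 mderivXU.
  by have -> : (i == c) = false by apply: contraNF iC => /eqP ->.
- by rewrite mderivD rmorphD !coefD hp hq rmorphD coefD mderivD.
rewrite mderivM rmorphD !rmorphM coefD !coefM -big_split /=.
rewrite [RHS](raddf_sum (mderiv c)) /=; apply: eq_bigr => l _.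
by rewrite hp hq [RHS]mderivM.
Qed.

Lemma horner_slice_map p (e : rat) x : ((slice_map p).[e%:MP]).@[x] =
  p.@[fun i => psi i + (if i \in C then x i else x i * e)].
Proof.
elim/mpoly_alg_ind: p => [a|i|p q hp hq|p q hp hq].
- by rewrite slice_mapC hornerC !mevalC.
- rewrite slice_mapX hornerD hornerC mevalD mevalC mevalXU; case: ifP => _.
    by rewrite hornerC mevalXU.
  by rewrite hornerM hornerC hornerX mevalM mevalXU mevalC.
- by rewrite rmorphD hornerD !mevalD hp hq.
by rewrite rmorphM hornerM !mevalM hp hq.
Qed.

End Slice.

(* If the Jacobian of the T_i has rank r, then locally around psi the T_i are
   functions of r of them, so a combination of the T_i vanishing on the slice
   psi + <e_{C u} : u < r> vanishes identically.  Algebraically: every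
   derivative of f is a combination of derivatives along the slice, which is
   incompatible with f having positive finite order along the slice. *)
Lemma jacobian_slice n k (T : 'I_k -> {mpoly rat[n]}) r (R : 'I_r -> 'I_k) (C : 'I_r -> 'I_n)
    (psi : 'I_n -> rat) :
  (forall (R' : 'I_r.+1 -> 'I_k) (C' : 'I_r.+1 -> 'I_n),
     \det (\matrix_(u, v) (T (R' u))^`M(C' v)) = 0) ->
  (\det (\matrix_(u, v) (T (R u))^`M(C v))).@[psi] != 0 -> \sum_i T i != 0 ->
  exists Y : 'I_n -> rat, (forall i, i \notin codom C -> Y i = 0) /\
    (\sum_i T i).@[fun i => psi i + Y i] != 0.
Proof.
move=> hmin; set M := \det _ => hM f0; apply: NNPP => hY.
set f := \sum_i T i in f0 hY *.
pose Phi := slice_map psi (ssrbool.mem (codom C)); pose g := Phi f.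
have g0 : g != 0.
  have [x hx] := mpoly_nonroot f0; apply: contraNneq hx => g0.
  have := horner_slice_map psi (ssrbool.mem (codom C)) f 1 (fun i => x i - psi i).
  rewrite -/(Phi f) -/g g0 horner0 meval0 => /esym e; apply/eqP; rewrite -[RHS]e.
  by apply: meval_eq => i /=; rewrite mulr1 if_same addrC subrK.
have gc0 : g`_0 = 0.
  rewrite -horner_coef0; apply: mpoly_eq0_meval => x.
  have := horner_slice_map psi (ssrbool.mem (codom C)) f 0 x; rewrite mpolyC0 -/(Phi f) -/g => ->.
  apply/eqP; apply: contra_notT hY => h.
  exists (fun i => if i \in codom C then x i else x i * 0); split=> // i.
  by move/negbTE => ->; rewrite mulr0.
(* [m] is the order of [f] in the scaling variable, positive because [f] is assumed to vanish on the
   slice. *)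
have [m gm ltm] : exists2 m, g`_m != 0 & forall j, (j < m)%N -> g`_j = 0.
  have ex : exists m, g`_m != 0 by exists (size g).-1; rewrite -lead_coefE lead_coef_eq0.
  exists (ex_minn ex); case: ex_minnP => // m _ h j jm.
  by apply/eqP; apply: contraTT jm => /h; rewrite -leqNgt.
have m0 : (0 < m)%N by case: m gm {ltm} => //; rewrite gc0 eqxx.
have pde : exists b : 'I_n -> 'I_r -> {mpoly rat[n]}, forall c,
    M * f^`M(c) = \sum_u b c u * f^`M(C u).
  have: forall c, exists b : 'I_r -> {mpoly rat[n]}, M * f^`M(c) = \sum_u b u * f^`M(C u).
    move=> c; have [b hb] := jacobian_cramer R C c hmin; exists b.
    rewrite !raddf_sum /= big_distrr /=; under eq_bigr do rewrite hb.
    rewrite exchange_big /=; apply: eq_bigr => u _.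
    by rewrite raddf_sum /= big_distrr.
  by case/(@fin_all_exists _ _ _) => b hb; exists b.
case: pde => b hb.
have e : Phi M * g^`() = \sum_(c | c \notin codom C) \sum_u
    ('X_c)%:P * (Phi (b c u) * Phi f^`M(C u)).
  rewrite deriv_slice_map big_distrr /=; apply: eq_bigr => c _.
  rewrite mulrCA -rmorphM /= hb rmorph_sum big_distrr /=; apply: eq_bigr => u _.
  by rewrite rmorphM.
(* In order [m - 1] the right side is zero, since derivatives along [C] have order at least [m]. On
   the left only [m * g_m] times the order-0 part of the minor survives, so that part must be
   zero. *)
have := congr1 (fun p : {poly {mpoly rat[n]}} => p`_m.-1) e.
rewrite coef_sum [RHS]big1 => [|c _]; last first.
  rewrite coef_sum big1 // => u _; rewrite coefCM coefM big1 ?mulr0 // => j _.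
  rewrite coef_slice_map_deriv ?codom_f // ltm ?mderiv0 ?mulr0 //.
  by case: m m0 {gm ltm} j => //= m _ j; rewrite ltnS leq_subr.
rewrite coefM big_ord_recl /= big1 => [|j _]; last first.
  rewrite coef_deriv ltm ?mul0rn ?mulr0 //.
  by case: m m0 {gm ltm} j => //= m _ [j hj] /=; rewrite /bump /=; lia.
rewrite subn0 coef_deriv prednK // addr0 => /eqP; rewrite mulrnAr -mulr_natr !mulf_eq0 (negbTE gm) orbF.
rewrite -mpolyC_nat mpolyC_eq0 pnatr_eq0 -leqn0 leqNgt m0 orbF => /eqP e0.
(* At the origin the order-0 part of the minor takes its value at [psi], which is not zero. *)
have := horner_slice_map psi (ssrbool.mem (codom C)) M 0 (fun _ => 0).
rewrite mpolyC0 -/(Phi M) horner_coef0 e0 meval0 => /esym z.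
case/negP: hM; rewrite -[X in _ == X]z; apply/eqP; apply: meval_eq => i.
by rewrite mul0r if_same addr0.
Qed.

(** * Programs for the random access machine *)

Definition agree m (M M' : mem) := forall i, (i < m)%N -> M' (Posz i) = M (Posz i).

Lemma agree_refl m M : agree m M M. Proof. by []. Qed.

Lemma agree_trans m M1 M2 M3 : agree m M1 M2 -> agree m M2 M3 -> agree m M1 M3.
Proof. by move=> h1 h2 i im; rewrite h2 // h1. Qed.

Lemma agree_le m m' M M' : (m <= m')%N -> agree m' M M' -> agree m M M'.
Proof. by move=> h h' i im; apply: h'; apply: leq_trans im h. Qed.

Lemma agree_upd m M M' i v : (m <= i)%N -> agree m M M' -> agree m M (upd M' (Posz i) v).
Proof.
move=> mi h j jm; rewrite /upd eqz_nat; case: eqP => [e|_]; last exact: h.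
by move: jm; rewrite e ltnNge mi.
Qed.

Lemma updE (M : mem) (i j : nat) v : upd M (Posz i) v (Posz j) = if j == i then v else M (Posz j).
Proof. by rewrite /upd eqz_nat. Qed.

(* A term maps a register [m] to a program that leaves its value in [m] and
   only touches registers from [m] on. *)
Definition term := nat -> cmd.

Definition computes (c : cmd) (m : nat) (M : mem) (v T : nat) :=
  exists t M', [/\ exec c M t M' [::], (t <= T)%N, M' (Posz m) = Posz v & agree m M M'].

(** [M] matters only below [m0]: the term has to work from every memory that agrees there, and with
    every scratch register from [m0] on, so it can be rerun inside loops. Time is recorded as an
    exponent of one base [B], so each construction adds a constant to it. *)
Definition den (B j m0 : nat) (M : mem) (a : term) (v : nat) :=
  forall m M', (m0 <= m)%N -> agree m0 M M' -> computes (a m) m M' v (B ^ j).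

Lemma den_agree B j m m' M M' a v :
  den B j m M a v -> (m <= m')%N -> agree m M M' -> den B j m' M' a v.
Proof.
move=> h mm ag m1 M1 h1 ag1; apply: h; first exact: leq_trans mm h1.
exact: agree_trans ag (agree_le mm ag1).
Qed.

Lemma den_le B j j' m M a v : (0 < B)%N -> (j <= j')%N -> den B j m M a v -> den B j' m M a v.
Proof.
move=> B0 jj h m1 M1 h1 ag; have [t [M' [e lt ev ag']]] := h m1 M1 h1 ag.
by exists t, M'; split=> //; apply: leq_trans lt _; rewrite leq_pexp2l.
Qed.

Definition tvar (i : nat) : term := fun m => Seq (Const (Posz m) 0) (Add (Posz m) (Posz i) (Posz m)).
Definition tconst (c : nat) : term := fun m => Const (Posz m) (Posz c).
Definition tadd (a b : term) : term := fun m =>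
  Seq (a m) (Seq (b m.+1) (Add (Posz m) (Posz m) (Posz m.+1))).
Definition tsub (a b : term) : term := fun m =>
  Seq (a m) (Seq (b m.+1) (Seq (Sub (Posz m) (Posz m) (Posz m.+1))
    (IfPos (Posz m) Skip (Const (Posz m) 0)))).
(* register layout: m = state, m+1 = index, m+2 = remaining rounds, m+3 = 1 *)
Definition trec (n a : term) (f : term -> term -> term) : term := fun m =>
  Seq (a m) (Seq (n m.+2) (Seq (Const (Posz m.+1) 0) (Seq (Const (Posz m.+3) 1)
  (WhilePos (Posz m.+2)
    (Seq (f (tvar m.+1) (tvar m) m.+4) (Seq (Const (Posz m) 0) (Seq (Add (Posz m) (Posz m) (Posz m.+4))
    (Seq (Add (Posz m.+1) (Posz m.+1) (Posz m.+3)) (Sub (Posz m.+2) (Posz m.+2) (Posz m.+3)))))))))).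

Fixpoint natrec (n : nat) (a : nat) (F : nat -> nat -> nat) : nat :=
  if n is n'.+1 then F n' (natrec n' a F) else a.

Lemma exec_seq0 p q M M1 M2 t1 t2 t : exec p M t1 M1 [::] -> exec q M1 t2 M2 [::] ->
  t = (t1 + t2)%N -> exec (Seq p q) M t M2 [::].
Proof. by move=> h1 h2 ->; exact: (ExSeq h1 h2). Qed.

Section Den.
Variables (B : nat) (B10 : (16 <= B)%N).

Lemma B_gt0 : (0 < B)%N. Proof. exact: leq_trans B10. Qed.

(** [B] dominates the constants of all constructions, so a bounded number of steps of cost [B ^ j]
    fits into the next power. *)
Lemma powB (j x y : nat) : (x <= y * B ^ j)%N -> (y <= B)%N -> (x <= B ^ j.+1)%N.
Proof. by move=> h yB; apply: (leq_trans h); rewrite expnS leq_mul2r yB orbT. Qed.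

Lemma powB_le j j' : (j <= j')%N -> (B ^ j <= B ^ j')%N.
Proof. by move=> h; rewrite leq_pexp2l // B_gt0. Qed.

Lemma powB_pos j : (0 < B ^ j)%N. Proof. by rewrite expn_gt0 B_gt0. Qed.

Lemma den_var m M i v : (i < m)%N -> M (Posz i) = Posz v -> den B 1 m M (tvar i) v.
Proof.
move=> im Mi m1 M1 h ag; exists 2%N, (upd (upd M1 (Posz m1) 0) (Posz m1) (Posz v)); split.
- apply: (exec_seq0 (ExConst _ _ _) _ (erefl (1 + 1)%N)).
  have := ExAdd (Posz m1) (Posz i) (Posz m1) (upd M1 (Posz m1) 0).
  rewrite !updE eqxx (ltn_eqF (leq_trans im h)) ag // Mi addr0; exact.
- by rewrite expn1; apply: leq_trans B10.
- by rewrite updE eqxx.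
by do 2!apply: agree_upd => //.
Qed.

Lemma den_const m M c : den B 1 m M (tconst c) c.
Proof.
move=> m1 M1 h ag; exists 1%N, (upd M1 (Posz m1) (Posz c)); split=> //.
- exact: ExConst.
- by rewrite expn1 B_gt0.
- by rewrite updE eqxx.
exact: agree_upd.
Qed.

Lemma den_add j1 j2 m M a b x y : den B j1 m M a x -> den B j2 m M b y ->
  den B (maxn j1 j2).+1 m M (tadd a b) (x + y).
Proof.
move=> ha hb m1 M1 h ag; have [t1 [M2 [e1 l1 v1 a1]]] := ha m1 M1 h ag.
have [t2 [M3 [e2 l2 v2 a2]]] := hb m1.+1 M2 (leqW h) (agree_trans ag (agree_le h a1)).
exists (t1 + (t2 + 1))%N, (upd M3 (Posz m1) (Posz (x + y)%N)); split.
- apply: (exec_seq0 e1 _ erefl); apply: (exec_seq0 e2 _ erefl).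
  have := ExAdd (Posz m1) (Posz m1) (Posz m1.+1) M3.
  by rewrite v2 (a2 m1 (leqnn _)) v1.
- apply: (@powB _ _ 3); last exact: leq_trans B10.
  have := leq_trans l1 (powB_le (leq_maxl j1 j2)); have := leq_trans l2 (powB_le (leq_maxr j1 j2)).
  by have := powB_pos (maxn j1 j2); lia.
- by rewrite updE eqxx.
by apply: agree_upd => //; apply: agree_trans a1 (agree_le (leqnSn _) a2).
Qed.

Lemma den_sub j1 j2 m M a b x y : den B j1 m M a x -> den B j2 m M b y ->
  den B (maxn j1 j2).+1 m M (tsub a b) (x - y).
Proof.
move=> ha hb m1 M1 h ag; have [t1 [M2 [e1 l1 v1 a1]]] := ha m1 M1 h ag.
have [t2 [M3 [e2 l2 v2 a2]]] := hb m1.+1 M2 (leqW h) (agree_trans ag (agree_le h a1)).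
have e3 := ExSub (Posz m1) (Posz m1) (Posz m1.+1) M3.
rewrite v2 (a2 m1 (leqnn _)) v1 in e3.
set M4 := upd M3 _ _ in e3.
have a4 : agree m1 M1 M4.
  by apply: agree_upd => //; apply: agree_trans a1 (agree_le (leqnSn _) a2).
have [t3 [M5 [e5 l5 v5 a5]]] : exists t3 M5, [/\ exec (IfPos (Posz m1) Skip (Const (Posz m1) 0)) M4 t3 M5 [::],
   (t3 <= 2)%N, M5 (Posz m1) = Posz (x - y)%N & agree m1 M1 M5].
  have [le|lt] := leqP x y.
    exists 2%N, (upd M4 (Posz m1) 0); split=> //.
    - by apply: ExIfFalse (ExConst _ _ _); rewrite /M4 updE eqxx subr_le0 lez_nat.
    - by rewrite updE eqxx; have /eqP -> : (x - y == 0)%N by rewrite subn_eq0.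
    exact: agree_upd.
  exists 2%N, M4; split=> //.
  - by apply: ExIfTrue (ExSkip _); rewrite /M4 updE eqxx subr_gt0 ltz_nat.
  by rewrite /M4 updE eqxx subzn // ltnW.
exists (t1 + (t2 + (1 + t3)))%N, M5; split=> //.
- by apply: (exec_seq0 e1 _ erefl); apply: (exec_seq0 e2 _ erefl); apply: (exec_seq0 e3 e5 erefl).
apply: (@powB _ _ 5); last exact: leq_trans B10.
have := leq_trans l1 (powB_le (leq_maxl j1 j2)); have := leq_trans l2 (powB_le (leq_maxr j1 j2)).
by have := powB_pos (maxn j1 j2); lia.
Qed.

(** There are at most [B] rounds, each of cost [B ^ j] plus a constant, which raises the exponent by
    two. The body is only required to work on states that are actually reached; this gives access to
    bounds on the accumulator. *)
Lemma den_rec jn ja jf m M n a f N A F :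
  den B jn m M n N -> den B ja m M a A -> (N <= B)%N ->
  (forall m' M' x y i acc, (m <= m')%N -> agree m M M' -> den B 1 m' M' x i -> den B 1 m' M' y acc ->
     (i < N)%N -> acc = natrec i A F -> den B jf m' M' (f x y) (F i acc)) ->
  den B (maxn (maxn jn ja) jf).+2 m M (trec n a f) (natrec N A F).
Proof.
move=> hn ha NB hf m1 M1 h ag; have [t1 [M2 [e1 l1 v1 a1]]] := ha m1 M1 h ag.
have [t2 [M3 [e2 l2 v2 a2]]] := hn m1.+2 M2 (leqW (leqW h)) (agree_trans ag (agree_le h a1)).
set j := maxn _ jf.
have jn_j : (B ^ jn <= B ^ j)%N by apply: powB_le; rewrite /j; lia.
have ja_j : (B ^ ja <= B ^ j)%N by apply: powB_le; rewrite /j; lia.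
have jf_j : (B ^ jf <= B ^ j)%N by apply: powB_le; rewrite /j; lia.
rewrite /trec; set body := Seq (f _ _ _) _.
have loop : forall r i acc M4, (i + r = N)%N -> agree m1 M1 M4 -> M4 (Posz m1) = Posz acc ->
   M4 (Posz m1.+1) = Posz i -> M4 (Posz m1.+2) = Posz r -> M4 (Posz m1.+3) = 1 ->
   acc = natrec i A F ->
   exists t M5, [/\ exec (WhilePos (Posz m1.+2) body) M4 t M5 [::], (t <= r * (B ^ j + 5) + 1)%N,
     M5 (Posz m1) = Posz (natrec N A F) & agree m1 M1 M5].
  elim=> [|r IH] i acc M4 ir ag4 vacc vi vr v1' eacc.
    exists 1%N, M4; split=> //; first by apply: ExWhileStop; rewrite vr.
    by rewrite vacc eacc -ir addn0.
  have dx : den B 1 m1.+2 M4 (tvar m1.+1) i by apply: den_var.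
  have dy : den B 1 m1.+2 M4 (tvar m1) acc by apply: den_var.
  have iN : (i < N)%N by rewrite -ir addnS ltnS leq_addr.
  have df := hf m1.+2 M4 _ _ i acc (leqW (leqW h)) (agree_trans ag (agree_le h ag4)) dx dy iN eacc.
  have [t5 [M5 [e5 l5 v5 a5]]] := df m1.+4 M4 (leqW (leqnSn _)) (@agree_refl _ _).
  pose M6 := upd M5 (Posz m1) 0.
  pose M7 := upd M6 (Posz m1) (Posz (F i acc)).
  pose M8 := upd M7 (Posz m1.+1) (Posz i.+1).
  pose M9 := upd M8 (Posz m1.+2) (Posz r).
  have q1 : (m1.+1 == m1) = false by lia.
  have q2 : (m1.+2 == m1) = false by lia.
  have q3 : (m1.+3 == m1) = false by lia.
  have q4 : (m1.+4 == m1) = false by lia.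
  have q5 : (m1 == m1.+1) = false by lia.
  have q6 : (m1 == m1.+2) = false by lia.
  have w1 : M5 (Posz m1.+1) = Posz i by rewrite a5 //; lia.
  have w2 : M5 (Posz m1.+2) = Posz r.+1 by rewrite a5 //; lia.
  have w3 : M5 (Posz m1.+3) = 1 by rewrite a5 //; lia.
  have e7 : exec (Add (Posz m1) (Posz m1) (Posz m1.+4)) M6 1 M7 [::].
    have := ExAdd (Posz m1) (Posz m1) (Posz m1.+4) M6.
    by rewrite /M7 /M6 !updE eqxx q4 add0r v5.
  have e8 : exec (Add (Posz m1.+1) (Posz m1.+1) (Posz m1.+3)) M7 1 M8 [::].
    have := ExAdd (Posz m1.+1) (Posz m1.+1) (Posz m1.+3) M7.
    have -> : M7 (Posz m1.+1) = Posz i by rewrite /M7 /M6 !updE q1 w1.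
    have -> : M7 (Posz m1.+3) = 1 by rewrite /M7 /M6 !updE q3 w3.
    by rewrite (_ : Posz i + 1 = Posz i.+1) // -addn1 PoszD.
  have e9 : exec (Sub (Posz m1.+2) (Posz m1.+2) (Posz m1.+3)) M8 1 M9 [::].
    have := ExSub (Posz m1.+2) (Posz m1.+2) (Posz m1.+3) M8.
    have -> : M8 (Posz m1.+2) = Posz r.+1.
      rewrite /M8 /M7 /M6 !updE; do 2!(case: eqP => [/eqP|_]; first lia).
      exact: w2.
    have -> : M8 (Posz m1.+3) = 1.
      rewrite /M8 /M7 /M6 !updE; do 2!(case: eqP => [/eqP|_]; first lia).
      exact: w3.
    by rewrite (_ : Posz r.+1 - 1 = Posz r) // -addn1 PoszD addrK.
  have ebody : exec body M4 (t5 + (1 + (1 + (1 + 1)))) M9 [::].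
    apply: (exec_seq0 e5 _ erefl); apply: (exec_seq0 (ExConst _ _ _) _ erefl).
    by apply: (exec_seq0 e7 _ erefl); apply: (exec_seq0 e8 e9 erefl).
  have ag9 : agree m1 M1 M9.
    apply: agree_upd; [lia|apply: agree_upd; [lia|do 2!apply: agree_upd => //]].
    by apply: agree_trans ag4 (agree_le _ a5); lia.
  have [||||||t10 [M10 [e10 l10 v10 a10]]] := IH i.+1 (F i acc) M9 _ ag9.
  - by rewrite addSn -addnS.
  - by rewrite /M9 /M8 /M7 !updE q6 q5 eqxx.
  - by rewrite /M9 /M8 !updE eqxx; case: eqP => // /eqP; lia.
  - by rewrite /M9 updE eqxx.
  - rewrite /M9 /M8 /M7 /M6 !updE w3.
    by do 2!(case: eqP => [/eqP|_]; first lia); rewrite q3.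
  - by rewrite eacc.
  exists (t5 + (1 + (1 + (1 + 1))) + t10).+1, M10; split=> //.
  - by apply: (ExWhileLoop _ ebody e10); rewrite vr.
  rewrite mulSn; move: l5 jf_j l10; move: (B ^ jf)%N (B ^ j)%N (r * _)%N => X Y Z; lia.
pose M4 := upd (upd M3 (Posz m1.+1) 0) (Posz m1.+3) 1.
have [||||||t5 [M5 [e5 l5 v5 a5]]] := loop N 0%N A M4 (add0n _).
- do 2!(apply: agree_upd; first lia).
  by apply: agree_trans a1 (agree_le _ a2); lia.
- rewrite /M4 !updE a2 ?v1; last lia.
  by do 2!(case: eqP => [/eqP|_]; first lia).
- by rewrite /M4 !updE eqxx; case: eqP => [/eqP|_] //; lia.
- rewrite /M4 !updE v2.
  by do 2!(case: eqP => [/eqP|_]; first lia).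
- by rewrite /M4 updE eqxx.
- by [].
exists (t1 + (t2 + (1 + (1 + t5))))%N, M5; split=> //.
- apply: (exec_seq0 e1 _ erefl); apply: (exec_seq0 e2 _ erefl).
  by apply: (exec_seq0 (ExConst _ _ _) _ erefl); apply: (exec_seq0 (ExConst _ _ _) e5 erefl).
apply: (@powB _ _ 8); last exact: leq_trans B10.
have : (t5 <= B * (6 * B ^ j) + 1)%N.
  apply: leq_trans l5 _; rewrite leq_add2r leq_mul //.
  by have := powB_pos j; move: (B ^ j)%N; lia.
have := powB_pos j; rewrite expnS.
move: (leq_trans l1 ja_j) (leq_trans l2 jn_j); move: (B ^ j)%N => X.
have : (16 * X <= B * X)%N by rewrite leq_mul2r B10 orbT.
rewrite (mulnCA B 6); move: (B * X)%N; lia.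
Qed.

Definition tifz (c a b : term) : term := fun m => Seq (c m) (IfPos (Posz m) (b m) (a m)).

Lemma den_ifz0 j1 j2 m M c a b x y z : den B j1 m M c x -> den B j2 m M a y -> den B j2 m M b z ->
  den B (maxn j1 j2).+1 m M (tifz c a b) (if x == 0%N then y else z).
Proof.
move=> hc ha hb m1 M1 h ag; have [t1 [M2 [e1 l1 v1 a1]]] := hc m1 M1 h ag.
have ag2 := agree_trans ag (agree_le h a1).
have [t [M3 [e l v a3]]] : computes (if x == 0%N then a m1 else b m1) m1 M2 (if x == 0%N then y else z) (B ^ j2).
  by case: (x == 0%N); [exact: ha|exact: hb].
exists (t1 + t.+1)%N, M3; split=> //; last exact: agree_trans a1 a3.
  apply: (exec_seq0 e1 _ erefl); move: e; case: eqP => [x0|/eqP x0] e.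
    by apply: ExIfFalse e; rewrite v1 x0.
  by apply: ExIfTrue e; rewrite v1 ltz_nat lt0n.
apply: (@powB _ _ 3); last exact: leq_trans B10.
have := leq_trans l1 (powB_le (leq_maxl j1 j2)); have := leq_trans l (powB_le (leq_maxr j1 j2)).
by have := powB_pos (maxn j1 j2); lia.
Qed.

Notation D := (den B).

Lemma den_up j m M a v : D 1 m M a v -> D j.+1 m M a v.
Proof. exact: (den_le B_gt0). Qed.

Lemma den_cst j m M c : D j.+1 m M (tconst c) c.
Proof. by apply: den_up; exact: den_const. Qed.

Lemma den_plus j m M a b x y : D j m M a x -> D j m M b y -> D j.+1 m M (tadd a b) (x + y).
Proof. by move=> ha hb; have := den_add ha hb; rewrite maxnn. Qed.

Lemma den_minus j m M a b x y : D j m M a x -> D j m M b y -> D j.+1 m M (tsub a b) (x - y).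
Proof. by move=> ha hb; have := den_sub ha hb; rewrite maxnn. Qed.

Lemma den_ifz j m M c a b x y z : D j m M c x -> D j m M a y -> D j m M b z ->
  D j.+1 m M (tifz c a b) (if x == 0%N then y else z).
Proof. by move=> hc ha hb; have := den_ifz0 hc ha hb; rewrite maxnn. Qed.

Lemma den_loop j m M n a f N A F :
  D j m M n N -> D j m M a A -> (N <= B)%N ->
  (forall m' M' x y i acc, (m <= m')%N -> agree m M M' -> D 1 m' M' x i -> D 1 m' M' y acc ->
     (i < N)%N -> acc = natrec i A F -> D j m' M' (f x y) (F i acc)) ->
  D j.+2 m M (trec n a f) (natrec N A F).
Proof. by move=> hn ha NB hf; have := den_rec hn ha NB hf; rewrite !maxnn. Qed.

(** Without a multiplication instruction, every operation iterates a simpler one. The operand that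
    drives the loop must be at most [B], while the other one may be arbitrarily large. *)
Definition tmul a b := trec b (tconst 0) (fun _ acc => tadd acc a).

Lemma den_mul j m M a b x y : D j.+1 m M a x -> D j.+1 m M b y -> (y <= B)%N ->
  D j.+4 m M (tmul a b) (x * y).
Proof.
move=> ha hb yB; rewrite (_ : (x * y)%N = natrec y 0 (fun _ acc => acc + x)%N); last first.
  by elim: y {hb yB} => [|y IH]; rewrite ?muln0 // mulnSr IH.
apply: den_loop => //; [by apply: (den_le B_gt0 _ hb); lia|exact: den_cst|].
move=> m' M' x' y' i acc mm ag _ hy _ _; apply: den_plus; first exact: den_up.
exact: den_agree ha mm ag.
Qed.

Definition tpow a b := trec b (tconst 1) (fun _ acc => tmul acc a).

Lemma den_pow j m M a b x y : D j.+1 m M a x -> D j.+1 m M b y -> (x <= B)%N -> (y <= B)%N ->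
  D j.+4.+2 m M (tpow a b) (x ^ y).
Proof.
move=> ha hb xB yB; rewrite (_ : (x ^ y)%N = natrec y 1 (fun _ acc => acc * x)%N); last first.
  by elim: y {hb yB} => [|y IH] //; rewrite expnSr IH.
apply: den_loop => //; [by apply: (den_le B_gt0 _ hb); lia|exact: den_cst|].
move=> m' M' x' y' i acc mm ag _ hy _ _; apply: den_mul => //; first exact: den_up.
exact: den_agree ha mm ag.
Qed.

(** Vanishes exactly for equal values, since one of two opposite truncated differences is always
    zero. *)
Definition teq a b := tadd (tsub a b) (tsub b a).

Lemma den_eq j m M a b x y : D j m M a x -> D j m M b y ->
  D j.+2 m M (teq a b) ((x - y) + (y - x)).
Proof. by move=> ha hb; apply: den_plus; apply: den_minus. Qed.

Lemma eq_sub0 x y : (((x - y) + (y - x))%N == 0%N) = (x == y).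
Proof. by apply/eqP/eqP; lia. Qed.

(** A cyclic counter advanced [a] times and reset on reaching [b]. *)
Definition tmod a b := trec a (tconst 0)
  (fun _ acc => tifz (teq (tadd acc (tconst 1)) b) (tconst 0) (tadd acc (tconst 1))).

Lemma den_mod j m M a b x p : D j.+1 m M a x -> D j.+2 m M b p -> (x <= B)%N -> (0 < p)%N ->
  D j.+4.+3 m M (tmod a b) (x %% p).
Proof.
move=> ha hb xB p0; rewrite (_ : (x %% p)%N = natrec x 0 (fun _ acc =>
   if ((acc + 1 - p) + (p - (acc + 1)))%N == 0%N then 0 else acc + 1)%N); last first.
  elim: x {ha xB} => [|x IH]; first by rewrite mod0n.
  rewrite /= -IH eq_sub0 addn1 modnS; congr (if _ then _ else _).
  apply/idP/eqP => [d|e].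
    move: d; rewrite {1}(divn_eq x p) -addnS dvdn_addr ?dvdn_mull // => d.
    by apply/eqP; rewrite eqn_leq ltn_pmod // dvdn_leq.
  by apply/dvdnP; exists (x %/ p).+1; rewrite mulSn {1}(divn_eq x p) -addnS e addnC.
apply: den_loop => //; [by apply: (den_le B_gt0 _ ha); lia|exact: den_cst|].
move=> m' M' x' y' i acc mm ag _ hy _ _; apply: den_ifz; [|exact: den_cst|].
  apply: den_eq; first by apply: den_plus; [exact: den_up|exact: den_cst].
  exact: den_agree hb mm ag.
by apply: den_plus; [exact: den_up|exact: den_cst].
Qed.

(** Counts the multiples of [b] among 1, ..., [a]. *)
Definition tdiv a b := trec a (tconst 0)
  (fun i acc => tifz (tmod (tadd i (tconst 1)) b) (tadd acc (tconst 1)) acc).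

Lemma den_div j m M a b x p : D j.+1 m M a x -> D j.+3 m M b p -> (x <= B)%N -> (0 < p)%N ->
  D j.+4.+4.+3 m M (tdiv a b) (x %/ p).
Proof.
move=> ha hb xB p0; rewrite (_ : (x %/ p)%N = natrec x 0 (fun i acc =>
   if ((i + 1) %% p)%N == 0%N then acc + 1 else acc)%N); last first.
  elim: x {ha xB} => [|x IH]; first by rewrite div0n.
  rewrite [RHS]/= -IH addn1 divnS // /dvdn; case: (_ == 0%N); rewrite ?addn1 //.
apply: den_loop => //; [by apply: (den_le B_gt0 _ ha); lia|exact: den_cst|].
move=> m' M' x' y' i acc mm ag hx hy ix _; apply: den_ifz; [|apply: den_plus; [exact: den_up|exact: den_cst]|exact: den_up].
apply: den_mod => //; [by apply: den_plus; [exact: den_up|exact: den_cst]|exact: den_agree hb mm ag|lia].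
Qed.

(** Counts the exponents e >= 1 with 2^e at most [a]; [a] rounds suffice, as the logarithm is
    smaller than its argument. *)
Definition tlog a := trec a (tconst 0)
  (fun i acc => tifz (tsub (tpow (tconst 2) (tadd i (tconst 1))) a) (tadd acc (tconst 1)) acc).

Lemma den_log j m M a s : D j.+4.+3 m M a s -> (0 < s <= B)%N ->
  D j.+4.+4.+3 m M (tlog a) (log2 s).
Proof.
move=> ha /andP[s0 sB]; pose F i acc := (if (2 ^ (i + 1) - s)%N == 0%N then acc + 1 else acc)%N.
rewrite (_ : log2 s = natrec s 0 F); last first.
  suff h t : natrec t 0 F = minn t (log2 s).
    by rewrite h; apply/esym/minn_idPr; exact: (leq_trans (ltnW (ltn_expl _ (ltnSn 1))) (trunc_logP _ s0)).
  elim: t => [|t IH]; first by rewrite min0n.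
  rewrite /= {1}/F IH subn_eq0 addn1.
  have -> : (2 ^ t.+1 <= s)%N = (t.+1 <= log2 s)%N.
    apply/idP/idP => h; first exact: trunc_log_max.
    by apply: leq_trans (trunc_logP (ltnSn 1) s0); rewrite leq_exp2l.
  by case: (leqP t.+1 (log2 s)) => ?; lia.
apply: den_loop => //; [by apply: (den_le B_gt0 _ ha); lia|exact: den_cst|].
move=> m' M' x' y' i acc mm ag hx hy ix _; apply: den_ifz; [|apply: den_plus; [exact: den_up|exact: den_cst]|exact: den_up].
apply: den_minus; last exact: den_agree ha mm ag.
apply: den_pow; [exact: den_cst|apply: den_plus; [exact: den_up|exact: den_cst]|exact: leq_trans B10|lia].
Qed.

Definition den_out j m0 M (a : term) (out : seq int) :=
  forall m M', (m0 <= m)%N -> agree m0 M M' ->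
  exists t M'', [/\ exec (a m) M' t M'' out, (t <= B ^ j)%N & agree m M' M''].

Definition oemit (a : term) : term := fun m => Seq (a m) (Output (Posz m)).
Definition oseq (a b : term) : term := fun m => Seq (a m) (b m).
(** Register layout: m = index, m+1 = remaining rounds, m+2 = 1; the body works from m+3 on. *)
Definition ofor (n : term) (f : term -> term) : term := fun m =>
  Seq (n m.+1) (Seq (Const (Posz m) 0) (Seq (Const (Posz m.+2) 1)
  (WhilePos (Posz m.+1) (Seq (f (tvar m) m.+3)
    (Seq (Add (Posz m) (Posz m) (Posz m.+2)) (Sub (Posz m.+1) (Posz m.+1) (Posz m.+2))))))).

Lemma den_emit j m M a v : D j m M a v -> den_out j.+1 m M (oemit a) [:: Posz v].
Proof.
move=> ha m1 M1 h ag; have [t1 [M2 [e1 l1 v1 a1]]] := ha m1 M1 h ag.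
exists (t1 + 1)%N, M2; split=> //.
  by have := ExSeq e1 (ExOutput (Posz m1) M2); rewrite v1.
by apply: (@powB _ _ 2); [have := powB_pos j; lia|exact: leq_trans B10].
Qed.

Lemma den_oseq j m M a b o1 o2 : den_out j m M a o1 -> den_out j m M b o2 ->
  den_out j.+1 m M (oseq a b) (o1 ++ o2).
Proof.
move=> ha hb m1 M1 h ag; have [t1 [M2 [e1 l1 a1]]] := ha m1 M1 h ag.
have [t2 [M3 [e2 l2 a2]]] := hb m1 M2 h (agree_trans ag (agree_le h a1)).
exists (t1 + t2)%N, M3; split; [exact: ExSeq e1 e2| |exact: agree_trans a1 a2].
by apply: (@powB _ _ 2); [lia|exact: leq_trans B10].
Qed.

Lemma den_for j m M n f N out : D j m M n N -> (N <= B)%N ->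
  (forall m' M' x i, (m <= m')%N -> agree m M M' -> D 1 m' M' x i -> (i < N)%N ->
     den_out j m' M' (f x) (out i)) ->
  den_out j.+2 m M (ofor n f) (flatten [seq out i | i <- iota 0 N]).
Proof.
move=> hn NB hf m1 M1 h ag.
have [t2 [M3 [e2 l2 v2 a2]]] := hn m1.+1 M1 (leqW h) ag.
rewrite /ofor; set body := Seq (f _ _) _.
have loop : forall r i M4, (i + r = N)%N -> agree m1 M1 M4 ->
   M4 (Posz m1) = Posz i -> M4 (Posz m1.+1) = Posz r -> M4 (Posz m1.+2) = 1 ->
   exists t M5, [/\ exec (WhilePos (Posz m1.+1) body) M4 t M5 (flatten [seq out i | i <- iota i r]),
      (t <= r * (B ^ j + 5) + 1)%N & agree m1 M1 M5].
  elim=> [|r IH] i M4 ir ag4 vi vr v1'.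
    by exists 1%N, M4; split=> //; apply: ExWhileStop; rewrite vr.
  have dx : D 1 m1.+1 M4 (tvar m1) i by apply: den_var.
  have iN : (i < N)%N by rewrite -ir addnS ltnS leq_addr.
  have df := hf m1.+1 M4 _ i (leqW h) (agree_trans ag (agree_le h ag4)) dx iN.
  have [t5 [M5 [e5 l5 a5]]] := df m1.+3 M4 (leqW (leqnSn _)) (@agree_refl _ _).
  pose M8 := upd M5 (Posz m1) (Posz i.+1).
  pose M9 := upd M8 (Posz m1.+1) (Posz r).
  have q1 : (m1.+1 == m1) = false by lia.
  have q2 : (m1.+2 == m1) = false by lia.
  have q3 : (m1.+2 == m1.+1) = false by lia.
  have q4 : (m1 == m1.+1) = false by lia.
  have w1 : M5 (Posz m1) = Posz i by rewrite a5 //; lia.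
  have w2 : M5 (Posz m1.+1) = Posz r.+1 by rewrite a5 //; lia.
  have w3 : M5 (Posz m1.+2) = 1 by rewrite a5 //; lia.
  have e8 : exec (Add (Posz m1) (Posz m1) (Posz m1.+2)) M5 1 M8 [::].
    have := ExAdd (Posz m1) (Posz m1) (Posz m1.+2) M5.
    by rewrite w1 w3 (_ : Posz i + 1 = Posz i.+1) // -addn1 PoszD.
  have e9 : exec (Sub (Posz m1.+1) (Posz m1.+1) (Posz m1.+2)) M8 1 M9 [::].
    have := ExSub (Posz m1.+1) (Posz m1.+1) (Posz m1.+2) M8.
    have -> : M8 (Posz m1.+1) = Posz r.+1 by rewrite /M8 !updE q1 w2.
    have -> : M8 (Posz m1.+2) = 1 by rewrite /M8 !updE q2 w3.
    by rewrite (_ : Posz r.+1 - 1 = Posz r) // -addn1 PoszD addrK.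
  have ebody : exec body M4 (t5 + (1 + 1)) M9 (out i).
    by rewrite -[out i]cats0; exact: (ExSeq e5 (ExSeq e8 e9)).
  have ag9 : agree m1 M1 M9.
    apply: agree_upd; [lia|apply: agree_upd; [lia|]].
    by apply: agree_trans ag4 (agree_le _ a5); lia.
  have [||||t10 [M10 [e10 l10 a10]]] := IH i.+1 M9 _ ag9.
  - by rewrite addSn -addnS.
  - by rewrite /M9 /M8 !updE q4 eqxx.
  - by rewrite /M9 updE eqxx.
  - by rewrite /M9 /M8 !updE q3 q2.
  exists (t5 + (1 + 1) + t10).+1, M10; split=> //=.
  - by apply: (ExWhileLoop _ ebody e10); rewrite vr.
  rewrite mulSn; move: l5 l10; move: (B ^ j)%N (r * _)%N => X Y; lia.
pose M4 := upd (upd M3 (Posz m1) 0) (Posz m1.+2) 1.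
have [||||t5 [M5 [e5 l5 a5]]] := loop N 0%N M4 (add0n _).
- do 2!(apply: agree_upd; first lia).
  by apply: (agree_le _ a2); lia.
- rewrite /M4 !updE eqxx; by case: eqP => [/eqP|_] //; lia.
- rewrite /M4 !updE v2.
  by do 2!(case: eqP => [/eqP|_]; first lia).
- by rewrite /M4 updE eqxx.
exists (t2 + (1 + (1 + t5)))%N, M5; split=> //.
- have e3 := ExConst (Posz m1) 0 M3.
  have e4 := ExConst (Posz m1.+2) 1 (upd M3 (Posz m1) 0).
  exact: (ExSeq e2 (ExSeq e3 (ExSeq e4 e5))).
apply: (@powB _ _ 8); last exact: leq_trans B10.
have : (t5 <= B * (6 * B ^ j) + 1)%N.
  apply: leq_trans l5 _; rewrite leq_add2r leq_mul //.
  by have := powB_pos j; move: (B ^ j)%N; lia.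
have := powB_pos j; rewrite expnS.
move: l2; move: (B ^ j)%N => X.
have : (16 * X <= B * X)%N by rewrite leq_mul2r B10 orbT.
rewrite (mulnCA B 6); move: (B * X)%N; lia.
Qed.

End Den.

(** * Isolating weights for sums of separated products *)

Definition mono_over n (A : {pred 'I_n}) (a : 'X_{1..n}) := forall i, i \notin A -> a i = 0%N.

Lemma mono_overD n (A : {pred 'I_n}) a b : mono_over A a -> mono_over A b -> mono_over A (a + b)%MM.
Proof. by move=> ha hb i iA; rewrite mnmDE ha ?hb. Qed.

Definition mrestr n (A : {pred 'I_n}) (a : 'X_{1..n}) : 'X_{1..n} :=
  [multinom (if i \in A then a i else 0%N) | i < n].

Lemma mrestr_over n (A : {pred 'I_n}) a : mono_over A (mrestr A a).
Proof. by move=> i iA; rewrite mnmE (negbTE iA). Qed.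

Lemma mrestr_split n (A : {pred 'I_n}) a : (mrestr A a + mrestr [predC A] a = a)%MM.
Proof. by apply/mnmP => i; rewrite mnmDE !mnmE !inE; case: (i \in A); rewrite ?addn0. Qed.

Lemma mrestrD n (A : {pred 'I_n}) a b : mono_over A a -> mono_over [predC A] b ->
  mrestr A (a + b)%MM = a.
Proof.
move=> ha hb; apply/mnmP => i; rewrite !mnmE; case: ifPn => iA; last by rewrite ha.
by rewrite hb ?addn0 // inE negbK.
Qed.

Definition poly_over n (A : {pred 'I_n}) (u : {mpoly rat[n]}) :=
  forall m, m \in msupp u -> mono_over A m.

(** This bounds by [w] the rank of the coefficient matrix with rows indexed by monomials over [A]
    and columns by monomials outside [A]. An explicit list of products passes easily through sums,
    products and substitutions. *)
Definition sep n (A : {pred 'I_n}) (w : nat) (P : {mpoly rat[n]}) :=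
  exists l : seq ({mpoly rat[n]} * {mpoly rat[n]}), [/\ (size l <= w)%N,
    forall uv, uv \in l -> poly_over A uv.1 /\ poly_over [predC A] uv.2
    & P = \sum_(uv <- l) uv.1 * uv.2].

(** A monomial splits in only one way into a part over [A] and a part outside, so a single pair of
    terms contributes. *)
Lemma mcoeff_over_mul n (A : {pred 'I_n}) u v a b :
  poly_over A u -> poly_over [predC A] v -> mono_over A a -> mono_over [predC A] b ->
  (u * v)@_(a + b)%MM = u@_a * v@_b.
Proof.
move=> hu hv ha hb; rewrite mpolyME.
transitivity (\sum_(m <- msupp u) \sum_(m' <- msupp v)
    (u@_m * v@_m') * ((m == a) && (m' == b))%:R).
  rewrite raddf_sum /=; under [RHS]eq_bigr do rewrite big_seq_cond.
  rewrite big_allpairs_dep /=; rewrite big_seq [RHS]big_seq; apply: eq_bigr => m mu.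
  rewrite big_seq [RHS]big_seq_cond [RHS]big_mkcondr /=; apply: eq_bigr => m' mv.
  rewrite mv mcoeffZ mcoeffX; congr (_ * _%:R); congr nat_of_bool.
  apply/eqP/andP => [e|[/eqP -> /eqP ->]] //.
  have := congr1 (mrestr A) e; rewrite (mrestrD (hu _ mu) (hv _ mv)) (mrestrD ha hb) => ma.
  by move: e; rewrite ma => /addmI ->; rewrite !eqxx.
have [au|au] := boolP (a \in msupp u); last first.
  rewrite (memN_msupp_eq0 au) mul0r big_seq big1 // => m mu; rewrite big1 // => m' _.
  by case: eqP => [e|_]; [rewrite -e mu in au|rewrite mulr0].
rewrite (bigD1_seq a) ?msupp_uniq //= [X in _ + X]big1 ?addr0 => [|m ma]; last first.
  by rewrite big1 // => m' _; rewrite (negbTE ma) mulr0.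
have [bv|bv] := boolP (b \in msupp v); last first.
  rewrite (memN_msupp_eq0 bv) mulr0 big_seq big1 // => m mu.
  by case: (m =P b) => [e|_]; [rewrite -e mu in bv|rewrite andbF mulr0].
rewrite (bigD1_seq b) ?msupp_uniq //= [X in _ + X]big1 ?addr0 => [|m mb]; last first.
  by rewrite (negbTE mb) andbF mulr0.
by rewrite !eqxx mulr1.
Qed.

(* The A-slice of P at a, i.e. the coefficient of the monomial a in the
   A-variables, is a combination of slices of strictly smaller weight. *)
Definition dependent n (P : {mpoly rat[n]}) (w : 'I_n -> nat) (A : {pred 'I_n}) (a : 'X_{1..n}) :=
  exists l : seq (rat * 'X_{1..n}),
    (forall ca, ca \in l -> mono_over A ca.2 /\ (wdeg w ca.2 < wdeg w a)%N) /\
    forall b, mono_over [predC A] b -> P@_(a + b)%MM = \sum_(ca <- l) ca.1 * P@_(ca.2 + b)%MM.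

(** When their weights are distinct, these index the slices kept by a greedy choice of a basis in
    order of increasing weight. *)
Definition pivot n (P : {mpoly rat[n]}) w (A : {pred 'I_n}) (a : 'X_{1..n}) :=
  mono_over A a /\ ~ dependent P w A a.

(** Only pivots must get distinct weights. By [pivots_bounded] they are at most as many as the
    separation width, whereas the monomials over a large [A] are too many to be separated by a small
    modulus. *)
Definition isolates n (P : {mpoly rat[n]}) w (A : {pred 'I_n}) :=
  forall a b, pivot P w A a -> pivot P w A b -> wdeg w a = wdeg w b -> a = b.

Lemma eq_wdeg n (w w' : 'I_n -> nat) : w =1 w' -> wdeg w =1 wdeg w'.
Proof. by move=> e a; apply: eq_bigr => i _; rewrite e. Qed.

Lemma eq_dependent n (P : {mpoly rat[n]}) w w' A a : w =1 w' -> dependent P w A a -> dependent P w' A a.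
Proof.
by move=> e [l [h1 h2]]; exists l; split=> // ca /h1; rewrite !(eq_wdeg e).
Qed.

Lemma eq_isolates n (P : {mpoly rat[n]}) w w' A : w =1 w' -> isolates P w A -> isolates P w' A.
Proof.
move=> e iso a b [oa da] [ob db]; rewrite -!(eq_wdeg e) => h; apply: iso => //.
  by split=> // d; apply: da; apply: eq_dependent d.
by split=> // d; apply: db; apply: eq_dependent d.
Qed.

Lemma pivot_mdeg n (P : {mpoly rat[n]}) w A a : pivot P w A a -> (mdeg a < msize P)%N.
Proof.
case=> _ hd; rewrite ltnNge; apply/negP => h; apply: hd.
exists [::]; split=> // b _; rewrite big_nil; apply/eqP; rewrite mcoeff_eq0.
by apply: msize_mdeg_ge; rewrite mdegD (leq_trans h) ?leq_addr.
Qed.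

(** More than [W] slices satisfy a linear relation, because their left coefficient vectors have
    length at most [W]. Isolation makes the largest weight in the relation unique, and the pivot of
    that weight would depend on the others. *)
Lemma pivots_bounded n (P : {mpoly rat[n]}) w A W (l : seq 'X_{1..n}) :
  sep A W P -> isolates P w A -> uniq l -> (forall a, a \in l -> pivot P w A a) -> (size l <= W)%N.
Proof.
case=> uv [huv hover eP] hiso ul hl; rewrite leqNgt; apply/negP => lt.
pose M : 'M[rat]_(size l, size uv) := \matrix_(i, j) (nth (0, 0) uv j).1@_(nth 0%MM l i).
have rk : (\rank M < size l)%N by apply: leq_ltn_trans (rank_leq_col _) _; apply: leq_ltn_trans lt.
have [r [i0 ri0]] : exists r : 'rV[rat]_(size l), (exists i, r 0 i != 0) /\ r *m M = 0.
  have : kermx M != 0 by rewrite -mxrank_eq0 mxrank_ker subn_eq0 -ltnNge.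
  case/matrix0Pn => i [j hij]; exists (row i (kermx M)); split.
    by exists j; rewrite mxE.
  by rewrite -row_mul mulmx_ker row0.
case: i0 => i0 hi0.
pose i1 := [arg max_(i > i0 | r 0 i != 0) wdeg w (nth 0%MM l i)].
have [ri1 max1] : r 0 i1 != 0 /\ forall i, r 0 i != 0 -> (wdeg w (nth 0%MM l i) <= wdeg w (nth 0%MM l i1))%N.
  by rewrite /i1; case: arg_maxnP.
have p1 : pivot P w A (nth 0%MM l i1) by apply: hl; rewrite mem_nth.
case: (p1) => o1; apply.
exists [seq (- (r 0 i / r 0 i1), nth 0%MM l i) | i <- enum 'I_(size l) & (i != i1) && (r 0 i != 0)].
split=> [ca|b hb].
  case/mapP => i; rewrite mem_filter => /andP[/andP[ii ri] _] -> /=.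
  have pi : pivot P w A (nth 0%MM l i) by apply: hl; rewrite mem_nth.
  split; first by case: pi.
  rewrite ltn_neqAle max1 // andbT; apply: contraNneq ii => e.
  by apply/eqP/val_inj/eqP; rewrite /= -(nth_uniq 0%MM _ _ ul) //; apply/eqP; apply: hiso.
rewrite big_map big_filter big_enum_cond /=.
have rel : \sum_i r 0 i * P@_(nth 0%MM l i + b)%MM = 0.
  rewrite eP; under eq_bigr => i _.
    rewrite raddf_sum big_distrr /= (big_nth (0, 0)) big_mkord; over.
  rewrite exchange_big big1 //= => j _.
  have [oj1 oj2] := hover _ (mem_nth (0, 0) (ltn_ord j)).
  have := congr1 (fun m : 'rV__ => m 0 j) ri0; rewrite !mxE => z.
  transitivity ((\sum_i r 0 i * M i j) * (nth (0, 0) uv j).2@_b); last by rewrite z mul0r.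
  rewrite big_distrl /=; apply: eq_bigr => i _.
  rewrite (mcoeff_over_mul oj1 oj2) ?mxE ?mulrA //.
  by case: (hl (nth 0%MM l i)); rewrite ?mem_nth.
move: rel; rewrite (bigD1 i1) //= => /eqP; rewrite addr_eq0 => /eqP rel.
apply: (mulfI ri1); rewrite rel big_distrr /= -sumrN big_mkcondr /=.
apply: eq_bigr => i _; case: (eqVneq (r 0 i) 0) => [->|_] /=; first by rewrite mul0r oppr0.
by rewrite mulNr mulrN mulrA mulrCA divff // mulr1.
Qed.

(** If no duplicate-free list exhausted [B], lists could be extended beyond any length, against the
    bound. *)
Lemma covering_list (T : eqType) (B : T -> Prop) W :
  (forall l : seq T, uniq l -> (forall a, a \in l -> B a) -> (size l <= W)%N) ->
  exists l : seq T, [/\ uniq l, forall a, a \in l -> B a, forall a, B a -> a \in l & (size l <= W)%N].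
Proof.
move=> h; apply: NNPP => hn.
suff H k : exists l : seq T, [/\ uniq l, forall a, a \in l -> B a & size l = k].
  by have [l [u hl e]] := H W.+1; have := h l u hl; rewrite e ltnn.
elim: k => [|k [l [u hl e]]]; first by exists [::].
have [a Ba al] : exists2 a, B a & a \notin l.
  apply: NNPP => hc; apply: hn; exists l; split=> //; last exact: h.
  by move=> a Ba; apply/negPn/negP => al; apply: hc; exists a.
exists (a :: l); split=> /=; [by rewrite al|by move=> b; rewrite inE => /orP[/eqP -> //|/hl]|by rewrite e].
Qed.

(** Restricting a pivot over the union to one half gives a pivot of that half: a dependency of the
    restriction, multiplied by the other part, is a dependency of the whole. Hence [w1] has to
    separate only sums of two pivots. Multiplying the old weight by [N], above all weights under
    [w1], makes the new order refine the old one. *)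
Lemma isolates_merge n (P : {mpoly rat[n]}) (w w1 : 'I_n -> nat) (A A1 A2 : {pred 'I_n}) N :
  (forall i, (i \in A) = (i \in A1) || (i \in A2)) -> [disjoint A1 & A2] -> (forall a, (mdeg a < msize P)%N -> (wdeg w1 a < N)%N) ->
  (forall a1 b1 a2 b2, pivot P w A1 a1 -> pivot P w A1 b1 -> pivot P w A2 a2 -> pivot P w A2 b2 ->
     (mdeg (a1 + a2)%MM < msize P)%N -> (mdeg (b1 + b2)%MM < msize P)%N -> wdeg w1 (a1 + a2)%MM = wdeg w1 (b1 + b2)%MM -> (a1 + a2)%MM = (b1 + b2)%MM) ->
  isolates P (fun i => w i * N + w1 i)%N A.
Proof.
move=> eA dis hN hinj.
have we a : wdeg (fun i => w i * N + w1 i)%N a = (wdeg w a * N + wdeg w1 a)%N.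
  rewrite /wdeg big_distrl -big_split /=; apply: eq_bigr => i _.
  by rewrite mulnDr mulnA.
have half (X Y : {pred 'I_n}) a1 a2 : (forall i, i \in X -> i \notin Y) ->
    (forall i, (i \in A) = (i \in X) || (i \in Y)) ->
    mono_over X a1 -> mono_over Y a2 -> pivot P (fun i => w i * N + w1 i)%N A (a1 + a2)%MM ->
    pivot P w X a1.
  move=> XY eU o1 o2 pa; split=> // -[l [hl hP]]; case: (pa) => _; apply.
  (* Terms of degree at least [msize P] are dropped: their coefficients in [P] are zero, and the
     bound [N] is only known for the others. *)
  exists [seq (ca.1, (ca.2 + a2)%MM) | ca <- l & (mdeg (ca.2 + a2)%MM < msize P)%N]; split=> [ca|b hb].
    case/mapP => -[c a] ; rewrite mem_filter => /andP[/= da /hl /= [oa lta]] -> /=.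
    split; first by move=> i; rewrite eU negb_or => /andP[iX iY]; rewrite mnmDE oa ?o2.
    rewrite !we !wdegD; have := hN _ da; rewrite wdegD; move: lta.
    by move: (wdeg w a) (wdeg w a1) (wdeg w a2) (wdeg w1 a) (wdeg w1 a2) (wdeg w1 a1) => x y z u v t; nia.
  rewrite -addmA hP; last first.
    move=> i; rewrite inE negbK => iX; rewrite mnmDE o2 ?XY // hb //.
    by rewrite inE negbK eU iX.
  rewrite big_map big_filter [RHS]big_mkcond /=; apply: eq_bigr => -[c a] _ /=.
  case: ifPn => [_|]; first by rewrite addmA.
  rewrite -leqNgt => h; rewrite memN_msupp_eq0 ?mulr0 //.
  by apply: msize_mdeg_ge; rewrite addmA mdegD (leq_trans h) ?leq_addr.
have split a : pivot P (fun i => w i * N + w1 i)%N A a ->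
    pivot P w A1 (mrestr A1 a) /\ pivot P w A2 (mrestr A2 a) /\ a = (mrestr A1 a + mrestr A2 a)%MM.
  move=> pa; have ea : a = (mrestr A1 a + mrestr A2 a)%MM.
    apply/mnmP => i; rewrite mnmDE !mnmE; case: ifPn => i1.
      by rewrite (disjointFr dis i1) addn0.
    case: ifPn => // i2; case: pa => oa _; apply: oa.
    by rewrite eA negb_or i1.
  split; last split=> //.
    apply: (half A1 A2 _ (mrestr A2 a)) => //; last by rewrite -ea.
    - by move=> i /(disjointFr dis) ->.
    - exact: mrestr_over.
    - exact: mrestr_over.
  apply: (half A2 A1 _ (mrestr A1 a)) => //; last by rewrite addmC -ea.
  - by move=> i /(disjointFl dis) ->.
  - by move=> i; rewrite eA orbC.
  - exact: mrestr_over.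
  - exact: mrestr_over.
move=> a b pa pb; rewrite !we => e.
have [a1 [a2 ea]] := split a pa; have [b1 [b2 eb]] := split b pb.
rewrite ea eb; apply: hinj => //; rewrite -?ea -?eb; [exact: pivot_mdeg pa|exact: pivot_mdeg pb|].
have := congr1 (modn^~ N) e; rewrite !modnMDl !modn_small //; apply: hN; exact: pivot_mdeg pa || exact: pivot_mdeg pb.
Qed.

(** A monomial of least weight in the support is a pivot, since all coefficients of smaller weight
    are zero. By isolation it is alone at its weight. *)
Lemma isolates_nonzero n (P : {mpoly rat[n]}) w (A : {pred 'I_n}) : (forall i, i \in A) ->
  isolates P w A -> P != 0 -> mmap (@polyC rat) (fun i => 'X^(w i)) P != 0.
Proof.
move=> hA hiso P0.
have ex : exists k, has (fun m => wdeg w m == k) (msupp P).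
  by exists (wdeg w (mlead P)); apply/hasP; exists (mlead P); rewrite ?mlead_supp.
case: (ex_minnP ex) => k /hasP[a aP /eqP ak] mink.
have piv m : m \in msupp P -> wdeg w m = k -> pivot P w A m.
  move=> mP mk; split=> [i|[l [hl hP]]]; first by rewrite hA.
  move: mP; rewrite mcoeff_msupp -[m]addm0 hP => [|i _]; last by rewrite mnm0E.
  rewrite big_seq big1 ?eqxx // => ca /hl[_]; rewrite mk addm0 => lt.
  rewrite memN_msupp_eq0 ?mulr0 //; apply: contraTN lt => h; rewrite -leqNgt; apply: mink.
  by apply/hasP; exists ca.2.
apply: (weight_poly_neq0 aP) => m mP e; apply: hiso => //; first by apply: piv => //; rewrite e.
exact: piv.
Qed.

Lemma wdeg_le n (w : 'I_n -> nat) q (a : 'X_{1..n}) : (forall i, w i <= q)%N ->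
  (wdeg w a <= mdeg a * q)%N.
Proof.
by move=> h; rewrite /wdeg mdegE big_distrl /=; apply: leq_sum => i _; rewrite leq_mul2l h orbT.
Qed.

Lemma wdeg_modn n (w : 'I_n -> nat) p (a : 'X_{1..n}) :
  wdeg (fun i => w i %% p)%N a = wdeg w a %[mod p].
Proof.
rewrite /wdeg; elim/big_ind2: _ => // [x y z t h1 h2|i _]; last by rewrite modnMmr.
by rewrite -modnDm h1 h2 modnDm.
Qed.

Lemma dvdn_dist p x y : x = y %[mod p] -> (p %| (x - y) + (y - x))%N.
Proof.
wlog xy : x y / (x <= y)%N => [h e|e].
  by case/orP: (leq_total x y) => xy; [exact: h|rewrite addnC; exact: h].
by rewrite (eqP (_ : x - y == 0)%N) ?subn_eq0 // add0n -eqn_mod_dvd //; apply/eqP.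
Qed.

(** A modulus is bad only if it divides the difference of the Kronecker weights of an unequal pair.
    The product of these differences is below [2 ^ m], so some small number does not divide it,
    hence divides none of them. *)
Lemma separating_modulus n D d m (S : seq ('X_{1..n} * 'X_{1..n})) :
  (D <= 2 ^ d)%N -> (d * n.+1 * size S < m)%N ->
  (forall ab, ab \in S -> (mdeg ab.1 < D)%N /\ (mdeg ab.2 < D)%N) ->
  exists p, (0 < p <= m.*2)%N /\ forall ab, ab \in S ->
    wdeg (fun i => D ^ i %% p)%N ab.1 = wdeg (fun i => D ^ i %% p)%N ab.2 -> ab.1 = ab.2.
Proof.
move=> hD hm hS; pose K := @wdeg n (fun i => D ^ i)%N.
pose g (ab : 'X_{1..n} * 'X_{1..n}) := (if ab.1 == ab.2 then 1 else (K ab.1 - K ab.2) + (K ab.2 - K ab.1))%N.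
have g0 ab : ab \in S -> (0 < g ab <= 2 ^ (d * n.+1))%N.
  move=> /hS[h1 h2]; rewrite /g; case: eqVneq => [_|ne]; first by rewrite expn_gt0.
  have neK : K ab.1 != K ab.2 by apply: contra_neq ne; exact: kronecker_inj.
  have lt x : (mdeg x < D)%N -> (K x < 2 ^ (d * n.+1))%N.
    move=> hx; apply: (leq_trans (wdeg_kronecker_lt hx)).
    by rewrite expnM leq_exp2r.
  by move: (lt _ h1) (lt _ h2) neK; move: (K ab.1) (K ab.2) => x y; lia.
pose N := (\prod_(ab <- S) g ab)%N.
have N0 : (0 < N < 2 ^ m)%N.
  have : (0 < N <= 2 ^ (d * n.+1 * size S))%N.
    rewrite /N; elim: S hS g0 {hm N} => [|ab S IH] hS g0; first by rewrite big_nil muln0.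
    have /andP[a0 al] := g0 ab (mem_head _ _).
    have /andP[b0 bl] : (0 < \prod_(ab <- S) g ab <= 2 ^ (d * n.+1 * size S))%N.
      by apply: IH => x xS; [apply: hS|apply: g0]; rewrite inE xS orbT.
    by rewrite big_cons muln_gt0 a0 b0 /= mulnS expnD leq_mul.
  case/andP => -> h /=; apply: leq_ltn_trans h _; by rewrite ltn_exp2l.
have [p [hp hd]] := exists_nondivisor N0; exists p; split=> // ab abS e.
apply/eqP; apply/negPn/negP => ne; case/negP: hd.
rewrite /N (big_rem ab) //= dvdn_mulr // /g (negbTE ne).
have := congr1 (modn^~ p) e; rewrite /= !wdeg_modn -/(K _) -/(K _).
exact: dvdn_dist.
Qed.

Lemma monomials_over_bound n (A : {pred 'I_n}) D K (l : seq 'X_{1..n}) : (0 < D)%N ->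
  (#|A| <= K)%N -> uniq l -> (forall a, a \in l -> mono_over A a /\ (mdeg a < D)%N) ->
  (size l <= D ^ K)%N.
Proof.
move=> D0 hK ul hl; apply: (@leq_trans (D ^ #|A|)); last by rewrite leq_pexp2l.
case: D D0 hl => // D _ hl.
have -> : (D.+1 ^ #|A|)%N = #|pffun_on (ord0 : 'I_D.+1) A (fun _ : 'I_D.+1 => true)|.
  rewrite card_pffun_on; congr (_ ^ _)%N; rewrite -[LHS](card_ord D.+1).
  by apply: eq_card => x; rewrite !inE.
pose g (a : 'X_{1..n}) := [ffun i => inord (a i) : 'I_D.+1].
have mle (a : 'X_{1..n}) i : (a i <= mdeg a)%N by rewrite mdegE (bigD1 i) //= leq_addr.
rewrite -(size_map g) cardE; apply: uniq_leq_size.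
  rewrite map_inj_in_uniq // => a b /hl[_ da] /hl[_ db] e; apply/mnmP => i.
  have := congr1 (fun f : {ffun 'I_n -> 'I_D.+1} => val (f i)) e; rewrite !ffunE /= !inordK //.
    exact: leq_ltn_trans (mle _ _) db.
  exact: leq_ltn_trans (mle _ _) da.
move=> x /mapP[a /hl[oa da] ->]; rewrite mem_enum; apply/pffun_onP; split=> //.
apply/supportP => i iA; rewrite ffunE oa //; apply: val_inj; rewrite /= inordK //.
Qed.

(** Horner's scheme in base [N]: earlier moduli dominate and later ones break the remaining ties. *)
Definition level_weight D N (ps : seq nat) (i : nat) : nat :=
  foldl (fun acc p => acc * N + D ^ i %% p)%N 0%N ps.

Lemma level_weight_rcons D N ps p i :
  level_weight D N (rcons ps p) i = (level_weight D N ps i * N + D ^ i %% p)%N.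
Proof. by rewrite /level_weight foldl_rcons. Qed.

Section Levels.
Variables (n : nat) (P : {mpoly rat[n]}) (idx : 'I_n -> nat) (D d N m K W X L : nat).
Hypotheses (hD : (D <= 2 ^ d)%N) (D0 : (0 < D)%N) (hP : (msize P <= D)%N).
(** Block [j] of level [l + 1] is the union of the blocks [2j] and [2j + 1] of level [l]. *)
Let blk l j : {pred 'I_n} := [pred i | idx i %/ 2 ^ l == j]%N.
Hypotheses (hK : forall j, (#|blk 0 j| <= K)%N) (hsep : forall l j, sep (blk l j) W P).
Hypotheses (hX1 : (D ^ K <= X)%N) (hX2 : (W * W <= X)%N).
Hypothesis hm : (d * n.+1 * (2 ^ L * (X * X)) < m)%N.
Hypothesis hN : (D * m.*2 <= N)%N.

(** One modulus serves all blocks of a level: at most [2 ^ L * (X * X)] pairs have to be separated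
    together. *)
Lemma level_step J (B : nat -> 'X_{1..n} -> Prop) : (J <= 2 ^ L)%N ->
  (forall j a, B j a -> (mdeg a < D)%N) ->
  (forall j, (j < J)%N -> exists2 l : seq 'X_{1..n}, (size l <= X)%N & forall a, B j a -> a \in l) ->
  exists p, (0 < p <= m.*2)%N /\ forall j a b, (j < J)%N -> B j a -> B j b ->
    wdeg (fun i : 'I_n => D ^ i %% p)%N a = wdeg (fun i : 'I_n => D ^ i %% p)%N b -> a = b.
Proof.
move=> JL hB hl.
have [f hf] : exists f : 'I_J -> seq 'X_{1..n}, forall j,
    (size (f j) <= X)%N /\ forall a, B j a -> a \in f j.
  apply: (@fin_all_exists _ _ (fun (j : 'I_J) (l : seq 'X_{1..n}) => (size l <= X)%N /\ forall a, B j a -> a \in l)).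
  by move=> j; have [l h1 h2] := hl j (ltn_ord j); exists l.
pose g j := [seq a <- f j | mdeg a < D]%N.
pose S := flatten [seq [seq (a, b) | a <- g j, b <- g j] | j <- enum 'I_J].
have sS : (size S <= 2 ^ L * (X * X))%N.
  apply: (@leq_trans (J * (X * X))); last by rewrite leq_mul2r JL orbT.
  rewrite size_flatten /shape -map_comp sumnE big_map big_enum /=.
  apply: (@leq_trans (\sum_(j < J) (X * X))); last by rewrite sum_nat_const card_ord.
  apply: leq_sum => j _; rewrite size_allpairs size_filter.
  by apply: leq_mul; apply: leq_trans (count_size _ _) _; case: (hf j).
have [||p [hp hsp]] := @separating_modulus n D d m S hD.
- by apply: leq_ltn_trans hm; rewrite leq_mul2l sS orbT.
- move=> ab /flattenP[s /mapP[j _ ->]] /allpairsP[[a b] [/= ha hb ->]] /=.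
  by move: ha hb; rewrite !mem_filter => /andP[-> _] /andP[-> _].
exists p; split=> // j a b jJ ha hb; apply: (hsp (a, b)).
apply/flattenP; exists [seq (a, b) | a <- g (Ordinal jJ), b <- g (Ordinal jJ)].
  by apply/mapP; exists (Ordinal jJ); rewrite ?mem_enum.
apply/allpairsP; exists (a, b); split=> //=; rewrite mem_filter (hB j) //=; last first.
  by case: (hf (Ordinal jJ)) => _; apply.
by case: (hf (Ordinal jJ)) => _; apply.
Qed.

Lemma isolating_levels l : (l <= L)%N -> exists ps : seq nat,
  [/\ size ps = l.+1, forall p, p \in ps -> (0 < p <= m.*2)%N
    & forall j, (j < 2 ^ (L - l))%N -> isolates P (fun i => level_weight D N ps i) (blk l j)].
Proof.
elim: l => [_|l IH lL].
  rewrite subn0.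
  (* Blocks of level 0 have at most [K] variables, so all their monomials of degree below [D] can be
     separated. *)
  pose B j a := mono_over (blk 0 j) a /\ (mdeg a < D)%N.
  have [||p [hp hinj]] := @level_step (2 ^ L)%N B (leqnn _).
  - by move=> j a [].
  - move=> j _; have [l [_ _ h1 h2]] := @covering_list _ (B j) (D ^ K)%N
      (fun l ul hl => @monomials_over_bound n (blk 0 j) D K l D0 (hK j) ul hl).
    by exists l => //; apply: leq_trans h2 hX1.
  exists [:: p]; split=> // [q|j jL a b pa pb e]; first by rewrite inE => /eqP ->.
  have hB c : pivot P (fun i => level_weight D N [:: p] i) (blk 0 j) c -> B j c.
    by move=> pc; split; [case: pc|exact: leq_trans (pivot_mdeg pc) hP].
  by apply: (hinj j) => //; exact: hB.
have [ps [sps hps iso]] := IH (ltnW lL).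
have e2 : (2 ^ (L - l) = (2 ^ (L - l.+1)).*2)%N.
  by rewrite -mul2n -expnS -subSn.
pose w (i : 'I_n) := level_weight D N ps i.
(* When two blocks merge, only sums of one pivot from each matter, at most [W * W] of them, however
   many variables are involved. *)
pose B j a := exists a1 a2, [/\ pivot P w (blk l j.*2) a1, pivot P w (blk l j.*2.+1) a2,
  a = (a1 + a2)%MM & (mdeg a < msize P)%N].
have [|||p [hp hinj]] := @level_step (2 ^ (L - l.+1))%N B.
- by rewrite leq_pexp2l // leq_subr.
- by move=> j a [a1 [a2 [_ _ _ h]]]; exact: leq_trans h hP.
- move=> j jL.
  have cov j' : (j' < 2 ^ (L - l))%N -> exists l' : seq 'X_{1..n},
     [/\ uniq l', forall a, a \in l' -> pivot P w (blk l j') a,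
       forall a, pivot P w (blk l j') a -> a \in l' & (size l' <= W)%N].
    move=> hj; apply: covering_list => l' ul hl.
    exact: (pivots_bounded (hsep l j') (iso j' hj) ul hl).
  have [|l1 [_ _ c1 s1]] := cov j.*2; first by rewrite e2 ltn_double.
  have [|l2 [_ _ c2 s2]] := cov j.*2.+1; first by rewrite e2 ltn_Sdouble.
  exists [seq (a + b)%MM | a <- l1, b <- l2].
    by rewrite size_allpairs; apply: leq_trans hX2; apply: leq_mul.
  move=> a [a1 [a2 [p1 p2 -> _]]]; apply/allpairsP; exists (a1, a2); split=> //=; [exact: c1|exact: c2].
exists (rcons ps p); split=> [|q|j jL].
- by rewrite size_rcons sps.
- by rewrite mem_rcons inE => /orP[/eqP ->//|/hps].
apply: (@eq_isolates _ _ (fun i => w i * N + D ^ i %% p)%N).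
  by move=> i; rewrite level_weight_rcons.
apply: (@isolates_merge _ _ _ _ _ (blk l j.*2) (blk l j.*2.+1)).
- by move=> i; rewrite !inE expnSr divnMA; move: (idx i %/ _)%N => x; lia.
- by apply/pred0P => i /=; rewrite !inE; move: (idx i %/ _)%N => x; lia.
- move=> a da; apply: leq_ltn_trans (@wdeg_le _ _ m.*2 _ _) _.
    move=> i; apply: ltnW; apply: leq_trans (ltn_pmod _ _) _; by case/andP: hp.
  case/andP: hp => p0 pm; apply: leq_trans hN; rewrite ltn_mul2r (leq_trans da hP) andbT.
  exact: leq_trans pm.
by move=> a1 b1 a2 b2 pa1 pb1 pa2 pb2 da db; apply: (hinj j) => //; [exists a1, a2|exists b1, b2].
Qed.

End Levels.

(** * Rank concentration by shifting *)

Definition slice n (A : {pred 'I_n}) (Q : {mpoly rat[n]}) (a : 'X_{1..n}) : {mpoly rat[n]} :=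
  \sum_(m <- msupp Q | mrestr A m == a) Q@_m *: 'X_[mrestr [predC A] m].

Lemma slice_over n (A : {pred 'I_n}) Q a : poly_over [predC A] (slice A Q a).
Proof.
move=> m /(msupp_sum_le (F := fun m => Q@_m *: 'X_[mrestr [predC A] m])) /flattenP[s /mapP[m' _ ->]].
by move/msuppZ_le; rewrite msuppX inE => /eqP ->; exact: mrestr_over.
Qed.

Lemma mcoeff_slice n (A : {pred 'I_n}) Q a b : mono_over A a -> mono_over [predC A] b ->
  (slice A Q a)@_b = Q@_(a + b)%MM.
Proof.
move=> oa ob; rewrite /slice raddf_sum /=.
transitivity (\sum_(m <- msupp Q | m == (a + b)%MM) Q@_m).
  rewrite big_mkcond [RHS]big_mkcond; apply: eq_bigr => m _; rewrite mcoeffZ mcoeffX.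
  have e : (m == (a + b)%MM) = (mrestr A m == a) && (mrestr [predC A] m == b).
    apply/eqP/andP => [->|[/eqP <- /eqP <-]]; last by rewrite mrestr_split.
    rewrite mrestrD // addmC mrestrD ?eqxx //.
    by move=> i; rewrite !inE negbK; exact: oa.
  by rewrite e; case: (mrestr A m == a); case: (_ == b); rewrite /= ?mulr1 ?mulr0.
rewrite big_mkcond; have [h|h] := boolP ((a + b)%MM \in msupp Q).
  rewrite (bigD1_seq _ h) ?msupp_uniq //= eqxx big1 ?addr0 // => m /negbTE -> //.
rewrite (memN_msupp_eq0 h) big_seq big1 // => m mQ; case: eqP => // e.
by rewrite -e mQ in h.
Qed.

Lemma slice_expand n (A : {pred 'I_n}) Q (l : seq 'X_{1..n}) : uniq l ->
  (forall m, m \in msupp Q -> mrestr A m \in l) -> Q = \sum_(a <- l) 'X_[a] * slice A Q a.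
Proof.
move=> ul hl; rewrite {1}[Q]mpolyE /slice.
under [RHS]eq_bigr => a _.
  rewrite big_distrr big_mkcond /=; over.
rewrite exchange_big /= big_seq [RHS]big_seq; apply: eq_bigr => m mQ.
rewrite (bigD1_seq _ (hl m mQ) ul) /= eqxx big1 ?addr0 => [|a]; last by rewrite eq_sym => /negbTE ->.
by rewrite -scalerAr -mpolyXD mrestr_split.
Qed.

Section PivotDecomposition.
Variables (n : nat) (P : {mpoly rat[n]}) (w : 'I_n -> nat) (A : {pred 'I_n}) (bs : seq 'X_{1..n}).
Hypothesis ubs : uniq bs.
Hypothesis bs_pivot : forall b, b \in bs -> pivot P w A b.
Hypothesis pivot_bs : forall b, pivot P w A b -> b \in bs.

(** Induction on the weight: a slice that is not a pivot is replaced by slices of smaller weight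
    until only pivots remain. *)
Lemma slice_reduce a : mono_over A a -> exists c : 'X_{1..n} -> rat,
  (forall b, b \in bs -> c b != 0 -> (b = a /\ c b = 1) \/ (wdeg w b < wdeg w a)%N) /\
  (a \in bs -> c a = 1) /\ slice A P a = \sum_(b <- bs) c b *: slice A P b.
Proof.
have [k] := ubnP (wdeg w a); elim: k a => // k IH a ak oa.
have [abs|abs] := boolP (a \in bs).
  exists (fun b => (b == a)%:R); split=> [b _|].
    by case: (eqVneq b a) => [-> _|_]; [left|rewrite eqxx].
  split=> [_|]; first by rewrite eqxx.
  rewrite (bigD1_seq a) //= eqxx scale1r big1 ?addr0 // => b /negbTE ->; exact: scale0r.
have : dependent P w A a by apply: NNPP => nd; case/negP: abs; exact: pivot_bs.
case=> l [hl hP].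
have [c [hc1 hc2]] : exists c : 'X_{1..n} -> rat,
   (forall b, b \in bs -> c b != 0 -> (wdeg w b < wdeg w a)%N) /\
   \sum_(ca <- l) ca.1 *: slice A P ca.2 = \sum_(b <- bs) c b *: slice A P b.
  elim: l hl {hP} => [|ca l IHl] hl.
    by exists (fun _ => 0); split=> [b _ /eqP//|]; rewrite big_nil big1 // => b _; rewrite scale0r.
  have [oca lca] := hl ca (mem_head _ _).
  have [c1 [h1 [_ e1]]] := IH ca.2 (leq_trans lca ak) oca.
  have [x xl|c2 [h2 e2]] := IHl; first by apply: hl; rewrite inE xl orbT.
  exists (fun b => ca.1 * c1 b + c2 b); split=> [b bbs|].
    have [c2b|c2b _] := eqVneq (c2 b) 0; last exact: h2.
    rewrite c2b addr0 mulf_eq0 negb_or => /andP[_ c1b].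
    by case: (h1 b bbs c1b) => [[-> _]|lt]; [|exact: ltn_trans lt lca].
  rewrite big_cons e1 e2 scaler_sumr -big_split /=; apply: eq_bigr => b _.
  by rewrite scalerDl scalerA.
exists c; split=> [b bbs cb|]; first by right; exact: hc1.
split=> //.
rewrite -hc2; apply/mpolyP => m; rewrite [RHS]raddf_sum /=.
have [om|om] := classic (mono_over [predC A] m).
  rewrite mcoeff_slice // hP //; rewrite big_seq [RHS]big_seq; apply: eq_bigr => ca /hl[oca _].
  by rewrite mcoeffZ mcoeff_slice.
have z x : (slice A P x)@_m = 0 by apply: memN_msupp_eq0; apply/negP => /slice_over.
by rewrite z big1 // => ca _; rewrite mcoeffZ z mulr0.
Qed.

(** Reducing every slice to pivots collects a factor [U b] in front of the slice of [b]. In it, [b]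
    is the unique term of lowest weight; this triangular shape lets [local_shift] read off the
    lowest term of a determinant. *)
Lemma pivot_decomposition : exists U : 'X_{1..n} -> {mpoly rat[n]},
  (forall b, b \in bs -> (U b)@_b = 1 /\ forall m, m \in msupp (U b) ->
     mono_over A m /\ (m = b \/ (wdeg w b < wdeg w m)%N)) /\
  P = \sum_(b <- bs) U b * slice A P b.
Proof.
pose l := undup (bs ++ [seq mrestr A m | m <- msupp P]).
have lo a : a \in l -> mono_over A a.
  by rewrite mem_undup mem_cat => /orP[/bs_pivot[]//|/mapP[m _ ->]]; exact: mrestr_over.
have [U [hU eU]] : exists U : 'X_{1..n} -> {mpoly rat[n]},
  (forall b, b \in bs -> (U b)@_b = (b \in l)%:R /\ forall m, m \in msupp (U b) ->
     m \in l /\ (m = b \/ (wdeg w b < wdeg w m)%N)) /\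
  \sum_(a <- l) 'X_[a] * slice A P a = \sum_(b <- bs) U b * slice A P b; last first.
  exists U; split=> [b bbs|].
    have [h1 h2] := hU b bbs; split=> [|m /h2[/lo]//].
    by rewrite h1 mem_undup mem_cat bbs.
  rewrite -eU; apply: slice_expand; first exact: undup_uniq.
  by move=> m mP; rewrite mem_undup mem_cat map_f ?orbT.
have: uniq l by exact: undup_uniq.
elim: l lo => [|a l IH] lo; first (move=> _; exists (fun _ => 0); split=> [b _|]).
- by split=> [|m]; rewrite ?mcoeff0 // msupp0.
- by rewrite big_nil big1 // => b _; rewrite mul0r.
case/andP => al ul; have [x xl|//|U [hU eU]] := IH; first by apply: lo; rewrite inE xl orbT.
have [c [h1 [h2 h3]]] := slice_reduce (lo a (mem_head _ _)).
exists (fun b => U b + c b *: 'X_[a]); split=> [b bbs|].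
  have [hb1 hb2] := hU b bbs; split.
    rewrite mcoeffD mcoeffZ mcoeffX hb1 inE eq_sym.
    case: eqP => [e|_]; last by rewrite mulr0 addr0.
    by move: bbs; rewrite e => abs; rewrite (negbTE al) h2 // add0r mulr1.
  move=> m /msuppD_le; rewrite mem_cat => /orP[/hb2[ml hm]|]; first by rewrite inE ml orbT.
  have [cb|cb] := eqVneq (c b) 0; first by rewrite cb scale0r msupp0.
  move=> h; move: h; rewrite (msuppMCX _ cb) mem_seq1 => /eqP ->; rewrite mem_head; split=> //.
  by case: (h1 b bbs cb) => [[-> _]|lt]; [left|right].
rewrite big_cons eU h3 big_distrr -big_split /=; apply: eq_bigr => b _.
by rewrite mulrDl addrC -scalerAl -scalerAr.
Qed.

End PivotDecomposition.

(** Group the monomials by their exponent at some [i] in [S]. Each group still vanishes on the other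
    hyperplanes, so by induction it has at least half the required size. A single group is
    impossible, since setting X_i = 1 would not make it vanish. *)
Lemma sparse_hyperplanes n (S : {set 'I_n}) (l : seq 'X_{1..n}) (lam : 'X_{1..n} -> rat) :
  uniq l -> (0 < size l)%N -> (forall m, m \in l -> lam m != 0) ->
  (forall i X, i \in S -> X i = 1 -> \sum_(m <- l) lam m * \prod_j X j ^+ m j = 0) ->
  (2 ^ #|S| <= size l)%N.
Proof.
have [k] := ubnP #|S|; elim: k S l => // k IH S l Sk ul l0 hlam hz.
have [->|[i iS]] := set_0Vmem S; first by rewrite cards0.
have cS : #|S| = #|S :\ i|.+1 by rewrite (cardsD1 i) iS.
rewrite cS expnS mul2n -addnn.
have part m0 : m0 \in l -> (2 ^ #|S :\ i| <= count (fun m : 'X_{1..n} => m i == m0 i) l)%N.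
  move=> m0l; rewrite -size_filter; apply: IH.
  - by rewrite -ltnS -cS.
  - exact: filter_uniq.
  - by rewrite size_filter -has_count; apply/hasP; exists m0.
  - by move=> m; rewrite mem_filter => /andP[_ /hlam].
  move=> i' X; rewrite !inE => /andP[ii' i'S] X1.
  pose rest (m : 'X_{1..n}) := \prod_(j | j != i) X j ^+ m j.
  have full (m : 'X_{1..n}) z : \prod_j (if j == i then z else X j) ^+ m j = rest m * z ^+ m i.
    rewrite (bigD1 i) //= eqxx mulrC; congr (_ * _); apply: eq_bigr => j /negbTE -> //.
  pose p : {poly rat} := \sum_(m <- l) (lam m * rest m) *: 'X^(m i).
  have p0 : p = 0.
    apply/eqP; apply/negPn/negP => /poly_nat_nonroot/(_ (leqnSn _))[u _] /negP; apply.
    rewrite /p horner_sum -[X in _ == X](hz i' (fun j => if j == i then u%:R else X j) i'S); last first.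
      by rewrite (negbTE ii').
    apply/eqP; apply: eq_bigr => m _; rewrite full hornerZ hornerXn mulrA //.
  have := congr1 (fun q : {poly rat} => q`_(m0 i) * X i ^+ m0 i) p0; rewrite coef0 mul0r /p coef_sum.
  move=> h; rewrite -[RHS]h big_filter big_mkcond big_distrl /=; apply: eq_bigr => m _.
  rewrite coefZ coefXn eq_sym; case: eqP => [e|_]; last by rewrite mulr0 mul0r.
  rewrite mulr1 e -mulrA -full; congr (_ * _); apply: eq_bigr => j _.
  by case: eqP => [->|].
have [m0 m0l] : exists m0, m0 \in l by case: l l0 {ul hlam hz part} => // m0 l _; exists m0; rewrite mem_head.
have [m1 m1l ne] : exists2 m1, m1 \in l & m1 i != m0 i.
  apply: NNPP => hn.
  have eqi m : m \in l -> m i = m0 i.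
    by move=> ml; apply/eqP/negPn/negP => ne; apply: hn; exists m.
  pose f : {mpoly rat[n]} := \sum_(m <- l) lam m *: 'X_[m].
  have f0 : f != 0.
    apply/eqP => /(congr1 (mcoeff m0)); rewrite mcoeff0 raddf_sum /= (bigD1_seq m0) //= big1 => [|m /negbTE mm].
      by rewrite mcoeffZ mcoeffX eqxx mulr1 addr0; apply/eqP; exact: hlam.
    by rewrite mcoeffZ mcoeffX mm mulr0.
  have [x hx] := mpoly_nonroot f0; case/negP: hx.
  have := hz i (fun j => if j == i then 1 else x j) iS; rewrite eqxx => /(_ erefl) h.
  apply/eqP; transitivity (x i ^+ m0 i * 0); last by rewrite mulr0.
  rewrite -h /f raddf_sum big_distrr /= big_seq [RHS]big_seq; apply: eq_bigr => m ml.
  rewrite mevalZ mevalX mulrCA; congr (_ * _); rewrite (bigD1 i) //= [in RHS](bigD1 i) //= eqxx expr1n mul1r.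
  by rewrite eqi //; congr (_ * _); apply: eq_bigr => j /negbTE ->.
apply: leq_trans (leq_add (part _ m0l) (part _ m1l)) _.
rewrite -count_predUI (_ : count (predI _ _) l = 0%N) ?addn0 ?count_size //.
apply/eqP; rewrite -leqn0 leqNgt -has_count; apply/negP => /hasP[m _ /= /andP[/eqP e1 /eqP e2]].
by rewrite -e1 -e2 eqxx in ne.
Qed.

(** Rows are chosen greedily: as long as fewer than [k] are independent, some nonzero column kills
    them all, and the hypothesis gives a row outside their span. *)
Lemma spanning_det (T : Type) k (G : T -> Prop) (v : T -> 'rV[rat]_k) :
  (forall lam : 'cV[rat]_k, lam != 0 -> exists2 x, G x & v x *m lam != 0) ->
  exists x : 'I_k -> T, (forall i, G (x i)) /\ \det (\matrix_(i, j) v (x i) 0 j) != 0.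
Proof.
move=> h.
suff [x [Gx rx]] : exists x : 'I_k -> T, (forall i, G (x i)) /\ row_free (\matrix_(i < k) v (x i)).
  by exists x; split=> //; move: rx; rewrite row_free_unit unitmxE unitfE.
suff H r : (r <= k)%N -> exists x : 'I_r -> T, (forall i, G (x i)) /\ row_free (\matrix_(i < r) v (x i)).
  exact: H.
elim: r => [_|r IH rk].
  have x : 'I_0 -> T by case.
  exists x; split=> [[]//|]; rewrite /row_free; by rewrite [\matrix_(i < 0) _]flatmx0 mxrank0.
have [x [Gx rx]] := IH (ltnW rk); set M := \matrix_(i < r) _ in rx.
have [lam lam0 Ml] : exists2 lam : 'cV[rat]_k, lam != 0 & M *m lam = 0.
  have : kermx M^T != 0.
    by rewrite -mxrank_eq0 mxrank_ker mxrank_tr subn_eq0 -ltnNge (eqP rx).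
  case/matrix0Pn => i [j hij]; exists (row i (kermx M^T))^T.
    by apply/matrix0Pn; exists j, 0; rewrite mxE mxE.
  by apply: trmx_inj; rewrite trmx_mul trmxK -row_mul mulmx_ker row0 trmx0.
have [y Gy vy] := h lam lam0.
exists (fun i => if unlift ord0 i is Some j then x j else y); split=> [i|].
  by case: (unlift ord0 i).
set M' := \matrix_(i < r.+1) _.
have sub : (M <= M')%MS.
  apply/row_subP => i; rewrite rowK.
  have -> : v (x i) = row (lift ord0 i) M' by rewrite rowK liftK.
  exact: row_sub.
have nsub : ~~ (M' <= M)%MS.
  apply: contraNN vy => s; have : (row ord0 M' <= M)%MS by apply: submx_trans (row_sub _ _) s.
  by rewrite rowK unlift_none => /submxP[z ->]; rewrite -mulmxA Ml mulmx0.
have lt : (\rank M < \rank M')%N by apply: rank_ltmx; rewrite /ltmx sub nsub.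
by rewrite /row_free eqn_leq rank_leq_row /=; have /eqP e := rx; rewrite e in lt.
Qed.

Lemma poly_over0 n (A : {pred 'I_n}) : poly_over A 0.
Proof. by move=> m; rewrite msupp0. Qed.

Lemma poly_overC n (A : {pred 'I_n}) c : poly_over A c%:MP.
Proof. by move=> m; rewrite msuppC; case: eqP => // _; rewrite inE => /eqP -> i _; rewrite mnm0E. Qed.

Lemma poly_overX n (A : {pred 'I_n}) i : i \in A -> poly_over A 'X_i.
Proof.
move=> iA m; rewrite msuppX inE => /eqP -> j jA; rewrite mnm1E; case: eqP => // e.
by rewrite -e iA in jA.
Qed.

Lemma poly_overD n (A : {pred 'I_n}) u v : poly_over A u -> poly_over A v -> poly_over A (u + v).
Proof. by move=> hu hv m /msuppD_le; rewrite mem_cat => /orP[/hu|/hv]. Qed.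

Lemma poly_overM n (A : {pred 'I_n}) u v : poly_over A u -> poly_over A v -> poly_over A (u * v).
Proof.
move=> hu hv m /msuppM_le /allpairsP[[a b] [/= /hu oa /hv ob ->]]; exact: mono_overD.
Qed.

Lemma poly_overXn n (A : {pred 'I_n}) u k : poly_over A u -> poly_over A (u ^+ k).
Proof.
move=> hu; elim: k => [|k IH]; first by rewrite expr0 -mpolyC1; exact: poly_overC.
by rewrite exprS; exact: poly_overM.
Qed.

Lemma poly_over_sum n (A : {pred 'I_n}) (I : Type) (r : seq I) (Q : pred I) F :
  (forall i, Q i -> poly_over A (F i)) -> poly_over A (\sum_(i <- r | Q i) F i).
Proof.
by move=> h; elim/big_ind: _ => //; [exact: poly_over0|exact: poly_overD].
Qed.

Lemma poly_over_prod n (A : {pred 'I_n}) (I : Type) (r : seq I) (Q : pred I) F :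
  (forall i, Q i -> poly_over A (F i)) -> poly_over A (\prod_(i <- r | Q i) F i).
Proof.
by move=> h; elim/big_ind: _ => //; [rewrite -mpolyC1; exact: poly_overC|exact: poly_overM].
Qed.

Lemma poly_overZ n (A : {pred 'I_n}) c u : poly_over A u -> poly_over A (c *: u).
Proof. by move=> hu m /msuppZ_le /hu. Qed.

Definition comp n k (h : 'I_n -> {mpoly rat[k]}) : {mpoly rat[n]} -> {mpoly rat[k]} :=
  subst (@mpolyC k rat) h.

HB.instance Definition _ n k h := GRing.RMorphism.on (@comp n k h).

Lemma compE n k (h : 'I_n -> {mpoly rat[k]}) u :
  comp h u = \sum_(m <- msupp u) u@_m *: \prod_i h i ^+ m i.
Proof. by rewrite /comp substE /mmap; apply: eq_bigr => m _; rewrite mul_mpolyC. Qed.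

Lemma comp_over n k (h : 'I_n -> {mpoly rat[k]}) (A : {pred 'I_n}) (J : {pred 'I_k}) u :
  (forall i, i \in A -> poly_over J (h i)) -> poly_over A u -> poly_over J (comp h u).
Proof.
move=> hJ hu; rewrite compE big_seq; apply: poly_over_sum => m /hu om.
apply/poly_overZ/poly_over_prod => i _; have [iA|iA] := boolP (i \in A).
  exact/poly_overXn/hJ.
by rewrite om // expr0 -mpolyC1; exact: poly_overC.
Qed.

Lemma meval_comp n k (h : 'I_n -> {mpoly rat[k]}) u x :
  (comp h u).@[x] = u.@[fun i => (h i).@[x]].
Proof.
rewrite compE raddf_sum mevalE /=; apply: eq_bigr => m _.
by rewrite mevalZ rmorph_prod; congr (_ * _); apply: eq_bigr => i _; rewrite rmorphXn.
Qed.

Lemma sep_comp n k (h : 'I_n -> {mpoly rat[k]}) (A : {pred 'I_n}) (J : {pred 'I_k}) W u :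
  (forall i, i \in A -> poly_over J (h i)) -> (forall i, i \notin A -> poly_over [predC J] (h i)) ->
  sep A W u -> sep J W (comp h u).
Proof.
move=> h1 h2 [l [sl hl ->]]; exists [seq (comp h uv.1, comp h uv.2) | uv <- l]; split.
- by rewrite size_map.
- move=> uv /mapP[x xl ->] /=; have [o1 o2] := hl x xl.
  by split; [exact: comp_over h1 o1|apply: comp_over o2 => i iA; exact: h2].
by rewrite big_map rmorph_sum; apply: eq_bigr => x _; rewrite rmorphM.
Qed.

Definition shift n (b : 'I_n -> rat) : {mpoly rat[n]} -> {mpoly rat[n]} :=
  comp (fun i => 'X_i + (b i)%:MP).

HB.instance Definition _ n b := GRing.RMorphism.on (@shift n b).

Lemma shift_over n (b : 'I_n -> rat) (A : {pred 'I_n}) u : poly_over A u -> poly_over A (shift b u).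
Proof.
by apply: comp_over => i iA; apply: poly_overD; [exact: poly_overX|exact: poly_overC].
Qed.

Lemma meval_shift n (b : 'I_n -> rat) u x : (shift b u).@[x] = u.@[fun i => x i + b i].
Proof. by rewrite meval_comp; apply: meval_eq => i; rewrite mevalD mevalXU mevalC. Qed.

Lemma sep_shift n (b : 'I_n -> rat) (A : {pred 'I_n}) W u : sep A W u -> sep A W (shift b u).
Proof.
apply: sep_comp => i iA; apply: poly_overD; try exact: poly_overC; exact: poly_overX.
Qed.

Lemma shift_neq0 n (b : 'I_n -> rat) u : u != 0 -> shift b u != 0.
Proof.
move=> /mpoly_nonroot[x hx]; apply: contraNneq hx => e.
have := meval_shift b u (fun i => x i - b i); rewrite e meval0 => /esym z.
by apply/eqP; rewrite -[RHS]z; apply: meval_eq => i; rewrite subrK.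
Qed.

(* A monomial of P(x + b) witnessing that S violates rank concentration: its
   support contains S, and no other support is strictly contained in it. *)
Definition blocking n (P : {mpoly rat[n]}) (S : {set 'I_n}) (b : 'I_n -> rat) :=
  exists m0, [/\ m0 \in msupp (shift b P), forall i, i \in S -> m0 i != 0%N
    & forall m, m \in msupp (shift b P) -> (forall i, m i != 0%N -> m0 i != 0%N) ->
      forall i, m0 i != 0%N -> m i != 0%N].

(** Fix the part of [m0] outside [S]. The corresponding slice of the shifted polynomial is a
    combination of the shifted [U j], and minimality of the support of [m0] makes each of its
    monomials contain all of [S]. So it vanishes wherever a coordinate in [S] is zero, in particular
    at the points [X i * b - b]. The nonzero determinant then kills the combination, although [m0]
    occurs in it. *)
Lemma not_blocking n (P : {mpoly rat[n]}) (S : {set 'I_n}) (b : 'I_n -> rat) k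
    (U V : 'I_k -> {mpoly rat[n]}) (X : 'I_k -> 'I_n -> rat) :
  (forall j, poly_over [pred i | i \in S] (U j)) ->
  (forall j, poly_over [predC [pred i | i \in S]] (V j)) -> P = \sum_j U j * V j ->
  (forall i, exists2 l, l \in S & X i l = 1) ->
  \det (\matrix_(i, j) (U j).@[fun l => X i l * b l]) != 0 -> ~ blocking P S b.
Proof.
set A := [pred i | i \in S] => hU hV eP hX hdet [m0 [m0Q hS hmin]].
pose Q := shift b P; pose b0 := mrestr [predC A] m0.
have b0o : mono_over [predC A] b0 by exact: mrestr_over.
have AA (a : 'X_{1..n}) : mono_over [predC [predC A]] a <-> mono_over A a.
  by split=> h i; have := h i; rewrite !inE ?negbK.
pose th j := (shift b (V j))@_b0.
have sl : slice [predC A] Q b0 = \sum_j th j *: shift b (U j).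
  apply/mpolyP => a; rewrite [RHS]raddf_sum /=.
  have [oa|oa] := classic (mono_over A a).
    rewrite mcoeff_slice //; last exact/AA.
    rewrite /Q eP rmorph_sum raddf_sum /=; apply: eq_bigr => j _.
    rewrite rmorphM /= addmC (mcoeff_over_mul (shift_over (hU j)) (shift_over (hV j))) //.
    by rewrite mcoeffZ mulrC.
  rewrite memN_msupp_eq0; last by apply/negP => /slice_over /AA.
  rewrite big1 // => j _; rewrite mcoeffZ memN_msupp_eq0 ?mulr0 //.
  by apply/negP => /(shift_over (hU j)).
have sup a : a \in msupp (slice [predC A] Q b0) -> forall i, i \in S -> a i != 0%N.
  move=> ha i iS; have oa : mono_over A a by apply/AA; exact: slice_over ha.
  have mQ : (b0 + a)%MM \in msupp Q.
    by rewrite mcoeff_msupp -(@mcoeff_slice _ [predC A]) -?mcoeff_msupp //; apply/AA.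
  have := hmin _ mQ _ i (hS i iS); rewrite mnmDE mnmE !inE iS /= add0n; apply.
  move=> l; rewrite mnmDE mnmE !inE; case lS: (l \in S) => /=; first by rewrite hS.
  by rewrite oa ?addn0 // inE lS.
have van z l : l \in S -> z l = 0 -> (slice [predC A] Q b0).@[z] = 0.
  move=> lS zl; rewrite mevalE big_seq big1 // => a ha.
  by rewrite (bigD1 l) //= zl expr0n (negbTE (sup a ha l lS)) mul0r mulr0.
have lin : \matrix_(i, j) (U j).@[fun l => X i l * b l] *m \col_j th j = 0.
  apply/matrixP => i j; rewrite !mxE; have [l lS Xl] := hX i.
  have := van (fun l => X i l * b l - b l) l lS; rewrite Xl mul1r subrr => /(_ erefl).
  rewrite sl raddf_sum /= => h; rewrite -[RHS]h; apply: eq_bigr => j' _.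
  rewrite !mxE mevalZ meval_shift mulrC; congr (_ * _).
  by apply: meval_eq => l'; rewrite subrK.
have th0 j : th j = 0.
  have : \col_j th j = 0.
    by apply: (@row_full_inj _ _ _ _ _ _) lin || (rewrite -[LHS](@mulKmx _ _ _ (\matrix_(i, j) (U j).@[fun l => X i l * b l])) ?lin ?mulmx0 // unitmxE unitfE).
  by move/matrixP/(_ j 0); rewrite !mxE.
have : (slice [predC A] Q b0)@_(mrestr A m0) = 0.
  by rewrite sl big1 ?mcoeff0 // => j _; rewrite th0 scale0r.
rewrite mcoeff_slice //; last exact/AA/mrestr_over.
by rewrite addmC mrestr_split => /eqP; rewrite mcoeff_eq0 m0Q.
Qed.

Lemma meval_mmap_weight n (u : {mpoly rat[n]}) (w : 'I_n -> nat) (x : 'I_n -> rat) :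
  mmap (@polyC rat) (fun l => (x l)%:P * 'X^(w l)) u =
  \sum_(m <- msupp u) (u@_m * \prod_l x l ^+ m l)%:P * 'X^(wdeg w m).
Proof.
apply: eq_bigr => m _; rewrite polyCM -mulrA; congr (_ * _).
rewrite /mmap1 /wdeg -prodrXr rmorph_prod -big_split /=; apply: eq_bigr => l _.
by rewrite exprMn rmorphXn /= -exprM mulnC.
Qed.

(** At the points [X i * mu * t ^ w] the matrix of the [U b] has a determinant polynomial in [t].
    Its lowest term is, up to powers of [mu], the determinant of the pivot monomials at the [X i],
    and [sparse_hyperplanes] provides suitable [X i]. The quantifiers are arranged so that one [t],
    then one [v], can be chosen for all [S]. *)
Lemma local_shift n (P : {mpoly rat[n]}) (S : {set 'I_n}) (w : 'I_n -> nat) W (mu : rat) :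
  isolates P w [pred i | i \in S] -> sep [pred i | i \in S] W P -> (W < 2 ^ #|S|)%N -> mu != 0 ->
  exists Qt : {poly rat}, Qt != 0 /\ forall t0, Qt.[t0] != 0 ->
    forall (bv : 'I_n -> {poly rat}) v1, (forall i, (bv i).[v1] = mu * t0 ^+ w i) ->
    exists Dv : {poly rat}, Dv != 0 /\ forall v0, Dv.[v0] != 0 ->
      ~ blocking P S (fun i => (bv i).[v0]).
Proof.
set A := [pred i | i \in S] => iso hsep hW mu0.
have [bs [ubs bs1 bs2 sbs]] := covering_list (fun l ul hl => pivots_bounded hsep iso ul hl).
have [U [hU eP]] := pivot_decomposition ubs bs1 bs2.
pose k := size bs; pose b_ (j : 'I_k) := nth 0%MM bs j.
have b_bs j : b_ j \in bs by rewrite mem_nth.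
have b_inj j j' : (b_ j == b_ j') = (j == j') by rewrite nth_uniq.
pose pw (X : 'I_n -> rat) (m : 'X_{1..n}) := \prod_l X l ^+ m l.
pose hyper (X : 'I_n -> rat) := exists2 l, l \in S & X l = 1.
have [lam lam0|X [hX detX]] := @spanning_det _ k hyper (fun X => \row_j pw X (b_ j)).
  apply: NNPP => hn.
  pose lf m := \sum_j lam j 0 *+ (b_ j == m).
  have lfb j : lf (b_ j) = lam j 0.
    rewrite /lf (bigD1 j) //= eqxx big1 ?addr0 // => j' jj'; by rewrite b_inj (negbTE jj').
  pose l := [seq m <- bs | lf m != 0].
  have : (2 ^ #|S| <= size l)%N.
    apply: (@sparse_hyperplanes _ S l lf).
    - exact: filter_uniq.
    - have [j [j' hj]] := matrix0Pn _ lam0; rewrite size_filter -has_count; apply/hasP; exists (b_ j) => //.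
      by move: hj; rewrite [j']ord1 lfb.
    - by move=> m; rewrite mem_filter => /andP[].
    move=> i X iS Xi; apply/eqP/negPn/negP => h; apply: hn; exists X; first by exists i.
    apply/matrix0Pn; exists 0, 0; rewrite mxE; apply: contraNneq h => h.
    rewrite big_filter big_mkcond (big_nth 0%MM) big_mkord -[X in _ == X]h; apply/eqP.
    apply: eq_bigr => j _; rewrite -/(b_ j) lfb mxE.
    by case: eqP => [->|_]; [rewrite mulr0|rewrite mulrC].
  by move/(leq_trans hW); rewrite ltnNge (leq_trans _ sbs) // size_filter count_size.
pose Gp : 'M[{poly rat}]_k := \matrix_(i, j) mmap (@polyC rat) (fun l => (mu * X i l)%:P * 'X^(w l)) (U (b_ j)).
have Qt0 : \det Gp != 0.
  (* Column [j] is divided by the power of [t] at the weight of [b_ j]; at [t = 0] only the lowest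
     monomial [b_ j] of [U (b_ j)] is left. *)
  pose G' : 'M[{poly rat}]_k := \matrix_(i, j) \sum_(m <- msupp (U (b_ j)))
    ((U (b_ j))@_m * \prod_l (mu * X i l) ^+ m l)%:P * 'X^(wdeg w m - wdeg w (b_ j)).
  have -> : Gp = G' *m diag_mx (\row_j 'X^(wdeg w (b_ j))).
    apply/matrixP => i j; rewrite mul_mx_diag !mxE meval_mmap_weight big_distrl /=.
    rewrite big_seq [RHS]big_seq; apply: eq_bigr => m mU; rewrite -mulrA -exprD; congr (_ * 'X^_).
    by have [_ /(_ m mU)[_ [->|lt]]] := hU _ (b_bs j); rewrite ?subnn // subnK // ltnW.
  rewrite det_mulmx det_diag mulf_neq0 //; last first.
    by apply/prodf_neq0 => j _; rewrite mxE expf_neq0 // polyX_eq0.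
  suff : (\det G').[0] != 0 by apply: contraNneq => ->; rewrite horner0.
  rewrite -[_.[0]]/(horner_eval 0 _) -det_map_mx.
  have -> : map_mx (horner_eval 0) G' =
     (\matrix_(i, j) (\row_j pw (X i) (b_ j)) 0 j) *m diag_mx (\row_j mu ^+ mdeg (b_ j)).
    apply/matrixP => i j; rewrite mul_mx_diag !mxE /horner_eval horner_sum.
    have [c1 hm] := hU _ (b_bs j).
    have bU : b_ j \in msupp (U (b_ j)) by rewrite mcoeff_msupp c1 oner_eq0.
    rewrite (bigD1_seq _ bU) ?msupp_uniq //= [X in _ + X]big1_seq => [|m /andP[mb mU]]; last first.
      have [_ [e|lt]] := hm m mU; first by rewrite e eqxx in mb.
      by rewrite hornerM hornerXn expr0n subn_eq0 leqNgt lt mulr0.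
    rewrite hornerM hornerC hornerXn.
    rewrite addr0 subnn expr0 mulr1 c1 mul1r mdegE -prodrXr -big_split /=.
    by apply: eq_bigr => l _; rewrite exprMn mulrC.
  by rewrite det_mulmx det_diag mulf_neq0 //; apply/prodf_neq0 => j _; rewrite mxE expf_neq0.
exists (\det Gp); split=> // t0 ht bv v1 hv.
pose Dm : 'M[{poly rat}]_k := \matrix_(i, j) mmap (@polyC rat) (fun l => (X i l)%:P * bv l) (U (b_ j)).
exists (\det Dm); split=> [|v0].
  (* At [v1] the curve passes through the scaled powers of [t0], so the determinant along it is not
     the zero polynomial. *)
  suff e : (\det Dm).[v1] = (\det Gp).[t0] by apply: contraNneq ht => z; rewrite -e z horner0.
  rewrite -[LHS]/(horner_eval v1 _) -[RHS]/(horner_eval t0 _) -!det_map_mx; congr (\det _).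
  apply/matrixP => i j; rewrite !mxE /= /horner_eval -!meval_horner; apply: meval_eq => l.
  by rewrite !hornerM !hornerC hornerXn hv mulrCA mulrA.
rewrite -[X in X != 0]/(horner_eval v0 _) -det_map_mx => hdet.
apply: (@not_blocking _ _ _ _ k (fun j => U (b_ j)) (fun j => slice A P (b_ j)) X) => //.
- by move=> j m mU; have [_ /(_ m mU)[]] := hU _ (b_bs j).
- by move=> j; exact: slice_over.
- by rewrite {1}eP (big_nth 0%MM) big_mkord.
move: hdet; congr (\det _ != 0); apply/matrixP => i j; rewrite !mxE /= /horner_eval -meval_horner.
by apply: meval_eq => l; rewrite hornerM hornerC.
Qed.

(* The curve v |-> b v t interpolates, up to scaling, the points
   t^(wt c) for all weight functions wt c, so one generic shift serves all
   sets S at once, although each S has its own isolating weight function. *)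
Lemma concentrating_shift n (P : {mpoly rat[n]}) W l0 C (wt : nat -> 'I_n -> nat) :
  P != 0 -> (forall A : {pred 'I_n}, sep A W P) -> (W < 2 ^ l0)%N ->
  (forall S : {set 'I_n}, #|S| = l0 -> exists2 c, (c < C)%N & isolates P (wt c) [pred i | i \in S]) ->
  exists v t : rat,
    let b i := \sum_(c < C) t ^+ wt c i * \prod_(c' < C | c' != c) (v + (c' : nat)%:R) in
    exists m, m \in msupp (shift b P) /\ (#|[set i | m i != 0%N]| < l0)%N.
Proof.
move=> P0 hsep hW hiso.
pose bv t i : {poly rat} := \sum_(c < C) (t ^+ wt c i) *: \prod_(c' < C | c' != c) ('X + (c' : nat)%:R%:P).
have bvE t v i : (bv t i).[v] = \sum_(c < C) t ^+ wt c i * \prod_(c' < C | c' != c) (v + (c' : nat)%:R).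
  rewrite horner_sum; apply: eq_bigr => c _; rewrite hornerZ horner_prod; congr (_ * _).
  by apply: eq_bigr => c' _; rewrite hornerD hornerX hornerC.
have step1 (S : {set 'I_n}) : exists Qt : {poly rat}, Qt != 0 /\ forall t0, Qt.[t0] != 0 ->
   exists Dv : {poly rat}, Dv != 0 /\ forall v0, Dv.[v0] != 0 -> #|S| = l0 ->
      ~ blocking P S (fun i => (bv t0 i).[v0]).
  have [cS|cS] := eqVneq #|S| l0; last first.
    exists 1; split; first exact: oner_neq0.
    move=> t0 _; exists 1; split; first exact: oner_neq0.
    by move=> v0 _ h; rewrite h eqxx in cS.
  have [c cC iso] := hiso S cS.
  (* At [v = -c] every summand of the shift except that of [c] vanishes; [mu] is the product left in
     that summand. *)
  pose mu : rat := \prod_(c' < C | c' != Ordinal cC) (- c%:R + (c' : nat)%:R).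
  have mu0 : mu != 0.
    apply/prodf_neq0 => c' cc'; rewrite addrC subr_eq0 eqr_nat; apply: contraNneq cc' => e.
    exact/eqP/val_inj.
  have [|Qt [Qt0 h]] := local_shift iso (hsep _) _ mu0; first by rewrite cS.
  exists Qt; split=> // t0 ht; have [i|Dv [Dv0 h']] := h t0 ht (bv t0) (- c%:R).
    rewrite bvE (bigD1 (Ordinal cC)) //= [X in _ + X]big1 ?addr0; first exact: mulrC.
    move=> c' cc'; rewrite (bigD1 (Ordinal cC)) 1?eq_sym //= addNr mul0r mulr0 //.
  by exists Dv; split=> // v0 hv _; exact: h'.
have [Qt hQ] := @fin_all_exists _ _ _ step1.
have [t ht] := @poly_common_nonroot _ Qt (fun S => (hQ S).1).
have [Dv hD] := @fin_all_exists _ _ _ (fun S => (hQ S).2 t (ht S)).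
have [v hv] := @poly_common_nonroot _ Dv (fun S => (hD S).1).
exists v, t => b; pose b' i := (bv t i).[v].
have Q0 : shift b' P != 0 by exact: shift_neq0.
have -> : shift b P = shift b' P.
  rewrite /shift !compE; apply: eq_bigr => m _; congr (_ *: _).
  by apply: eq_bigr => i _; rewrite /b' bvE.
pose sz (m : 'X_{1..n}) := #|[set i | m i != 0%N]|.
have ex : exists k, has (fun m => sz m == k) (msupp (shift b' P)).
  by exists (sz (mlead (shift b' P))); apply/hasP; exists (mlead (shift b' P)); rewrite ?mlead_supp.
case: (ex_minnP ex) => k /hasP[m mQ /eqP mk] mink; exists m; split=> //.
(* The monomial [m] has minimal support. With [l0] or more variables it would block every set [S] of
   [l0] of them. *)
rewrite ltnNge; apply/negP => le; have [S [Ssub cS]] : exists S : {set 'I_n}, S \subset [set i | m i != 0%N] /\ #|S| = l0.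
  have [s [us ss]] : exists s : seq 'I_n, uniq s /\ s = take l0 (enum [set i | m i != 0%N]).
    by eexists; split; [|reflexivity]; exact/take_uniq/enum_uniq.
  exists [set i in s]; split.
    by apply/subsetP => i; rewrite inE ss => /mem_take; rewrite mem_enum.
  by rewrite cardsE (card_uniqP us) ss size_takel // -cardE.
apply: ((hD S).2 v (hv S) cS); exists m; split=> //.
  by move=> i /(subsetP Ssub); rewrite inE.
move=> m' m'Q sub i mi; apply: contraT => /negPn/eqP m'i.
have : (sz m' < k)%N.
  rewrite -mk; apply: proper_card; apply/properP; split.
    by apply/subsetP => j; rewrite !inE; exact: sub.
  by exists i; rewrite !inE ?mi // m'i.
rewrite ltnNge mink //; apply/hasP; by exists m'.
Qed.

(** * Hashing concentrated monomials *)

Lemma msize_leP n (p : {mpoly rat[n]}) d :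
  reflect (forall m, m \in msupp p -> (mdeg m <= d)%N) (msize p <= d.+1)%N.
Proof.
rewrite msizeE; apply: (iffP (bigmax_leqP_seq _ _ _ _)) => h m mp; first exact: h.
by move=> _; exact: h.
Qed.

Lemma msizeM_bound n (p q : {mpoly rat[n]}) a b :
  (msize p <= a.+1)%N -> (msize q <= b.+1)%N -> (msize (p * q) <= (a + b).+1)%N.
Proof.
move=> /msize_leP hp /msize_leP hq; apply/msize_leP => m /msuppM_le /allpairsP[[x y] [/= hx hy ->]].
by rewrite mdegD leq_add ?hp ?hq.
Qed.

Lemma msizeD_bound n (p q : {mpoly rat[n]}) d :
  (msize p <= d)%N -> (msize q <= d)%N -> (msize (p + q) <= d)%N.
Proof. by move=> hp hq; apply: leq_trans (msizeD_le _ _) _; rewrite geq_max hp. Qed.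

Lemma msize_sum_bound n (I : Type) (r : seq I) (Q : pred I) (F : I -> {mpoly rat[n]}) d :
  (forall i, Q i -> (msize (F i) <= d)%N) -> (msize (\sum_(i <- r | Q i) F i) <= d)%N.
Proof.
by move=> h; elim/big_ind: _ => //; [rewrite mmeasure0|move=> *; exact: msizeD_bound].
Qed.

Lemma msizeXn_bound n (p : {mpoly rat[n]}) a k :
  (msize p <= a.+1)%N -> (msize (p ^+ k) <= (k * a).+1)%N.
Proof.
move=> h; elim: k => [|k IH]; first by rewrite expr0 msize1.
by rewrite exprS mulSn; exact: msizeM_bound.
Qed.

Lemma msize_prod_bound n (I : Type) (r : seq I) (Q : pred I) (F : I -> {mpoly rat[n]}) (d : I -> nat) :
  (forall i, Q i -> (msize (F i) <= (d i).+1)%N) ->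
  (msize (\prod_(i <- r | Q i) F i) <= (\sum_(i <- r | Q i) d i).+1)%N.
Proof.
move=> h; apply: (big_rec2 (fun x y => msize x <= y.+1)%N); first by rewrite msize1.
by move=> i y x hi hy; apply: msizeM_bound => //; exact: h.
Qed.

Lemma msizeZ_bound n (p : {mpoly rat[n]}) c d : (msize p <= d)%N -> (msize (c *: p) <= d)%N.
Proof. by move=> h; apply: leq_trans (msizeZ_le _ _) h. Qed.

Lemma msize_comp_bound n k (h : 'I_n -> {mpoly rat[k]}) u S d :
  (msize u <= S.+1)%N -> (forall i, msize (h i) <= d.+1)%N -> (msize (comp h u) <= (S * d).+1)%N.
Proof.
move=> /msize_leP hu hh; rewrite compE big_seq; apply: msize_sum_bound => m mu; apply: msizeZ_bound.
apply: (@leq_trans (\sum_i (m i * d)).+1).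
  by apply: (@msize_prod_bound _ _ _ _ _ (fun i => m i * d)%N) => i _; exact: msizeXn_bound.
by rewrite ltnS -big_distrl /= leq_mul2r -mdegE hu ?orbT.
Qed.

(** If every [q] in the range overfills a bucket, the at least [kap * kap.+1] ordered pairs in that
    bucket put this power of [q] into the product of all pairwise distances. By [common_multiple_ge]
    the product would exceed its size bound. *)
Lemma hash_modulus n (S : {set 'I_n}) d l kap M :
  (n <= 2 ^ d)%N -> (#|S| <= l)%N -> (d * (l * l) < M * (kap * kap.+1))%N ->
  exists q, (0 < q <= M.*2)%N /\ forall r, (#|[set i in S | i %% q == r]%N| <= kap)%N.
Proof.
move=> nd Sl hM; apply: NNPP => hn.
pose g (i i' : 'I_n) := ((i - i') + (i' - i))%N.
pose N := (\prod_(i in S) \prod_(i' in S :\ i) g i i')%N.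
have g0 i i' : i' != i -> (0 < g i i' <= 2 ^ d)%N.
  have := ltn_ord i; have := ltn_ord i'; rewrite -val_eqE /= /g; move: (val i) (val i') nd => x y; lia.
have N0 : (0 < N)%N.
  by apply: prodn_cond_gt0 => i iS; apply: prodn_cond_gt0 => i'; rewrite !inE => /andP[/g0/andP[]].
have N1 : (N <= 2 ^ (d * (l * l)))%N.
  rewrite mulnA expnM; apply: (@leq_trans (\prod_(i in S) (2 ^ (d * l)))).
    apply: leq_prod => i iS; apply: (@leq_trans (\prod_(i' in S :\ i) (2 ^ d))).
      by apply: leq_prod => i'; rewrite !inE => /andP[/g0/andP[]].
    rewrite prod_nat_const expnM leq_pexp2l ?expn_gt0 //.
    exact: leq_trans (subset_leq_card (subD1set _ _)) Sl.
  by rewrite prod_nat_const leq_pexp2l ?expn_gt0.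
have : (2 ^ (M * (kap * kap.+1)) <= N)%N.
  apply: common_multiple_ge => // q hq.
  have [r hr] : exists r, (kap < #|[set i in S | i %% q == r]%N|)%N.
    apply: NNPP => hr; apply: hn; exists q; split=> // r; rewrite leqNgt; apply/negP => h.
    by apply: hr; exists r.
  set T := [set i in S | _] in hr.
  have TS : T \subset S by apply/subsetP => i; rewrite inE => /andP[].
  have dsub (A B : {set 'I_n}) (F : 'I_n -> nat) : A \subset B -> (\prod_(i in A) F i %| \prod_(i in B) F i)%N.
    by move=> AB; rewrite [X in (_ %| X)%N](big_setID A) /= (setIidPr AB) dvdn_mulr.
  apply: dvdn_trans (dsub _ _ _ TS).
  apply: (@dvdn_trans (\prod_(i in T) \prod_(i' in T :\ i) g i i')); last first.
    by elim/big_ind2: _ => // [*|i _]; [exact: dvdn_mul|apply: dsub; exact: setSD].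
  apply: (@dvdn_trans (\prod_(i in T) \prod_(i' in T :\ i) q)); last first.
    rewrite big_seq_cond [X in (_ %| X)%N]big_seq_cond.
    elim/big_ind2: _ => // [*|i /andP[_ iT]]; first exact: dvdn_mul.
    rewrite big_seq_cond [X in (_ %| X)%N]big_seq_cond.
    elim/big_ind2: _ => // [*|i' /andP[_ ]]; first exact: dvdn_mul.
    rewrite !inE in iT *; case/andP: iT => _ /eqP ir /and3P[_ _ /eqP ir'].
    by apply: dvdn_dist; rewrite ir ir'.
  under eq_bigr => i iT.
    rewrite prod_nat_const (_ : #|T :\ i| = #|T|.-1); last by rewrite (cardsD1 i T) iT.
  over.
  rewrite prod_nat_const -expnM; apply: dvdn_exp2l; case: #|T| hr => // t; rewrite ltnS => kt.
  by rewrite leq_mul.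
by rewrite leqNgt => /negP; apply; apply: leq_ltn_trans N1 _; rewrite ltn_exp2l.
Qed.

Section Selector.
Variables (R : comNzRingType) (n kap q : nat).

(* The value at i of the low-support generator: in the bucket i %% q there are
   kap pairs (y, z), and z is meant to be -i for the live coordinates i. *)
Definition selector (x : nat -> R) (i : nat) : R :=
  \sum_(u < kap) x (2 * (kap * (i %% q) + u))%N *
    \prod_(i' < n | (i' : nat) != i) (x (2 * (kap * (i %% q) + u)).+1 + i'%:R).

End Selector.

(** Setting the variables outside the support of [m] to zero keeps [m], so some point with that
    support hits [P]. Each bucket has at most [kap] live coordinates, and each gets its own pair;
    the entry [-i] kills the contribution of this pair to all other coordinates. *)
Lemma selector_hits n kap q (P : {mpoly rat[n]}) m : (0 < q)%N ->
  m \in msupp P -> (forall r, (#|[set i : 'I_n | (m i != 0%N) && (i %% q == r)%N]| <= kap)%N) ->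
  exists x : nat -> rat, P.@[fun i => selector n kap q x i] != 0.
Proof.
move=> q0 mP hload; pose S := [set i : 'I_n | m i != 0%N].
pose A := [pred i : 'I_n | i \in S].
have [z hz] : exists z : 'I_n -> rat, P.@[fun i => if i \in S then z i else 0] != 0.
  pose PS := comp (fun i => if i \in S then 'X_i else 0 : {mpoly rat[n]}) P.
  suff /mpoly_nonroot[z hz] : PS != 0.
    exists z; apply: contraNneq hz => e; rewrite meval_comp -[X in _ == X]e; apply/eqP.
    by apply: meval_eq => i; case: ifP => _; rewrite ?mevalXU ?meval0.
  apply/eqP => /(congr1 (mcoeff m)); rewrite mcoeff0 /PS compE raddf_sum /=.
  rewrite (bigD1_seq m) ?msupp_uniq //= [X in _ + X]big1 => [|m' mm'].
    rewrite addr0 (_ : \prod_i _ = 'X_[m]).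
      by rewrite mcoeffZ mcoeffX eqxx mulr1 => /eqP; rewrite mcoeff_eq0 mP.
    rewrite [RHS]mpolyXE_id; apply: eq_bigr => i _; rewrite inE; case: eqP => [->|//].
    by rewrite !expr0.
  rewrite mcoeffZ; case: (boolP [forall i, (i \in S) || (m' i == 0%N)]) => [/forallP h|].
    rewrite (_ : \prod_i _ = 'X_[m']); first by rewrite mcoeffX (negbTE mm') mulr0.
    rewrite [RHS]mpolyXE_id; apply: eq_bigr => i _; have := h i; case: (i \in S) => //= /eqP ->.
    by rewrite !expr0.
  rewrite negb_forall => /existsP[i]; rewrite negb_or => /andP[/negbTE iS mi].
  by rewrite (bigD1 i) //= iS expr0n (negbTE mi) mul0r mcoeff0 mulr0.
pose T r := [set i : 'I_n | (m i != 0%N) && (i %% q == r)%N].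
pose dlt (i : 'I_n) : rat := \prod_(i' < n | i' != i) (- (i : nat)%:R + (i' : nat)%:R).
have dlt0 i : dlt i != 0.
  by apply/prodf_neq0 => i' ii'; rewrite addrC subr_eq0 eqr_nat; apply: contraNneq ii' => e; apply/eqP/val_inj.
pose live r u : option 'I_n := ohead (drop u (enum (T r))).
(* The entries with half [kap * r + u] belong to the [u]-th live coordinate of bucket [r]. Dividing
   by [dlt] cancels the product that remains when a coordinate meets its own pair. *)
pose x (I : nat) : rat :=
  if live (half I %/ kap)%N (half I %% kap)%N is Some i then (if odd I then - (i : nat)%:R else z i / dlt i) else 0.
exists x; apply: contraNneq hz => e; rewrite -[X in _ == X]e; apply/eqP; apply: meval_eq => i.
rewrite /selector; pose r := (i %% q)%N.
have xe (u : 'I_kap) : x (2 * (kap * r + u))%N = (if live r u is Some j then z j / dlt j else 0) /\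
    x (2 * (kap * r + u)).+1 = (if live r u is Some j then - (j : nat)%:R else 0).
  have k0 : (0 < kap)%N by case: (kap) u => [[]|].
  have e1 : ((kap * r + u) %/ kap = r)%N by rewrite mulnC divnMDl // divn_small ?addn0.
  have e2 : ((kap * r + u) %% kap = u)%N by rewrite mulnC modnMDl modn_small.
  by rewrite /x mul2n; split; rewrite /= ?doubleK ?uphalf_double ?odd_double /= e1 e2.
under eq_bigr => u _ do rewrite (xe u).1 (xe u).2.
case: ifP => iS.
  have iT : i \in enum (T r) by rewrite mem_enum inE eqxx andbT; move: iS; rewrite inE.
  have lt : (index i (enum (T r)) < kap)%N.
    by apply: leq_trans (hload r); rewrite cardE index_mem.
  have lv (u : nat) : live r u = if (u < #|T r|)%N then Some (nth i (enum (T r)) u) else None.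
    rewrite /live cardE; case: ltnP => h; first by rewrite (drop_nth i).
    by rewrite drop_oversize.
  rewrite (bigD1 (Ordinal lt)) //= [X in _ + X]big1 => [|u ui].
    rewrite lv cardE index_mem iT nth_index // addr0 -/(dlt i) divfK //.
  rewrite lv; case: ltnP => h; last by rewrite mul0r.
  have ne : nth i (enum (T r)) u != i.
    apply: contraNneq ui => e'; apply/eqP/val_inj => /=.
    by rewrite -[in RHS]e' index_uniq ?enum_uniq // -cardE.
  by rewrite [X in _ * X](bigD1 (nth i (enum (T r)) u)) //= addNr mul0r mulr0.
rewrite big1 // => u _; case lvu: (live r u) => [j|]; last by rewrite mul0r.
have jT : j \in T r.
  have : j \in drop u (enum (T r)) by move: lvu; rewrite /live; case: drop => // a s [->]; rewrite mem_head.
  by move/mem_drop; rewrite mem_enum.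
have ne : j != i.
  by apply: contraTneq jT => ->; rewrite inE; move: iS; rewrite inE => ->.
by rewrite [X in _ * X](bigD1 j) //= addNr mul0r mulr0.
Qed.

(** Variables indexed by natural numbers, with 0 as the value outside the range. *)
Definition mvar N (k : nat) : {mpoly rat[N]} := if insub k is Some i then 'X_i else 0.

Lemma meval_mvar N k (x : nat -> rat) : (k < N)%N -> (mvar N k).@[fun i => x i] = x k.
Proof. by move=> kN; rewrite /mvar insubT /= mevalXU. Qed.

Lemma msize_mvar N k : (msize (mvar N k) <= 2)%N.
Proof. by rewrite /mvar; case: insub => [i|]; rewrite ?mmeasure0 // msizeX mdeg1. Qed.

Section BucketLevels.
Variables (n : nat) (P : {mpoly rat[n]}) (kap L q D d N m W X s : nat).
Hypotheses (k0 : (0 < kap)%N) (q0 : (0 < q)%N) (qL : (q <= 2 ^ L)%N).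
Hypotheses (hD : (D <= 2 ^ d)%N) (hs : (msize P <= s.+1)%N) (hsD : (s * n < D)%N) (n0 : (0 < n)%N).
Hypothesis hsep : forall A : {pred 'I_n}, sep A W P.
Hypotheses (hX1 : (D ^ (2 * kap) <= X)%N) (hX2 : (W * W <= X)%N).
Hypothesis hm : (d * (2 * kap * 2 ^ L).+1 * (2 ^ L * (X * X)) < m)%N.
Hypothesis hN : (D * m.*2 <= N)%N.
Hypothesis hP : exists x : nat -> rat, P.@[fun i => selector n kap q x i] != 0.

Let NV := (2 * kap * 2 ^ L)%N.
Let h (i : 'I_n) : {mpoly rat[NV]} := selector n kap q (mvar NV) i.

Lemma bucket_index_lt (i u : nat) : (u < kap)%N -> ((2 * (kap * (i %% q) + u)).+1 < NV)%N.
Proof.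
move=> uk; have := leq_trans (ltn_pmod i q0) qL.
rewrite /NV; move: (i %% q)%N (2 ^ L)%N => r T; nia.
Qed.

Lemma bucket_div (r u b : nat) : (u < kap)%N -> (b < 2)%N ->
  ((2 * (kap * r + u) + b) %/ (2 * kap) = r)%N.
Proof.
move=> uk b2; rewrite (_ : _ + b = r * (2 * kap) + (2 * u + b))%N; last lia.
by rewrite divnMDl ?muln_gt0 ?k0 // divn_small ?addn0 //; lia.
Qed.

Lemma meval_h i (x : nat -> rat) : (h i).@[fun i => x i] = selector n kap q x i.
Proof.
rewrite /h /selector raddf_sum /=; apply: eq_bigr => u _; have lt := bucket_index_lt i (ltn_ord u).
rewrite mevalM meval_mvar ?(ltnW lt) // rmorph_prod /=; congr (_ * _).
by apply: eq_bigr => i' _; rewrite mevalD meval_mvar // -mpolyC_nat mevalC.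
Qed.

Lemma msize_h i : (msize (h i) <= n.+1)%N.
Proof.
apply: msize_sum_bound => u _.
have e : (1 + \sum_(i' < n | (i' : nat) != i) 1 = n)%N.
  by rewrite -[RHS]card_ord -sum1_card [RHS](bigD1 i).
apply: (@leq_trans (1 + \sum_(i' < n | (i' : nat) != i) 1).+1); last by rewrite e.
apply: msizeM_bound; first exact: msize_mvar.
apply: (@msize_prod_bound _ _ _ _ _ (fun _ => 1%N)) => i' _; apply: msizeD_bound; first exact: msize_mvar.
by rewrite -mpolyC_nat msizeC; case: (_ != _).
Qed.

Let idx (I : 'I_NV) : nat := (I %/ (2 * kap))%N.

(** After the substitution a coordinate depends only on the pairs of its own bucket. A set of
    buckets therefore inherits the separation of the coordinates hashed into it, and the level
    construction applies with [2 * kap] variables per lowest block. *)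
Lemma bucket_isolation : exists ps : seq nat, [/\ size ps = L.+1,
  forall p, p \in ps -> (0 < p <= m.*2)%N &
  exists t : rat, P.@[fun i => selector n kap q (fun I => t ^+ level_weight D N ps I) i] != 0].
Proof.
pose R := comp h P.
have R0 : R != 0.
  have [x hx] := hP; apply: contraNneq hx => e; have := meval_comp h P (fun I => x I).
  rewrite -/R e meval0 => z; apply/eqP; rewrite [RHS]z; apply: meval_eq => i; by rewrite meval_h.
have D0 : (0 < D)%N by apply: leq_ltn_trans hsD.
have k20 : (0 < 2 * kap)%N by rewrite muln_gt0 k0.
have hRD : (msize R <= D)%N.
  by apply: leq_trans hsD; apply: msize_comp_bound => // i; exact: msize_h.
have [||ps [sps hps iso]] := @isolating_levels NV R idx D d N m (2 * kap) W X L hD D0 hRD _ _ hX1 hX2 hm hN L (leqnn _).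
- move=> j; rewrite -[X in (_ <= X)%N]card_ord.
  pose g (I : 'I_NV) : 'I_(2 * kap) := Ordinal (ltn_pmod I k20).
  rewrite -(card_in_imset (f := g)); first exact: max_card.
  move=> I I'; rewrite !inE expn0 !divn1 => /eqP e1 /eqP e2 /(congr1 val) /= e3; apply: val_inj => /=.
  by rewrite (divn_eq I (2 * kap)) (divn_eq I' (2 * kap)) e3 -[(I %/ _)%N]/(idx I) -[(I' %/ _)%N]/(idx I') e1 e2.
- move=> l j; apply: (@sep_comp _ _ h [pred i : 'I_n | (i %% q) %/ 2 ^ l == j]%N) => [i|i|].
  + rewrite inE => hi; apply: poly_over_sum => u _; have lt := bucket_index_lt i (ltn_ord u).
    have ov b : (b < 2)%N -> poly_over [pred I | idx I %/ 2 ^ l == j]%N (mvar NV (2 * (kap * (i %% q) + u) + b)).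
      move=> b2; have lt' : (2 * (kap * (i %% q) + u) + b < NV)%N by apply: leq_ltn_trans lt; lia.
      rewrite /mvar insubT; apply: poly_overX; by rewrite inE /idx /= bucket_div.
    apply: poly_overM; first by have := ov 0%N isT; rewrite addn0.
    apply: poly_over_prod => i' _; apply: poly_overD; first by have := ov 1%N isT; rewrite addn1.
    by rewrite -mpolyC_nat; exact: poly_overC.
  + rewrite inE => hi; apply: poly_over_sum => u _; have lt := bucket_index_lt i (ltn_ord u).
    have ov b : (b < 2)%N -> poly_over [predC [pred I | idx I %/ 2 ^ l == j]%N] (mvar NV (2 * (kap * (i %% q) + u) + b)).
      move=> b2; have lt' : (2 * (kap * (i %% q) + u) + b < NV)%N by apply: leq_ltn_trans lt; lia.
      rewrite /mvar insubT; apply: poly_overX; by rewrite !inE /idx /= bucket_div.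
    apply: poly_overM; first by have := ov 0%N isT; rewrite addn0.
    apply: poly_over_prod => i' _; apply: poly_overD; first by have := ov 1%N isT; rewrite addn1.
    by rewrite -mpolyC_nat; exact: poly_overC.
  + exact: hsep.
exists ps; split=> //.
have full I : I \in [pred I : 'I_NV | idx I %/ 2 ^ L == 0]%N.
  rewrite inE /idx -divnMA divn_small //; exact: ltn_ord.
have /poly_nat_nonroot/(_ (leqnSn _))[t _ ht] := isolates_nonzero full (iso 0%N (expn_gt0 _ _)) R0.
exists t%:R; move: ht; rewrite -meval_horner meval_comp; congr (_ != 0).
apply: meval_eq => i; rewrite -meval_h; apply: meval_eq => I; by rewrite hornerXn.
Qed.

End BucketLevels.

(** * Logarithmic derivatives and the lowest homogeneous part *)

Definition ge_deg n (d : nat) (p : {mpoly rat[n]}) := forall m, m \in msupp p -> (d <= mdeg m)%N.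

Lemma ge_degD n d (p q : {mpoly rat[n]}) : ge_deg d p -> ge_deg d q -> ge_deg d (p + q).
Proof. by move=> hp hq m /msuppD_le; rewrite mem_cat => /orP[/hp|/hq]. Qed.

Lemma ge_degN n d (p : {mpoly rat[n]}) : ge_deg d p -> ge_deg d (- p).
Proof. by move=> hp m; rewrite (perm_mem (msuppN p)); exact: hp. Qed.

Lemma ge_degM n a b (p q : {mpoly rat[n]}) : ge_deg a p -> ge_deg b q -> ge_deg (a + b) (p * q).
Proof.
move=> hp hq m /msuppM_le /allpairsP[[x y] [/= /hp hx /hq hy ->]]; rewrite mdegD.
exact: leq_add.
Qed.

Lemma ge_deg_any n (p : {mpoly rat[n]}) : ge_deg 0 p. Proof. by []. Qed.

Lemma ge_deg_le n a b (p : {mpoly rat[n]}) : (a <= b)%N -> ge_deg b p -> ge_deg a p.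
Proof. by move=> ab h m /h; exact: leq_trans. Qed.

Lemma ge_degX n a k (p : {mpoly rat[n]}) : ge_deg a p -> ge_deg (k * a) (p ^+ k).
Proof.
move=> h; elim: k => [|k IH]; first exact: ge_deg_any.
by rewrite exprS mulSn; exact: ge_degM.
Qed.

(** Equality modulo the [d]-th power of the ideal generated by the variables. *)
Definition cong n d (p q : {mpoly rat[n]}) := ge_deg d (p - q).

Lemma cong_refl n d (p : {mpoly rat[n]}) : cong d p p.
Proof. by move=> m; rewrite subrr msupp0. Qed.

Lemma congD n d (p p' q q' : {mpoly rat[n]}) : cong d p p' -> cong d q q' -> cong d (p + q) (p' + q').
Proof.
move=> hp hq; rewrite /cong (_ : _ - _ = (p - p') + (q - q')); last by ring.
exact: ge_degD.
Qed.

Lemma congM n d (p p' q q' : {mpoly rat[n]}) : cong d p p' -> cong d q q' -> cong d (p * q) (p' * q').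
Proof.
move=> hp hq; rewrite /cong (_ : _ - _ = (p - p') * q + p' * (q - q')); last by ring.
apply: ge_degD; first by rewrite -[d]addn0; apply: ge_degM => //; exact: ge_deg_any.
by rewrite -[d]add0n; apply: ge_degM => //; exact: ge_deg_any.
Qed.

Lemma cong_sum n d (I : Type) (r : seq I) (Q : pred I) (F G : I -> {mpoly rat[n]}) :
  (forall i, Q i -> cong d (F i) (G i)) -> cong d (\sum_(i <- r | Q i) F i) (\sum_(i <- r | Q i) G i).
Proof.
move=> h; elim/big_ind2: _ => //; [exact: cong_refl|by move=> *; exact: congD].
Qed.

Lemma cong_prod n d (I : Type) (r : seq I) (Q : pred I) (F G : I -> {mpoly rat[n]}) :
  (forall i, Q i -> cong d (F i) (G i)) -> cong d (\prod_(i <- r | Q i) F i) (\prod_(i <- r | Q i) G i).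
Proof.
move=> h; elim/big_ind2: _ => //; [exact: cong_refl|by move=> *; exact: congM].
Qed.

Lemma cong_det n d r (A B : 'M[{mpoly rat[n]}]_r) : (forall i j, cong d (A i j) (B i j)) ->
  cong d (\det A) (\det B).
Proof.
move=> h; apply: cong_sum => s _; apply: congM; first exact: cong_refl.
by apply: cong_prod => i _.
Qed.

Lemma mcoeff0_shift n (a : 'I_n -> rat) p : (shift a p)@_0%MM = p.@[a].
Proof.
have -> : (shift a p)@_0%MM = (shift a p).@[fun _ => 0].
  rewrite mevalE; case: (boolP (0%MM \in msupp (shift a p))) => h.
    rewrite (bigD1_seq _ h) ?msupp_uniq //= big1 ?mulr1 => [|i _]; last by rewrite mnm0E expr0.
    rewrite [X in _ + X]big1 ?addr0 // => m m0; have [i mi] : exists i, m i != 0%N.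
      apply: NNPP => hn; case/eqP: m0; apply/mnmP => i; rewrite mnm0E; apply/eqP/negPn/negP => e.
      by apply: hn; exists i.
    by rewrite (bigD1 i) //= expr0n (negbTE mi) mul0r mulr0.
  rewrite (memN_msupp_eq0 h) big_seq big1 // => m mp; have [i mi] : exists i, m i != 0%N.
    apply: NNPP => hn; case/negP: h; rewrite (_ : 0%MM = m) //; apply/mnmP => i.
    by rewrite mnm0E; apply/esym/eqP/negPn/negP => e; apply: hn; exists i.
  by rewrite (bigD1 i) //= expr0n (negbTE mi) mul0r mulr0.
by rewrite meval_shift; apply: meval_eq => i; rewrite add0r.
Qed.

Section LogDerivative.
Variables (n r : nat) (al : 'I_n -> rat) (T : 'I_r -> seq {mpoly rat[n]}) (C : 'I_r -> 'I_n).
Hypothesis hal : forall u g, g \in T u -> g.@[al] != 0.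

Definition small_part (g : {mpoly rat[n]}) : {mpoly rat[n]} := 1 - (g.@[al])^-1 *: shift al g.

(** Shifted by [al], the factor is [g.@[al]] times [1 - small_part g], and [small_part g] has no
    constant term; this is the geometric series cut after degree [D]. *)
Definition trunc_inv (D : nat) (g : {mpoly rat[n]}) : {mpoly rat[n]} :=
  (g.@[al])^-1 *: \sum_(e < D.+1) small_part g ^+ e.

(* Up to order D and the shift by al, the entries are the logarithmic derivatives
   sum_g (d g / g) of the products T u. *)
Definition log_jacobian (D : nat) : {mpoly rat[n]} :=
  \det (\matrix_(u, v) \sum_(g <- T u) shift al g^`M(C v) * trunc_inv D g).

Definition jacobian : {mpoly rat[n]} := \det (\matrix_(u, v) (\prod_(g <- T u) g)^`M(C v)).

Lemma small_part_ge1 g : g.@[al] != 0 -> ge_deg 1 (small_part g).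
Proof.
move=> g0 m mg; rewrite lt0n mdeg_eq0; apply: contraTneq mg => ->; rewrite mcoeff_msupp negbK.
rewrite /small_part raddfB /= mcoeffZ mcoeff0_shift mulVf // -mpolyC1 mcoeffC eqxx mulr1.
by rewrite subrr.
Qed.

Lemma trunc_invP D g : g.@[al] != 0 -> cong D.+1 (shift al g * trunc_inv D g) 1.
Proof.
move=> g0; have e : shift al g = g.@[al] *: (1 - small_part g).
  by rewrite /small_part opprB addrCA subrr addr0 scalerA divff // scale1r.
rewrite /trunc_inv e -scalerAl -scalerAr scalerA divff // scale1r.
have := subrX1 (small_part g) D.+1 => h.
rewrite /cong (_ : _ - 1 = - (small_part g ^+ D.+1)); last first.
  by rewrite -[X in X - 1]opprK -mulNr opprB -h; ring.
by apply: ge_degN; rewrite -[D.+1 in X in ge_deg X]muln1; apply: ge_degX; exact: small_part_ge1.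
Qed.

Lemma log_derivative D v (l : seq {mpoly rat[n]}) : (forall g, g \in l -> g.@[al] != 0) ->
  cong D.+1 (shift al (\prod_(g <- l) g)^`M(v))
    ((\prod_(g <- l) shift al g) * \sum_(g <- l) shift al g^`M(v) * trunc_inv D g).
Proof.
elim: l => [|g l IH] hl.
  rewrite !big_nil mulr0 -mpolyC1 mderivC rmorph0; exact: cong_refl.
have g0 := hl g (mem_head _ _).
have {}IH := IH (fun x (xl : x \in l) => hl x ltac:(by rewrite inE xl orbT)).
rewrite !big_cons mderivM rmorphD !rmorphM /= rmorph_prod mulrDr; apply: congD.
  rewrite [X in cong _ X _](_ : _ = 1 * (shift al g^`M(v) * \prod_(i <- l) shift al i)); last by rewrite mul1r.
  rewrite [X in cong _ _ X](_ : _ = (shift al g * trunc_inv D g) *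
    (shift al g^`M(v) * \prod_(i <- l) shift al i)); last by ring.
  apply: congM; last exact: cong_refl.
  rewrite /cong -opprB; apply: ge_degN; exact: trunc_invP.
rewrite -mulrA; apply: congM; [exact: cong_refl|exact: IH].
Qed.

(** Row [u] of the Jacobian has the product of [T u] as common factor; pulling it out leaves the
    logarithmic derivatives. *)
Lemma jacobian_cong D : cong D.+1 (shift al jacobian)
  ((\prod_u \prod_(g <- T u) shift al g) * log_jacobian D).
Proof.
have -> : (\prod_u \prod_(g <- T u) shift al g) * log_jacobian D =
  \det (\matrix_(u, v) ((\prod_(g <- T u) shift al g) * \sum_(g <- T u) shift al g^`M(C v) * trunc_inv D g)).
  rewrite /log_jacobian -[\prod_u _](_ : \det (diag_mx (\row_u \prod_(g <- T u) shift al g)) = _).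
    rewrite -det_mulmx; congr (\det _); apply/matrixP => u v.
    by rewrite mul_diag_mx !mxE.
  by rewrite det_diag; apply: eq_bigr => u _; rewrite mxE.
rewrite /jacobian -det_map_mx; apply: cong_det => u v; rewrite !mxE.
by apply: log_derivative => g gT; apply: hal gT.
Qed.

(** [D] is the lowest degree of the shifted minor and also the truncation order. Up to this order
    the product [Q] of the shifted factors is invertible, so [log_jacobian] has no terms below
    degree [D], and in degree [D] multiplication by [Q] is multiplication by its constant term. *)
Lemma lowest_part : jacobian != 0 -> exists D c, [/\ (D < msize jacobian)%N, c != 0,
  exists2 m, m \in msupp (shift al jacobian) & mdeg m = D
  & forall m, mdeg m = D -> (shift al jacobian)@_m = c * (log_jacobian D)@_m].
Proof.
move=> J0; pose Js := shift al jacobian; have Js0 : Js != 0 by exact: shift_neq0.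
have ex : exists k, has (fun m => mdeg m == k) (msupp Js).
  by exists (mdeg (mlead Js)); apply/hasP; exists (mlead Js); rewrite ?mlead_supp.
case: (ex_minnP ex) => D /hasP[m0 m0J /eqP m0D] minD.
pose Q := \prod_u \prod_(g <- T u) shift al g; pose c := \prod_u \prod_(g <- T u) g.@[al].
pose I := \prod_u \prod_(g <- T u) trunc_inv D g; pose F := log_jacobian D.
have JD : ge_deg D Js by move=> m mJ; apply: minD; apply/hasP; exists m.
have Qc : Q@_0%MM = c.
  have -> : Q = shift al (\prod_u \prod_(g <- T u) g).
    by rewrite rmorph_prod; apply: eq_bigr => u _; rewrite rmorph_prod.
  rewrite mcoeff0_shift rmorph_prod; apply: eq_bigr => u _; exact: rmorph_prod.
have QI : cong D.+1 (Q * I) 1.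
  have -> : Q * I = \prod_u \prod_(g <- T u) (shift al g * trunc_inv D g).
    by rewrite -big_split; apply: eq_bigr => u _; rewrite -big_split.
  rewrite [X in cong _ _ X](_ : _ = \prod_(u < r) \prod_(g <- T u) (1 : {mpoly rat[n]})); last first.
    by rewrite big1 // => u _; rewrite big1.
  apply: cong_prod => u _; rewrite !big_seq; apply: cong_prod => g gT; apply: trunc_invP; exact: hal gT.
have JQ : cong D.+1 Js (Q * F) by exact: jacobian_cong.
have FD : ge_deg D F.
  (* As [Q * I] is 1 up to order [D], [F] agrees with [Js * I] to that order and inherits the
     absence of lower terms. *)
  rewrite (_ : F = - (Q * I - 1) * F + (Q * F - Js) * I + Js * I); last by ring.
  apply: ge_degD; [apply: ge_degD|].
  - apply: ge_deg_le (leqnSn D) _; rewrite -[D.+1]addn0; apply: ge_degM; last exact: ge_deg_any.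
    exact: ge_degN.
  - apply: ge_deg_le (leqnSn D) _; rewrite -[D.+1]addn0; apply: ge_degM; last exact: ge_deg_any.
    by rewrite -opprB; exact: ge_degN.
  - by rewrite -[D]addn0; apply: ge_degM => //; exact: ge_deg_any.
have JF : cong D.+1 Js (c *: F).
  rewrite /cong (_ : _ - _ = (Js - Q * F) + (Q - c%:MP) * F); last by rewrite -mul_mpolyC; ring.
  apply: ge_degD => //; rewrite -[D.+1]add1n; apply: ge_degM => // m mQ.
  rewrite lt0n mdeg_eq0; apply: contraTneq mQ => ->; rewrite mcoeff_msupp negbK.
  by rewrite mcoeffB mcoeffC eqxx mulr1 Qc subrr.
exists D, c; split.
(* A shift is inverted by a shift, so it preserves the degree. *)
- rewrite -m0D -[X in (_ < X)%N](_ : msize Js = _); first exact: msize_mdeg_lt.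
  apply/eqP; rewrite eqn_leq; apply/andP; split.
    rewrite (mpolySpred _ J0) -[X in X.+1]muln1; apply: msize_comp_bound.
      by rewrite -mpolySpred.
    by move=> i; apply: msizeD_bound; [rewrite msizeX mdeg1|rewrite msizeC; case: (_ != _)].
  have -> : jacobian = shift (fun i => - al i) Js.
    apply/eqP; rewrite -subr_eq0; apply/eqP/mpoly_eq0_meval => x.
    by rewrite mevalB !meval_shift; apply/eqP; rewrite subr_eq0; apply/eqP/meval_eq => i; rewrite subrK.
  rewrite (mpolySpred _ Js0) -[X in X.+1]muln1; apply: msize_comp_bound.
    by rewrite -mpolySpred.
  by move=> i; apply: msizeD_bound; [rewrite msizeX mdeg1|rewrite msizeC; case: (_ != _)].
- by apply/prodf_neq0 => u _; rewrite prodf_seq_neq0; apply/allP => g gT; apply/implyP => _; exact: hal gT.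
- by exists m0.
move=> m mD; apply/eqP; rewrite -mcoeffZ -subr_eq0 -mcoeffB mcoeff_eq0; apply/negP => /JF.
by rewrite mD ltnn.
Qed.

End LogDerivative.

(** * Separated sums under ring operations and homogeneous parts *)

Lemma sep_le n (A : {pred 'I_n}) a b p : (a <= b)%N -> sep A a p -> sep A b p.
Proof. by move=> ab [l [h1 h2 h3]]; exists l; split=> //; exact: leq_trans h1 ab. Qed.

Lemma sep0 n (A : {pred 'I_n}) : sep A 0 0.
Proof. by exists [::]; split=> //; rewrite big_nil. Qed.

Lemma sep_over1 n (A : {pred 'I_n}) p : poly_over A p -> sep A 1 p.
Proof.
move=> hp; exists [:: (p, 1)]; split=> //; last by rewrite big_seq1 mulr1.
by move=> uv; rewrite inE => /eqP ->; split=> //=; rewrite -mpolyC1; exact: poly_overC.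
Qed.

Lemma sep_over2 n (A : {pred 'I_n}) p : poly_over [predC A] p -> sep A 1 p.
Proof.
move=> hp; exists [:: (1, p)]; split=> //; last by rewrite big_seq1 mul1r.
by move=> uv; rewrite inE => /eqP ->; split=> //=; rewrite -mpolyC1; exact: poly_overC.
Qed.

Lemma sepD n (A : {pred 'I_n}) a b p q : sep A a p -> sep A b q -> sep A (a + b) (p + q).
Proof.
move=> [l [h1 h2 ->]] [l' [h1' h2' ->]]; exists (l ++ l'); split; rewrite ?size_cat ?leq_add ?big_cat //.
by move=> uv; rewrite mem_cat => /orP[/h2|/h2'].
Qed.

Lemma sepM n (A : {pred 'I_n}) a b p q : sep A a p -> sep A b q -> sep A (a * b) (p * q).
Proof.
move=> [l [h1 h2 ->]] [l' [h1' h2' ->]].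
exists [seq (x.1 * y.1, x.2 * y.2) | x <- l, y <- l']; split; first by rewrite size_allpairs leq_mul.
  move=> uv /allpairsP[[x y] [/= /h2[o1 o2] /h2'[o1' o2'] ->]] /=.
  by split; exact: poly_overM.
rewrite big_allpairs_dep big_distrl /=; apply: eq_bigr => x _; rewrite big_distrr /=.
by apply: eq_bigr => y _; rewrite mulrACA.
Qed.

Lemma sepZ n (A : {pred 'I_n}) a c p : sep A a p -> sep A a (c *: p).
Proof.
move=> h; rewrite -mul_mpolyC -[a]mul1n; apply: sepM => //; apply: sep_over1; exact: poly_overC.
Qed.

Lemma sep_sum n (A : {pred 'I_n}) (I : Type) (s : seq I) (w : I -> nat) F :
  (forall i, sep A (w i) (F i)) -> sep A (\sum_(i <- s) w i) (\sum_(i <- s) F i).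
Proof. by move=> h; elim/big_ind2: _ => //; [exact: sep0|move=> *; exact: sepD]. Qed.

Lemma sep_prod n (A : {pred 'I_n}) (I : Type) (s : seq I) (w : I -> nat) F :
  (forall i, sep A (w i) (F i)) -> sep A (\prod_(i <- s) w i) (\prod_(i <- s) F i).
Proof.
move=> h; elim/big_ind2: _ => //; last by move=> *; exact: sepM.
by apply: sep_over1; rewrite -mpolyC1; exact: poly_overC.
Qed.

(** By the binomial theorem a power of a split sum needs only [e + 1] products; this is the gain
    from sums of univariates. *)
Lemma sepXnD n (A : {pred 'I_n}) a b e : poly_over A a -> poly_over [predC A] b -> sep A e.+1 ((a + b) ^+ e).
Proof.
move=> oa ob; rewrite exprDn -[X in sep A X _](card_ord e.+1) -sum1_card; apply: sep_sum => i.
rewrite -scaler_nat; apply: sepZ; rewrite -[1%N]mul1n; apply: sepM.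
  by apply: sep_over1; exact: poly_overXn.
by apply: sep_over2; exact: poly_overXn.
Qed.

(** Homogeneous parts are the coefficients in the extra variable. Since this is a ring morphism,
    those of a product are convolutions. *)
Definition grade n : {mpoly rat[n]} -> {poly {mpoly rat[n]}} :=
  subst (polyC \o @mpolyC n rat) (fun i => ('X_i)%:P * 'X).

HB.instance Definition _ n := GRing.RMorphism.on (@grade n).

Definition homog_part n d (p : {mpoly rat[n]}) : {mpoly rat[n]} := (grade p)`_d.

Lemma homog_partE n d (p : {mpoly rat[n]}) :
  homog_part d p = \sum_(m <- msupp p | mdeg m == d) p@_m *: 'X_[m].
Proof.
rewrite /homog_part /grade substE /mmap coef_sum [RHS]big_mkcond; apply: eq_bigr => m _ /=.
have -> : mmap1 (fun i => ('X_i)%:P * 'X) m = ('X_[m])%:P * 'X^(mdeg m) :> {poly {mpoly rat[n]}}.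
  rewrite /mmap1 mpolyXE_id rmorph_prod mdegE -prodrXr -big_split /=; apply: eq_bigr => i _.
  by rewrite exprMn rmorphXn.
by rewrite coefCM coefCM coefXn eq_sym; case: eqP => _; rewrite ?mulr1 ?mulr0 // mul_mpolyC.
Qed.

Lemma mcoeff_homog_part n d (p : {mpoly rat[n]}) m :
  (homog_part d p)@_m = if mdeg m == d then p@_m else 0.
Proof.
rewrite homog_partE raddf_sum /=; case: (boolP (m \in msupp p)) => mp.
  rewrite big_mkcond (bigD1_seq _ mp) ?msupp_uniq //= [X in _ + X]big1 => [|m' mm'].
    by case: eqP => _; rewrite addr0 // mcoeffZ mcoeffX eqxx mulr1.
  by case: eqP => // _; rewrite mcoeffZ mcoeffX (negbTE mm') mulr0.
rewrite (memN_msupp_eq0 mp) if_same big_seq_cond big1 // => m' /andP[m'p _].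
by rewrite mcoeffZ mcoeffX; case: eqP => [e|_]; [rewrite -e m'p in mp|rewrite mulr0].
Qed.

Lemma homog_part_over n d (A : {pred 'I_n}) p : poly_over A p -> poly_over A (homog_part d p).
Proof.
move=> h m; rewrite mcoeff_msupp mcoeff_homog_part; case: ifP => _; last by rewrite eqxx.
by rewrite -mcoeff_msupp; exact: h.
Qed.

Lemma sep_homog_part n d (A : {pred 'I_n}) w p : sep A w p -> sep A (w * d.+1) (homog_part d p).
Proof.
case=> l [h1 h2 ->].
have -> : homog_part d (\sum_(uv <- l) uv.1 * uv.2) =
  \sum_(uv <- [seq (homog_part i uv.1, homog_part (d - i) uv.2) | uv <- l, i <- iota 0 d.+1]) uv.1 * uv.2.
  rewrite big_allpairs_dep /homog_part rmorph_sum coef_sum; apply: eq_bigr => uv _.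
  rewrite rmorphM /= coefM -(big_mkord predT (fun i => (grade uv.1)`_i * (grade uv.2)`_(d - i))).
  by rewrite /index_iota subn0.
eexists; split; last reflexivity; first by rewrite size_allpairs size_iota leq_mul2r h1 orbT.
by move=> uv /allpairsP[[x i] [/= /h2[o1 o2] _ ->]] /=; split; exact: homog_part_over.
Qed.

(** * Shifted partial derivatives *)

Definition derivs n (s : seq 'I_n) (p : {mpoly rat[n]}) : {mpoly rat[n]} :=
  foldr (fun i q => q^`M(i)) p s.

Lemma poly_over_deriv n (A : {pred 'I_n}) i p : poly_over A p -> poly_over A p^`M(i).
Proof.
move=> h m; rewrite mcoeff_msupp mcoeff_deriv mulrn_eq0 /= -mcoeff_msupp => /h om j jA.
by have := om j jA; rewrite mnmDE; case: (m j).
Qed.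

Lemma msize_deriv n i (p : {mpoly rat[n]}) d : (msize p <= d)%N -> (msize p^`M(i) <= d)%N.
Proof.
case: d => [|d]; first by rewrite leqn0 msize_poly_eq0 => /eqP ->; rewrite mderiv0 mmeasure0.
move=> /msize_leP h; apply/msize_leP => m; rewrite mcoeff_msupp mcoeff_deriv mulrn_eq0 /= -mcoeff_msupp.
by move=> /h; rewrite mdegD; apply: leq_trans; exact: leq_addr.
Qed.

Lemma mderiv_prod n i (I : eqType) (s : seq I) (F : I -> {mpoly rat[n]}) : uniq s ->
  (\prod_(u <- s) F u)^`M(i) = \sum_(u <- s) (F u)^`M(i) * \prod_(u' <- s | u' != u) F u'.
Proof.
elim: s => [_|a s IH /= /andP[as_ us]]; first by rewrite !big_nil -mpolyC1 mderivC.
rewrite !big_cons mderivM IH // eqxx /=; congr (_ + _).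
  congr (_ * _); rewrite big_seq [RHS]big_seq_cond; apply: eq_bigl => u.
  by case us': (u \in s) => //=; case: eqP => // e; rewrite -e us' in as_.
rewrite big_distrr /= big_seq [RHS]big_seq; apply: eq_bigr => u us'; rewrite mulrCA; congr (_ * _).
by rewrite big_cons; case: eqP => // e; rewrite e us' in as_.
Qed.

Lemma mderivXn n i (p : {mpoly rat[n]}) k : (p ^+ k)^`M(i) = k%:R *: (p^`M(i) * p ^+ k.-1).
Proof.
elim: k => [|[|k] IH]; first by rewrite expr0 -mpolyC1 mderivC scale0r.
  by rewrite expr1 expr0 mulr1 scale1r.
rewrite exprS mderivM IH /= -scalerAr mulrCA -exprS -[in RHS]addn1 natrD scalerDl scale1r.
by rewrite addrC.
Qed.

Section ShiftedPartials.
Variables (n r t E delta : nat) (S : {set 'I_n}) (h : 'I_r -> 'I_t -> {mpoly rat[n]}).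
Let A : {pred 'I_n} := [pred i | i \in S].
Hypothesis hdeg : forall u j, (msize (h u j) <= delta.+1)%N.
Hypothesis hover : forall u j, poly_over A (h u j).

(** One factor and one exponent for each row: the index of a term when the determinant of
    logarithmic derivatives is expanded. *)
Let K : finType := {ffun 'I_r -> 'I_t * 'I_E.+1}.

Definition power_product (k : K) : {mpoly rat[n]} := \prod_u h u (k u).1 ^+ (k u).2.

Definition in_span (d : nat) (f : {mpoly rat[n]}) := exists q : K -> {mpoly rat[n]},
  (forall k, (msize (q k) <= d.+1)%N /\ poly_over A (q k)) /\ f = \sum_k q k * power_product k.

Lemma in_span_gen d q k : (msize q <= d.+1)%N -> poly_over A q -> in_span d (q * power_product k).
Proof.
move=> hq oq; exists (fun k' => if k' == k then q else 0); split=> [k'|].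
  by case: eqP => _ //; rewrite mmeasure0; split=> //; exact: poly_over0.
rewrite (bigD1 k) //= eqxx big1 ?addr0 // => k' /negbTE ->; exact: mul0r.
Qed.

Lemma in_spanD d f g : in_span d f -> in_span d g -> in_span d (f + g).
Proof.
move=> [q [hq ->]] [q' [hq' ->]]; exists (fun k => q k + q' k); split=> [k|].
  have [a1 a2] := hq k; have [b1 b2] := hq' k.
  by split; [exact: msizeD_bound|exact: poly_overD].
by rewrite -big_split; apply: eq_bigr => k _; rewrite mulrDl.
Qed.

Lemma in_span0 d : in_span d 0.
Proof.
exists (fun _ => 0); split; last by rewrite big1 // => k _; rewrite mul0r.
by move=> k; rewrite mmeasure0; split=> //; exact: poly_over0.
Qed.

Lemma in_span_sum d (I : Type) (s : seq I) (Q : pred I) F :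
  (forall i, Q i -> in_span d (F i)) -> in_span d (\sum_(i <- s | Q i) F i).
Proof.
by move=> H; elim/big_ind: _ => //; [exact: in_span0|exact: in_spanD].
Qed.

Lemma in_spanM d a p f : (msize p <= a.+1)%N -> poly_over A p -> in_span d f -> in_span (a + d) (p * f).
Proof.
move=> hp op [q [hq ->]]; rewrite big_distrr; apply: in_span_sum => k _ /=; rewrite mulrA.
have [a1 a2] := hq k.
by apply: in_span_gen; [exact: msizeM_bound|exact: poly_overM].
Qed.

Lemma in_span_le d d' f : (d <= d')%N -> in_span d f -> in_span d' f.
Proof.
move=> dd [q [hq e]]; exists q; split=> // k; have [a1 a2] := hq k; split=> //.
exact: leq_trans a1 _.
Qed.

(** Differentiating a power lowers its exponent and moves the derivative of its base into the
    coefficient. The set of power products does not grow, only the degree of the coefficients, by at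
    most [delta]. *)
Lemma in_span_deriv d f i : in_span d f -> in_span (delta + d) f^`M(i).
Proof.
move=> [q [hq ->]]; rewrite (raddf_sum (mderiv i)); apply: in_span_sum => k _ /=.
have [a1 a2] := hq k; rewrite mderivM; apply: in_spanD.
  apply: (@in_span_le d); first exact: leq_addl.
  by apply: in_span_gen; [exact: msize_deriv|exact: poly_over_deriv].
rewrite /power_product mderiv_prod ?index_enum_uniq // big_distrr /=.
apply: in_span_sum => u _; rewrite mderivXn.
have [z|z] := posnP (k u).2.
  by rewrite z scale0r mul0r mulr0; exact: in_span0.
have lt : ((k u).2.-1 < E.+1)%N by apply: leq_ltn_trans (leq_pred _) (ltn_ord _).
pose k' : K := [ffun u' => if u' == u then ((k u).1, Ordinal lt) else k u'].
rewrite [X in in_span _ X](_ : _ = ((k u).2%:R *: ((h u (k u).1)^`M(i) * q k)) * power_product k').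
  apply: in_span_gen.
    by apply: msizeZ_bound; apply: msizeM_bound => //; exact: msize_deriv.
  by apply: poly_overZ; apply: poly_overM => //; exact: poly_over_deriv.
have -> : power_product k' = h u (k u).1 ^+ (k u).2.-1 * \prod_(u' | u' != u) h u' (k u').1 ^+ (k u').2.
  rewrite /power_product (bigD1 u) //= ffunE eqxx; congr (_ * _).
  by apply: eq_bigr => u' /negbTE uu; rewrite ffunE uu.
rewrite -!scalerAl -!scalerAr; congr (_ *: _); set X := \prod_(_ | _) _.
by ring.
Qed.

Lemma in_span_derivs d f s : in_span d f -> in_span (size s * delta + d) (derivs s f).
Proof.
by move=> hf; elim: s => [|i s IH] //=; rewrite mulSn -addnA; exact: in_span_deriv.
Qed.

Lemma card_monomials_le d : (#|[set m : 'X_{1..n < d.+1} | [forall i, (i \notin S) ==> (m i == 0)]]%N|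
  <= 'C(#|S| + d, #|S|))%N.
Proof.
rewrite -card_partial_ord_partitions.
pose g (m : 'X_{1..n < d.+1}) : #|S|.-tuple 'I_d.+1 := [tuple inord (m (enum_val i)) | i < #|S|].
have ml (m : 'X_{1..n < d.+1}) i : (m i < d.+1)%N.
  by apply: leq_ltn_trans (bmdeg m); rewrite mdegE (bigD1 i) //= leq_addr.
rewrite -(card_in_imset (f := g)).
  apply: subset_leq_card; apply/subsetP => x /imsetP[m]; rewrite !inE => /forallP hm ->.
  rewrite big_tuple; under eq_bigr do rewrite tnth_mktuple inordK ?ml //.
  have -> : (\sum_(i < #|S|) m (enum_val i) = \sum_(i in S) m i)%N by rewrite -big_enum_val.
  rewrite -ltnS; apply: leq_ltn_trans (bmdeg m).
  by rewrite mdegE big_mkcond /=; apply: leq_sum => i _; case: ifP.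
move=> m m'; rewrite !inE => /forallP hm /forallP hm' e; apply/val_inj/mnmP => i /=.
case: (boolP (i \in S)) => iS; last by rewrite (eqP (implyP (hm i) iS)) (eqP (implyP (hm' i) iS)).
have := congr1 (fun x : #|S|.-tuple 'I_d.+1 => val (tnth x (enum_rank_in iS i))) e.
by rewrite !tnth_mktuple enum_rankK_in //= !inordK ?ml.
Qed.

(** Dimension count: an element is determined by the coefficients of its [q k], that is, by one
    number for each power product and each monomial over [S] of degree at most [d]. *)
Lemma span_dependent (J : finType) d (f : J -> {mpoly rat[n]}) : (forall j, in_span d (f j)) ->
  ((t * E.+1) ^ r * 'C(#|S| + d, #|S|) < #|J|)%N ->
  exists2 lam : J -> rat, exists j, lam j != 0 & \sum_j lam j *: f j = 0.
Proof.
move=> /(@fin_all_exists _ _ _)[q hq] lt.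
pose B : finType := {m : 'X_{1..n < d.+1} | m \in [set m : 'X_{1..n < d.+1} | [forall i, (i \notin S) ==> (m i == 0)]]%N}.
pose KB : finType := (K * B)%type.
pose M : 'M[rat]_(#|J|, #|KB|) := \matrix_(i, l) (q (enum_val i) (enum_val l).1)@_(val (val (enum_val l).2)).
have cKB : (#|KB| < #|J|)%N.
  apply: leq_ltn_trans lt; rewrite card_prod leq_mul //.
    by rewrite card_ffun card_prod !card_ord.
  by rewrite card_sig -[X in (X <= _)%N](_ : #|[set m : 'X_{1..n < d.+1} | [forall i, (i \notin S) ==> (m i == 0)]]%N| = _) ?card_monomials_le //; apply: eq_card => x; rewrite !inE.
have : kermx M != 0.
  by rewrite -mxrank_eq0 mxrank_ker subn_eq0 -ltnNge (leq_ltn_trans (rank_leq_col _) cKB).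
case/matrix0Pn => i [j hij]; pose lam j' := kermx M i (enum_rank j').
exists lam; first by exists (enum_val j); rewrite /lam enum_valK.
have kz l : \sum_j' lam j' * M (enum_rank j') l = 0.
  have := congr1 (fun X : 'M_(_, _) => X i l) (mulmx_ker M); rewrite !mxE => z.
  rewrite -[RHS]z (reindex enum_rank) //=; last by exists enum_val => x _; rewrite ?enum_rankK ?enum_valK.
have qz k : \sum_j' lam j' *: q j' k = 0.
  apply/mpolyP => m; rewrite mcoeff0 raddf_sum /=.
  have [hm|hm] := boolP ((mdeg m < d.+1)%N && [forall i, (i \notin S) ==> (m i == 0)]%N); last first.
    rewrite big1 // => j' _; rewrite mcoeffZ memN_msupp_eq0 ?mulr0 //; apply: contra hm => hm.
    have [a1 a2] := (hq j').1 k; apply/andP; split; first exact: leq_trans (msize_mdeg_lt hm) a1.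
    by apply/forallP => i'; apply/implyP => i'S; apply/eqP; exact: a2 hm _ i'S.
  case/andP: hm => m1 m2.
  have mB : BMultinom m1 \in [set m : 'X_{1..n < d.+1} | [forall i, (i \notin S) ==> (m i == 0)]]%N by rewrite inE.
  have := kz (enum_rank ((k, exist _ (BMultinom m1) mB) : KB)); rewrite /M => z; rewrite -[RHS]z.
  by apply: eq_bigr => j' _; rewrite mcoeffZ mxE !enum_rankK.
under eq_bigr => j' _ do rewrite (hq j').2 scaler_sumr.
rewrite exchange_big big1 //= => k _; under eq_bigr do rewrite scalerAl.
by rewrite -big_distrl /= qz mul0r.
Qed.

End ShiftedPartials.

(** * Independence of shifted partial derivatives *)

Lemma mcoeff_shifted_partial n (F : {mpoly rat[n]}) b c m : (F^`M[b] * 'X_[c])@_m != 0 ->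
  exists2 m', m' \in msupp F & (m + b = m' + c)%MM.
Proof.
rewrite -mcoeff_msupp (perm_mem (msuppMX _ _)) => /mapP[k].
rewrite mcoeff_msupp mcoeff_mderivm => h ->; exists (b + k)%MM.
  by rewrite mcoeff_msupp; apply: contraNneq h => ->; rewrite mul0rn.
by rewrite addmC [(c + k)%MM]addmC addmA.
Qed.

(** A set of [m] variables to differentiate by, and a monomial of degree exactly [L] to multiply
    with. They use disjoint parts of [S], so both can be recovered from the resulting monomial. *)
Definition shift_index n (S : {set 'I_n}) m L : {set {set 'I_n} * 'X_{1..n < L.+1}} :=
  [set x : {set 'I_n} * 'X_{1..n < L.+1} | [&& x.1 \subset S, #|x.1| == m, mdeg x.2 == L
             & [forall i, (i \notin S :\: x.1) ==> (x.2 i == 0%N)]]].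

Lemma card_monomials_ge n (W : {set 'I_n}) w L : #|W| = w.+1 ->
  ('C(w + L, w) <= #|[set c : 'X_{1..n < L.+1} | (mdeg c == L) &&
     [forall i, (i \notin W) ==> (c i == 0%N)]]|)%N.
Proof.
move=> cW; rewrite -card_ord_partitions.
pose e (l : 'I_w.+1) : 'I_n := enum_val (cast_ord (esym cW) l).
have einj : injective e by move=> x y /enum_val_inj /cast_ord_inj.
pose g (c : 'X_{1..n < L.+1}) : w.+1.-tuple 'I_L.+1 := [tuple inord (c (e l)) | l < w.+1].
apply: leq_trans (leq_imset_card g _); apply: subset_leq_card; apply/subsetP => t.
rewrite inE big_tuple => /eqP tL.
pose c0 : 'X_{1..n} := (\sum_(l < w.+1) U_(e l) *+ tnth t l)%MM.
have dc : mdeg c0 = L.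
  by rewrite mdeg_sum -[RHS]tL; apply: eq_bigr => l _; rewrite mdegMn mdeg1 mul1n.
have c0L : (mdeg c0 < L.+1)%N by rewrite dc.
have c0e l : c0 (e l) = tnth t l.
  rewrite mnm_sumE (bigD1 l) //= big1 ?addn0 => [|l' ll]; first by rewrite mulmnE mnm1E eqxx mul1n.
  by rewrite mulmnE mnm1E (inj_eq einj) (negbTE ll).
apply/imsetP; exists (BMultinom c0L).
  rewrite inE /= dc eqxx; apply/forallP => i; apply/implyP => iW.
  rewrite mnm_sumE big1 // => l _; rewrite mulmnE mnm1E; case: eqP => // ei.
  by rewrite -ei enum_valP in iW.
by apply: eq_from_tnth => l; rewrite tnth_mktuple /= c0e inord_val.
Qed.

Lemma card_shift_index n (S : {set 'I_n}) m L : (m < #|S|)%N ->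
  ('C(#|S|, m) * 'C(#|S| - m.+1 + L, #|S| - m.+1) <= #|shift_index S m L|)%N.
Proof.
move=> mS; rewrite -[X in (_ <= X)%N]sum1_card.
rewrite [X in (_ <= X)%N](eq_bigl (fun x => (x.1 \in [set b : {set 'I_n} | b \subset S & #|b| == m]) &&
  (x.2 \in [set c : 'X_{1..n < L.+1} | (mdeg c == L) &&
     [forall i, (i \notin S :\: x.1) ==> (c i == 0%N)]]))); last first.
  by case=> b c; rewrite !inE /= -!andbA.
rewrite -(pair_big_dep _ (fun b c => c \in [set c : 'X_{1..n < L.+1} | (mdeg c == L) &&
     [forall i, (i \notin S :\: b) ==> (c i == 0%N)]]) (fun _ _ => 1%N)) /=.
rewrite -cards_draws -sum_nat_const; apply: leq_sum => b; rewrite inE => /andP[bS /eqP bm].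
rewrite sum1_card; apply: card_monomials_ge.
by rewrite cardsD (setIidPr bS) bm subnSK.
Qed.

(** All pairs change degrees by the same amount, so only terms of [F] of the degree of [m0]
    interfere. Among these [m0] is the largest, hence the relevant leading monomial of the pair (b,
    c) is [m0 - b + c]. Different pairs give different ones, as b consists of the variables whose
    exponent falls below that in [m0]. *)
Lemma shifted_partials_free n (F : {mpoly rat[n]}) (S : {set 'I_n}) m L m0 
    (lam : {set 'I_n} * 'X_{1..n < L.+1} -> rat) :
  m0 \in msupp F -> (forall i, i \in S -> m0 i != 0%N) ->
  (forall m', m' \in msupp F -> mdeg m' = mdeg m0 -> (m' <= m0)%O) ->
  (exists2 x, x \in shift_index S m L & lam x != 0) ->
  \sum_(x in shift_index S m L) lam x *: (F^`M[mesym1 x.1] * 'X_[x.2]) != 0.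
Proof.
move=> m0F m0S max [x0 x0J l0].
have le x : x \in shift_index S m L -> (mesym1 x.1 <= m0)%MM.
  rewrite inE => /and4P[/subsetP xS _ _ _]; apply/mnm_lepP => i; rewrite mnmE.
  by case: (boolP (i \in x.1)) => // /xS /m0S; rewrite lt0n.
pose lt_ (x : {set 'I_n} * 'X_{1..n < L.+1}) := (m0 - mesym1 x.1 + x.2)%MM.
pose Q x := (x \in shift_index S m L) && (lam x != 0).
have [x /andP[xJ lx] xmax] := @Order.TotalTheory.arg_maxP _ _ _ x0 Q lt_ (introT andP (conj x0J l0)).
apply/negP => /eqP /(congr1 (mcoeff (lt_ x))); rewrite mcoeff0 raddf_sum /= (bigD1 x) //=.
rewrite big1 ?addr0 => [|y /andP[yJ yx]]; rewrite mcoeffZ.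
  move/eqP; rewrite mulf_eq0 (negbTE lx) /= /lt_ addmC mcoeffMX mcoeff_mderivm addmC submK ?le //.
  rewrite mulrn_eq0 mcoeff_eq0 m0F orbF => /eqP z.
  have : (0 < \prod_(i < n) (m0 i) ^_ (mesym1 x.1 i))%N.
    by rewrite prodn_gt0 // => i; rewrite ffact_gt0; have /mnm_lepP := le _ xJ.
  by rewrite z.
have [->|ly] := eqVneq (lam y) 0; first by rewrite mul0r.
have [->|/mcoeff_shifted_partial[m' m'F e]] := eqVneq (F^`M[mesym1 y.1] * 'X_[y.2])@_(lt_ x) 0; first by rewrite mulr0.
case/eqP: yx; have xy : lt_ x = lt_ y.
  apply/le_anti/andP; split; last by apply: xmax; rewrite /Q yJ ly.
  rewrite -(lemc_add2l _ _ (mesym1 y.1)) e /lt_ -addmA [(y.2 + _)%MM]addmC addmA submK ?le //.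
  rewrite lemc_add2l; apply: max => //.
  have := congr1 mdeg e; rewrite !mdegD mdeg_mesym1; move: (yJ) (xJ).
  rewrite !inE => /and4P[_ /eqP -> /eqP -> _] /and4P[_ /eqP xm /eqP xL _].
  rewrite xL => e'; have := congr1 mdeg (submK (le _ xJ)); rewrite mdegD mdeg_mesym1 xm => e2.
  by apply/eqP; rewrite -(eqn_add2r L) -e' -e2 addnAC.
have mem z i : z \in shift_index S m L -> (i \in z.1) = (lt_ z i < m0 i)%N.
  move=> zJ; rewrite /lt_ mnmDE mnmBE mnmE; have /mnm_lepP/(_ i) := le _ zJ; rewrite mnmE.
  move: zJ; rewrite inE => /and4P[/subsetP xS _ _ /forallP/(_ i)]; rewrite in_setD.
  case: (boolP (i \in z.1)) => /= [_ /eqP -> i0|iz _ _]; last by rewrite subn0; lia.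
  by rewrite addn0 subn1 ltn_predL.
have e1 : x.1 = y.1 by apply/setP => i; rewrite !mem // xy.
have e2 : x.2 = y.2.
  by apply/val_inj; move: xy; rewrite /lt_ e1 => /addmI.
by rewrite (surjective_pairing x) (surjective_pairing y) e1 e2.
Qed.

(** * Binomial estimates *)

Lemma bin_raise a L N e : (0 < a)%N -> (a * N <= L)%N ->
  ('C(N + L + e, N) * a ^ e <= 'C(N + L, N) * a.+1 ^ e)%N.
Proof.
move=> a0 aL; elim: e => [|e IH]; first by rewrite addn0 !expn0.
rewrite !expnS addnS; have := mul_bin_down (N + L + e).+1 N; rewrite /= => h.
(* Raising the upper index by one multiplies the binomial by at most (a + 1)/a, because
   [a * N <= L]. *)
have h1 : (a * (N + L + e).+1 <= a.+1 * ((N + L + e).+1 - N))%N by nia.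
have p : (0 < (N + L + e).+1 - N)%N by lia.
rewrite -(leq_pmul2l p) !mulnA -h; set X := 'C(_, _) in IH *; set Y := 'C(N + L, N) in IH *.
set A := (a ^ e)%N in IH *; set B := (a.+1 ^ e)%N in IH *; set U := (N + L + e).+1 in h1 p *.
have := leq_mul h1 IH; nia.
Qed.

Lemma bin_diag_lower q L N j : (forall i, (i < j)%N -> (N - i + L <= q * (N - i))%N) -> (j <= N)%N ->
  ('C(N + L, N) <= q ^ j * 'C(N - j + L, N - j))%N.
Proof.
elim: j => [|j IH] h jN; first by rewrite expn0 mul1n subn0.
apply: leq_trans (IH _ (ltnW jN)) _ => [i ij|]; first by apply: h; exact: leqW.
rewrite expnSr -mulnA leq_mul2l; apply/orP; right.
have := h j (ltnSn j); rewrite -(subnSK jN); set M := (N - j.+1)%N => hj.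
have := mul_bin_diag (M.+1 + L) M; rewrite /= addSn /= => e.
have p : (0 < M.+1)%N by [].
rewrite -(leq_pmul2l p) -e; set X := 'C(_, _); nia.
Qed.

Lemma bin_mul_ge q m : (q ^ m <= 'C(q * m, m))%N.
Proof.
case: q => [|q]; first by case: m => // m; rewrite exp0n.
elim: m => [|m IH]; first by rewrite bin0 expn0.
have := mul_bin_diag (q.+1 * m.+1) m => e.
have p : (0 < m.+1)%N by [].
rewrite -(leq_pmul2l p) -e expnS -mulnA.
rewrite mulnCA leq_mul2l leq_mul2l /=.
by apply: leq_trans IH _; apply: leq_bin2l; rewrite mulnS; lia.
Qed.

(** Bernoulli's inequality without denominators: (1 - 1/x)^j is at least 1 - j/x, hence at least
    1/2. *)
Lemma bernoulli_half x j : (2 * j <= x)%N -> (0 < x)%N -> (x ^ j <= 2 * x.-1 ^ j)%N.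
Proof.
move=> h x0; suff b i : (i <= j)%N -> ((x - i) * x ^ i <= x * x.-1 ^ i)%N.
  have bj := b j (leqnn j); rewrite -(leq_pmul2l x0) mulnCA.
  by apply: leq_trans (_ : 2 * ((x - j) * x ^ j) <= _)%N; [nia|by rewrite leq_mul2l bj orbT].
elim: i => [|i IH] ij; first by rewrite !expn0 subn0.
have := IH (ltnW ij); rewrite !expnS; set A := (x ^ i)%N; set B := (x.-1 ^ i)%N => H.
have : ((x - i.+1) * x <= x.-1 * (x - i))%N by nia.
move=> H2; apply: leq_trans (_ : (x.-1 * (x - i)) * A <= _)%N; first by rewrite mulnA leq_mul2r H2 orbT.
by rewrite -mulnA [X in (_ <= X)%N]mulnCA leq_mul2l H orbT.
Qed.

(* The choice of L makes (1 + N / L) ^ (2 * delta) at most 2, so passing from L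
   to e + L costs a factor 2 ^ m, against a gain of 4 ^ m from the choice of the
   m differentiated variables. *)
Lemma shifted_partials_count N m w delta e (L := ((4 * delta).-1 * N)%N) : (0 < delta)%N -> (20 * delta * m <= N)%N -> (0 < m)%N ->
  (5 * delta * w < 2 ^ m)%N -> (e <= 2 * delta * m)%N ->
  (w * 'C(N + (e + L), N) < 'C(N, m) * 'C(N - m.+1 + L, N - m.+1))%N.
Proof.
move=> d0 Nm m0 hw he; have Nm' : (m.+1 <= N)%N by nia.
have step1 : ('C(N + (e + L), N) <= 2 ^ m * 'C(N + L, N))%N.
  apply: leq_trans (_ : 'C(N + L + 2 * delta * m, N) <= _)%N; first by apply: leq_bin2l; lia.
  have p : (0 < ((4 * delta).-1 ^ (2 * delta)) ^ m)%N by rewrite !expn_gt0; lia.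
  rewrite -(leq_pmul2r p); rewrite -[in X in (X <= _)%N]expnM.
  apply: leq_trans (bin_raise _ _ _) _; [lia|exact: leqnn|].
  rewrite mulnC [in X in (_ <= X)%N]mulnC mulnA leq_mul2r; apply/orP; right.
  rewrite prednK ?muln_gt0 ?d0 // expnM -expnMn; rewrite leq_exp2r //.
  by rewrite [X in (_ <= X)%N]mulnC; apply: bernoulli_half; lia.
have step2 : ('C(N + L, N) <= (5 * delta) ^ m.+1 * 'C(N - m.+1 + L, N - m.+1))%N.
  apply: bin_diag_lower => // i im; rewrite /L.
  have : (i <= m)%N by []. move=> im'. 
  have e1 : ((4 * delta).-1 = 4 * delta - 1)%N by lia.
  rewrite e1 mulnBl mul1n; nia.
(* In [20 * delta = 2 * 2 * (5 * delta)] one factor 2 pays for [step1] and [5 * delta] for [step2].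
   The other 2 has to beat [w] and the surplus [5 * delta] from the exponent [m.+1]. *)
have step3 : ((20 * delta) ^ m <= 'C(N, m))%N.
  by apply: leq_trans (bin_mul_ge _ _) _; exact: leq_bin2l.
set X := 'C(N - m.+1 + L, _) in step2 *; have X0 : (0 < X)%N by rewrite bin_gt0; lia.
apply: leq_ltn_trans (_ : w * (2 ^ m * ((5 * delta) ^ m.+1 * X)) < _)%N.
  rewrite leq_mul2l; apply/orP; right; apply: leq_trans step1 _.
  by rewrite leq_mul2l step2 orbT.
apply: leq_trans (_ : (20 * delta) ^ m * X <= _)%N; last by rewrite leq_mul2r step3 orbT.
rewrite !mulnA ltn_mul2r X0 /=; have -> : (20 * delta = 2 * 2 * (5 * delta))%N by lia.
have -> : ((2 * 2 * (5 * delta)) ^ m = 2 ^ m * 2 ^ m * (5 * delta) ^ m)%N by rewrite !expnMn.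
rewrite expnS; have q0 : (0 < (5 * delta) ^ m)%N by rewrite expn_gt0; lia.
have t0 : (0 < 2 ^ m)%N by rewrite expn_gt0.
have -> : (w * 2 ^ m * (5 * delta * (5 * delta) ^ m) = 5 * delta * w * (2 ^ m * (5 * delta) ^ m))%N by lia.
by rewrite -[X in (_ < X)%N]mulnA ltn_mul2r muln_gt0 t0 q0.
Qed.

Definition kill n (S : {set 'I_n}) : {mpoly rat[n]} -> {mpoly rat[n]} :=
  comp (fun i => if i \in S then 'X_i else 0).

HB.instance Definition _ n S := GRing.RMorphism.on (@kill n S).

Lemma mcoeff_kill n (S : {set 'I_n}) p m :
  (kill S p)@_m = if [forall i, (i \notin S) ==> (m i == 0%N)] then p@_m else 0.
Proof.
rewrite /kill compE raddf_sum /=.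
have e m' : (p@_m' *: \prod_i (if i \in S then 'X_i else 0) ^+ m' i : {mpoly rat[n]})@_m =
    if m' == m then if [forall i, (i \notin S) ==> (m i == 0%N)] then p@_m else 0 else 0.
  have [om|/forallPn[i]] := boolP [forall i, (i \notin S) ==> (m' i == 0%N)]; last first.
    rewrite negb_imply => /andP[iS m'i]; rewrite (bigD1 i) //= (negbTE iS) expr0n (negbTE m'i) mul0r.
    rewrite scaler0 mcoeff0; case: eqP => // <-; case: ifP => // /forallP/(_ i).
    by rewrite iS (negbTE m'i).
  have -> : \prod_i (if i \in S then 'X_i else 0) ^+ m' i = 'X_[m'] :> {mpoly rat[n]}.
    rewrite mpolyXE_id; apply: eq_bigr => i _; case: ifP => // /negbT iS.
    by have := forallP om i; rewrite iS => /eqP ->; rewrite !expr0.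
  by rewrite mcoeffZ mcoeffX; case: eqP => [<-|_]; rewrite ?om ?mulr1 ?mulr0.
under eq_bigr do rewrite e.
have [h|h] := boolP (m \in msupp p).
  by rewrite -big_mkcond -big_filter filter_pred1_uniq ?msupp_uniq // big_seq1.
rewrite (memN_msupp_eq0 h) if_same big_seq big1 // => i ip.
by case: eqP => // e1; rewrite -e1 ip in h.
Qed.

Lemma kill_over n (S : {set 'I_n}) p : poly_over [pred i | i \in S] (kill S p).
Proof.
move=> m; rewrite mcoeff_msupp mcoeff_kill; case: ifP; last by rewrite eqxx.
by move=> /forallP h _ i; rewrite inE => iS; apply/eqP/(implyP (h i)).
Qed.

Lemma msize_kill n (S : {set 'I_n}) p d : (msize p <= d)%N -> (msize (kill S p) <= d)%N.
Proof.
case: d => [|d]; first by rewrite leqn0 msize_poly_eq0 => /eqP ->; rewrite /kill rmorph0 mmeasure0.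
move=> /msize_leP h; apply/msize_leP => m; rewrite mcoeff_msupp mcoeff_kill.
by case: ifP; rewrite ?eqxx // -mcoeff_msupp => _ /h.
Qed.

Lemma in_span_det n r t E delta (S : {set 'I_n}) (h : 'I_r -> 'I_t -> {mpoly rat[n]})
    (a : 'I_r -> 'I_r -> 'I_t * 'I_E.+1 -> {mpoly rat[n]}) :
  (forall u v x, (msize (a u v x) <= delta.+1)%N /\ poly_over [pred i | i \in S] (a u v x)) ->
  @in_span n r t E S h (r * delta)
    (\det (\matrix_(u, v) \sum_(x : 'I_t * 'I_E.+1) a u v x * h u x.1 ^+ x.2)).
Proof.
move=> ha; apply: in_span_sum => /= s _.
rewrite (eq_bigr (fun u : 'I_r => \sum_(x : 'I_t * 'I_E.+1) a u (perm.fun_of_perm s u) x * h u x.1 ^+ x.2)); last first.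
  by move=> u _; rewrite mxE.
rewrite bigA_distr_bigA mulr_sumr; apply: in_span_sum => k _; rewrite big_split /= mulrA.
apply: in_span_gen; last first.
  apply: poly_overM; last by apply: poly_over_prod => u _; have [] := ha u (perm.fun_of_perm s u) (k u).
  by case: (perm.odd_perm s); rewrite ?expr0 ?expr1 -?mpolyC1 -?mpolyCN; exact: poly_overC.
rewrite mulr_sign; have hp : (msize (\prod_u a u (perm.fun_of_perm s u) (k u)) <= (r * delta).+1)%N.
  rewrite -[X in (X * _).+1]card_ord -sum_nat_const; apply: msize_prod_bound => u.
  by have [] := ha u (perm.fun_of_perm s u) (k u).
by case: ifP => _ //; rewrite -scaleN1r; exact: msizeZ_bound.
Qed.

(** Gates with fewer than [t] factors are padded by zero coefficients, so all entries share the
    index set that [in_span_det] expects. *)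
Lemma kill_log_jacobian n r (al : 'I_n -> rat) (T : 'I_r -> seq {mpoly rat[n]}) (C : 'I_r -> 'I_n) D t
    (S : {set 'I_n}) : (forall u, (size (T u) <= t)%N) ->
  kill S (log_jacobian al T C D) = \det (\matrix_(u, v) \sum_(x : 'I_t * 'I_D.+1)
    (if (x.1 < size (T u))%N then ((T u)`_x.1).@[al]^-1 *: kill S (shift al ((T u)`_x.1)^`M(C v)) else 0)
      * kill S (small_part al (T u)`_x.1) ^+ x.2).
Proof.
move=> hT; rewrite /log_jacobian -det_map_mx; congr (\det _); apply/matrixP => u v; rewrite !mxE.
rewrite rmorph_sum; suff gen dg : \sum_(g <- T u) kill S (dg g * trunc_inv al D g) = \sum_(x : 'I_t * 'I_D.+1)
    (if (x.1 < size (T u))%N then ((T u)`_x.1).@[al]^-1 *: kill S (dg (T u)`_x.1) else 0)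
      * kill S (small_part al (T u)`_x.1) ^+ x.2.
  exact: (gen (fun g => shift al g^`M(C v))).
rewrite (big_nth 0) big_mkord (big_ord_widen_cond t (fun _ => true)
  (fun i => kill S (dg (T u)`_i * trunc_inv al D (T u)`_i)) (hT u)).
rewrite big_mkcond -(pair_bigA _ (fun (j : 'I_t) (e : 'I_D.+1) =>
    (if (j < size (T u))%N then ((T u)`_j).@[al]^-1 *: kill S (dg (T u)`_j) else 0)
      * kill S (small_part al (T u)`_j) ^+ e)).
apply: eq_bigr => j _; rewrite andTb; case: ifP => _; last by rewrite big1 // => e _; rewrite mul0r.
rewrite rmorphM /trunc_inv -mul_mpolyC rmorphM rmorph_sum.
have e c : kill S c%:MP = c%:MP by exact: substC.
rewrite [X in _ * (X * _)](e _) mulrCA mulrA mul_mpolyC big_distrr; apply: eq_bigr => i _; congr (_ * _).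
exact: (rmorphXn (kill S)).
Qed.

Lemma shift_deriv_size n (al : 'I_n -> rat) p d : (msize p <= d.+1)%N -> (msize (shift al p) <= d.+1)%N.
Proof.
move=> h; rewrite -[X in X.+1]muln1; apply: msize_comp_bound => // i.
by apply: msizeD_bound; [rewrite msizeX mdeg1|rewrite msizeC; case: (_ != _)].
Qed.

Lemma small_part_size n (al : 'I_n -> rat) p d : (msize p <= d.+1)%N -> (msize (small_part al p) <= d.+1)%N.
Proof.
move=> h; apply: msizeD_bound; first by rewrite msize1.
by rewrite -scaleN1r; do 2!apply: msizeZ_bound; exact: shift_deriv_size.
Qed.

(** Take a degree-[D] monomial of least support [S] and set the other variables to zero. If [S] were
    large, the shifted partials would be independent by [shifted_partials_free], yet more numerous
    than the dimension of the span containing them. *)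
Lemma small_support n r (al : 'I_n -> rat) (T : 'I_r -> seq {mpoly rat[n]}) (C : 'I_r -> 'I_n) D t delta m :
  (forall u, (size (T u) <= t)%N) -> (forall u g, g \in T u -> (msize g <= delta.+1)%N) ->
  (0 < delta)%N -> (0 < m)%N -> (r <= m)%N -> (5 * delta * (t * D.+1) ^ r < 2 ^ m)%N ->
  (exists2 m0, m0 \in msupp (log_jacobian al T C D) & mdeg m0 = D) ->
  exists m0, [/\ m0 \in msupp (log_jacobian al T C D), mdeg m0 = D
    & (#|[set i | m0 i != 0%N]| < 20 * delta * m)%N].
Proof.
set F := log_jacobian al T C D => ht hd d0 m_gt0 rm hm [m1 m1F m1D].
pose supp (a : 'X_{1..n}) := [set i | a i != 0%N].
have ex : exists k, has (fun a => (mdeg a == D) && (#|supp a| == k)) (msupp F).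
  by exists #|supp m1|; apply/hasP; exists m1 => //; rewrite m1D !eqxx.
case: (ex_minnP ex) => k /hasP[a aF /andP[/eqP aD /eqP ak]] kmin.
exists a; split=> //; rewrite -/(supp a) ltnNge; apply/negP => big.
pose S := supp a; pose F' := kill S F.
have F'P b : b \in msupp F' -> b \in msupp F /\ supp b \subset S.
  rewrite mcoeff_msupp mcoeff_kill; case: ifP => [/forallP h|_]; last by rewrite eqxx.
  rewrite -mcoeff_msupp => bF; split=> //; apply/subsetP => i; apply: contraLR => iS.
  by rewrite inE negbK; exact: (implyP (h i)).
have aF' : a \in msupp F'.
  rewrite mcoeff_msupp mcoeff_kill ifT -?mcoeff_msupp //; apply/forallP => i; apply/implyP.
  by rewrite inE negbK.
pose top := filter (fun b => mdeg b == D) (msupp F').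
have topa : a \in top by rewrite mem_filter aD eqxx.
pose mm := foldr Order.max 0%MM top.
have mmax : (mm \in top) /\ forall b, b \in top -> (b <= mm)%O.
  have gen (s : seq 'X_{1..n}) : s != [::] -> (foldr Order.max 0%MM s \in s) /\
      forall b, b \in s -> (b <= foldr Order.max 0%MM s)%O.
    elim: s => // x [|y s] IH _.
      by rewrite /= Order.POrderTheory.max_l ?le0x //; split=> [|b]; rewrite ?inE // => /eqP ->.
    have [] := IH isT; set z := foldr _ _ _ => zs hz.
    rewrite -[foldr _ _ (x :: _)]/(Order.max x z) inE; split.
      by case: (Order.TotalTheory.leP x z) => _; rewrite ?zs ?orbT ?eqxx.
    move=> b; rewrite inE Order.TotalTheory.le_max => /orP[/eqP ->|/hz ->]; rewrite ?lexx ?orbT //.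
  by apply: gen; case: (top) topa.
have [mmt mmm] := mmax; move: mmt; rewrite mem_filter => /andP[/eqP mmD mmF'].
have [mmF mmS] := F'P _ mmF'.
have suppE : supp mm = S.
  apply/eqP; rewrite eqEcard mmS ak; apply: kmin; apply/hasP; exists mm => //.
  by rewrite mmD !eqxx.
pose L := ((4 * delta).-1 * #|S|)%N.
pose h u (j : 'I_t) := kill S (small_part al (T u)`_j).
have nth_size u (j : nat) : (msize (T u)`_j <= delta.+1)%N.
  have [lt|ge] := ltnP j (size (T u)); first by apply: hd; exact: mem_nth.
  by rewrite nth_default // mmeasure0.
have hsz u j : (msize (h u j) <= delta.+1)%N by apply: msize_kill; exact: small_part_size.
have hov u j : poly_over [pred i | i \in S] (h u j) by exact: kill_over.
have F'span : in_span D S h (r * delta) F'.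
  rewrite /F' (kill_log_jacobian _ _ _ _ ht).
  apply: (@in_span_det n r t D delta S h (fun u v (x : 'I_t * 'I_D.+1) => if (x.1 < size (T u))%N
    then ((T u)`_x.1).@[al]^-1 *: kill S (shift al ((T u)`_x.1)^`M(C v)) else 0)) => u v x.
  case: ifP => _; last by rewrite mmeasure0; split=> //; exact: poly_over0.
  split; last by apply: poly_overZ; exact: kill_over.
  by apply/msizeZ_bound/msize_kill/shift_deriv_size/msize_deriv.
pose A := shift_index S m L.
pose f (j : 'I_#|A|) := F'^`M[mesym1 (enum_val j).1] * 'X_[(enum_val j).2].
have fspan j : in_span D S h (L + (m * delta + r * delta)) (f j).
  have := enum_valP j; rewrite inE => /and4P[/subsetP bS /eqP bm /eqP cL /forallP cS].
  rewrite /f mulrC; apply: in_spanM.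
  - by rewrite msizeX cL.
  - move=> c; rewrite msuppX inE => /eqP -> i iS; apply/eqP/(implyP (cS i)).
    by rewrite in_setD (negbTE iS) andbF.
  rewrite mderivm_foldr; set s := flatten _.
  have -> : m = size s.
    rewrite -bm -mdeg_mesym1 mdegE size_flatten /shape -map_comp sumnE big_map big_enum.
    by apply: eq_bigr => i _ /=; rewrite size_nseq.
  exact: in_span_derivs.
have mS : (m < #|S|)%N by apply: leq_trans big; rewrite -[m.+1]mul1n -/(supp a); nia.
have cnt := @shifted_partials_count #|S| m ((t * D.+1) ^ r) delta (m * delta + r * delta) d0 big m_gt0 hm.
have [|lam [j0 lj0] z] := span_dependent fspan.
  rewrite card_ord; apply: leq_trans (card_shift_index L mS).
  by rewrite [(L + _)%N]addnC; apply: cnt; nia.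
pose lam' x := lam (enum_rank_in (enum_valP j0) x).
have := @shifted_partials_free _ F' S m L mm lam' mmF'.
case/(_ _ _ _)/eqP.
- by move=> i; rewrite -suppE inE.
- by move=> b bF' bD; apply: mmm; rewrite mem_filter bF' andbT bD mmD.
- by exists (enum_val j0); [exact: enum_valP|rewrite /lam' enum_valK_in].
rewrite big_enum_val -[RHS]z; apply: eq_bigr => j _.
by rewrite /lam' enum_valK_in.
Qed.

(** * Choice of a maximal minor and of a common nonroot *)

Lemma poly_over_sub n (A B : {pred 'I_n}) u : {subset A <= B} -> poly_over A u -> poly_over B u.
Proof. by move=> AB h m /h om i iB; apply: om; apply: contra iB => /AB. Qed.

Lemma sep_single n (A : {pred 'I_n}) l u : poly_over (pred1 l) u -> sep A 1 u.
Proof.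
move=> h; have [lA|lA] := boolP (l \in A); [apply: sep_over1|apply: sep_over2];
  by apply: poly_over_sub h => i; rewrite !inE => /eqP ->.
Qed.

Lemma horner_alg_over n l (p : {poly rat}) : poly_over (pred1 l : {pred 'I_n}) (horner_alg 'X_l p).
Proof.
elim/poly_ind: p => [|p c IH]; first by rewrite rmorph0; exact: poly_over0.
rewrite rmorphD rmorphM /= horner_algX horner_algC.
apply: poly_overD; first by apply: poly_overM => //; apply: poly_overX; rewrite inE.
by apply: poly_overZ; rewrite -mpolyC1; exact: poly_overC.
Qed.

Lemma univariate_split n (A : {pred 'I_n}) (g : {mpoly rat[n]}) : sum_of_univariates g ->
  exists a b, [/\ poly_over A a, poly_over [predC A] b & g = a + b].
Proof.
case=> h ->; rewrite (bigID (fun i => i \in A)) /=; exists (\sum_(i in A) horner_alg 'X_i (h i)).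
exists (\sum_(i | i \notin A) horner_alg 'X_i (h i)); split=> //; apply: poly_over_sum => i iA.
  have := @horner_alg_over n i (h i); apply: poly_over_sub => j; by rewrite !inE => /eqP ->.
have := @horner_alg_over n i (h i); apply: poly_over_sub => j; by rewrite !inE => /eqP ->.
Qed.

Lemma deriv_single n l v (q : {mpoly rat[n]}) : poly_over (pred1 l) q -> poly_over (pred1 v) q^`M(v).
Proof.
move=> h m; rewrite mcoeff_msupp mcoeff_deriv mulrn_eq0 /= -mcoeff_msupp => /h om i iv.
apply/eqP/negPn/negP => mi.
have li : i = l by apply/eqP/negPn/negP => il; have := om i il; rewrite mnmDE; lia.
have lv : v = l by apply/eqP/negPn/negP => vl; have := om v vl; rewrite mnmDE mnm1E eqxx; lia.
by rewrite inE li lv eqxx in iv.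
Qed.

(** Every other summand disappears, so the numerator of a logarithmic derivative lies on one side of
    any partition and costs nothing in the separation. *)
Lemma univariate_deriv n v (g : {mpoly rat[n]}) : sum_of_univariates g -> poly_over (pred1 v) g^`M(v).
Proof.
case=> h ->; rewrite (raddf_sum (mderiv v)); apply: poly_over_sum => l _.
by apply: (@deriv_single _ l); exact: horner_alg_over.
Qed.

Lemma sep_sum_seq n (A : {pred 'I_n}) (I : eqType) (l : seq I) w F :
  (forall i, i \in l -> sep A w (F i)) -> sep A (size l * w) (\sum_(i <- l) F i).
Proof.
elim: l => [_|a l IH h]; first by rewrite big_nil; exact: sep0.
rewrite big_cons mulSn; apply: sepD; first by apply: h; rewrite mem_head.
by apply: IH => i il; apply: h; rewrite inE il orbT.
Qed.

Lemma sep_det n (A : {pred 'I_n}) r w (M : 'M[{mpoly rat[n]}]_r) :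
  (forall u v, sep A w (M u v)) -> sep A (r`! * w ^ r) (\det M).
Proof.
move=> h; apply: (@sep_le _ _ (\sum_(s : {perm 'I_r}) w ^ r)).
  by rewrite sum_nat_const (card_Sn r).
apply: sep_sum => s.
rewrite -signr_odd; have -> : (-1) ^+ odd (odd_perm s) * \prod_i M i (s i) =
    (-1) ^+ odd (odd_perm s) *: \prod_i M i (s i) :> {mpoly rat[n]}.
  by case: (odd _); rewrite ?expr0 ?expr1 ?mulN1r ?mul1r ?scaleN1r ?scale1r.
apply: sepZ; rewrite -[r in (_ ^ r)%N]card_ord -prod_nat_const; exact: sep_prod.
Qed.

(** The determinant has [r]! products of [r] entries. An entry has at most [t * D.+1] terms, and in
    each the power of the small part splits into at most [D.+1] products. *)
Lemma sep_log_jacobian n r (al : 'I_n -> rat) (T : 'I_r -> seq {mpoly rat[n]}) (C : 'I_r -> 'I_n) D t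
    (A : {pred 'I_n}) : (forall u, (size (T u) <= t)%N) ->
  (forall u g, g \in T u -> sum_of_univariates g) ->
  sep A (r`! * (t * (D.+1 * D.+1)) ^ r) (log_jacobian al T C D).
Proof.
move=> ht hT; apply: sep_det => u v; rewrite mxE.
apply: (@sep_le _ _ (size (T u) * (D.+1 * D.+1))); first by rewrite leq_mul2r ht orbT.
apply: sep_sum_seq => g gT; rewrite -[(D.+1 * D.+1)%N]mul1n; apply: sepM.
  apply: (@sep_single _ _ (C v)); apply: shift_over; exact: univariate_deriv (hT _ _ gT).
apply: sepZ; rewrite -[X in (X * _)%N](card_ord D.+1) -sum_nat_const.
apply: sep_sum => e; have [a [b [oa ob ->]]] := univariate_split A (hT _ _ gT).
apply: (@sep_le _ _ e.+1); first exact: ltn_ord.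
have -> : small_part al (a + b) = (1 - (a + b).@[al]^-1 *: shift al a) + - ((a + b).@[al]^-1 *: shift al b).
  by rewrite -addrA -opprD -scalerDr -rmorphD.
apply: sepXnD.
  apply: poly_overD; first by rewrite -mpolyC1; exact: poly_overC.
  by rewrite -scaleN1r; do 2!apply: poly_overZ; exact: shift_over.
by rewrite -scaleN1r; do 2!apply: poly_overZ; exact: shift_over.
Qed.

Lemma minor_injective n k (T : 'I_k -> {mpoly rat[n]}) r (R : 'I_r -> 'I_k) (C : 'I_r -> 'I_n) :
  \det (\matrix_(u, v) (T (R u))^`M(C v)) != 0 -> injective R /\ injective C.
Proof.
move=> h; split=> u u' e; apply/eqP/negPn/negP => uu; case/eqP: h.
  by apply: (determinant_alternate uu) => v; rewrite !mxE e.
by rewrite -det_tr; apply: (determinant_alternate uu) => v; rewrite !mxE e.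
Qed.

Lemma maximal_minor n k (T : 'I_k -> {mpoly rat[n]}) :
  exists r (R : 'I_r -> 'I_k) (C : 'I_r -> 'I_n),
    \det (\matrix_(u, v) (T (R u))^`M(C v)) != 0 /\
    forall (R' : 'I_r.+1 -> 'I_k) (C' : 'I_r.+1 -> 'I_n),
      \det (\matrix_(u, v) (T (R' u))^`M(C' v)) = 0.
Proof.
pose minor r (R : {ffun 'I_r -> 'I_k}) (C : {ffun 'I_r -> 'I_n}) :=
  \det (\matrix_(u, v) (T (R u))^`M(C v)).
pose Q r := [exists R, [exists C, minor r R C != 0]].
(* The empty minor is 1, so the search for the largest size always starts. *)
have Q0 : exists r, Q r.
  exists 0%N; apply/existsP; exists (ffun0 (card_ord 0)); apply/existsP; exists (ffun0 (card_ord 0)).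
  by rewrite /minor det_mx00 oner_neq0.
have Qb r : Q r -> (r <= k)%N.
  case/existsP => R /existsP[C /minor_injective[/leq_card]].
  by rewrite !card_ord.
case: (ex_maxnP Q0 Qb) => r /existsP[R /existsP[C RC]] rmax.
exists r, R, C; split=> // R' C'; apply/eqP/negPn/negP => h.
have /rmax : Q r.+1; last by rewrite ltnn.
apply/existsP; exists [ffun u => R' u]; apply/existsP; exists [ffun u => C' u].
rewrite /minor (_ : \matrix_(_, _) _ = \matrix_(u, v) (T (R' u))^`M(C' v)) //.
by apply/matrixP => u v; rewrite !mxE !ffunE.
Qed.

(** One modulus separates the monomials within each polynomial, so none of them vanishes identically
    along the powers of [tau]. The pairs to be separated are counted by the squared sparsities. *)
Lemma common_nonroot_modulus n (G : seq {mpoly rat[n]}) D d m K : (D <= 2 ^ d)%N ->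
  (forall g, g \in G -> g != 0 /\ (msize g <= D)%N) ->
  (\sum_(g <- G) size (msupp g) * size (msupp g) <= K)%N -> (d * n.+1 * K < m)%N ->
  exists p (tau : rat), (0 < p <= m.*2)%N /\
    forall g, g \in G -> g.@[fun i => tau ^+ (D ^ i %% p)] != 0.
Proof.
move=> hD hG hK hm.
pose S := flatten [seq [seq (a, b) | a <- msupp g, b <- msupp g] | g <- G].
have [||p [hp inj]] := @separating_modulus n D d m S hD.
- apply: leq_ltn_trans hm; rewrite leq_mul2l; apply/orP; right; apply: leq_trans hK.
  rewrite size_flatten /shape -map_comp sumnE big_map; apply: leq_sum => g _ /=.
  by rewrite size_allpairs.
- move=> ab /flattenP[s /mapP[g gG ->]] /allpairsP[[a b] [/= ag bg ->]] /=.
  by have [_ gD] := hG g gG; split; apply: leq_trans gD; exact: msize_mdeg_lt.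
pose w (i : 'I_n) := (D ^ i %% p)%N.
have [|tau ht] := @poly_common_nonroot 'I_(size G) (fun j => mmap polyC (fun i => 'X^(w i)) G`_j).
  move=> j; have gG := mem_nth 0 (ltn_ord j); have [g0 _] := hG _ gG.
  apply: (@weight_poly_neq0 _ _ _ (mlead G`_j)); first exact: mlead_supp.
  move=> a ag e; apply: (inj (a, mlead G`_j)) => //=.
  apply/flattenP; exists [seq (a, b) | a <- msupp G`_j, b <- msupp G`_j].
    by apply/mapP; exists G`_j.
  by apply/allpairsP; exists (a, mlead G`_j); split=> //=; exact: mlead_supp.
exists p, tau; split=> // g gG.
have := ht (Ordinal (etrans (index_mem g G) gG)); rewrite /= nth_index // -meval_horner.
by rewrite (@meval_eq _ _ _ (fun i => tau ^+ (D ^ i %% p))) // => i; rewrite hornerXn.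
Qed.

(** Only the degree-[D] parts of [q] and [P] are related. Along the ray through [x] this part is the
    coefficient of [z ^ D]; it is nonzero, so the other terms cannot make [q] vanish on the whole
    ray. *)
Lemma homogeneous_ray n (q P : {mpoly rat[n]}) D c x : c != 0 -> 
  (forall m, mdeg m = D -> q@_m = c * P@_m) -> (homog_part D P).@[x] != 0 ->
  exists z : rat, q.@[fun i => z * x i] != 0.
Proof.
move=> c0 hq hP; pose u := mmap (@polyC rat) (fun l => (x l)%:P * 'X^1) q.
have uD : u`_D = c * (homog_part D P).@[x].
  rewrite /u meval_mmap_weight coef_sum.
  rewrite (eq_bigr (fun m => if mdeg m == D then q@_m * \prod_l x l ^+ m l else 0)); last first.
    move=> m _; rewrite coefCM coefXn eq_sym.
    have -> : wdeg (fun _ => 1%N) m = mdeg m by rewrite /wdeg mdegE; apply: eq_bigr => i _; rewrite muln1.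
    by case: eqP => _; rewrite ?mulr1 ?mulr0.
  rewrite -big_mkcond; have -> : (homog_part D P).@[x] = c^-1 * (homog_part D q).@[x].
    rewrite -mevalZ; congr meval; apply/mpolyP => m; rewrite mcoeffZ !mcoeff_homog_part.
    by case: eqP => [e|_]; rewrite ?mulr0 // hq // mulKf.
  rewrite mulVKf // homog_partE raddf_sum /=; apply: eq_bigr => m _.
  by rewrite mevalZ mevalX.
have u0 : u != 0.
  by apply/eqP => e; move: uD; rewrite e coef0 => /esym/eqP; rewrite mulf_eq0 (negbTE c0) (negbTE hP).
have [z _ hz] := poly_nat_nonroot u0 (leqnSn _).
exists z%:R; move: hz; rewrite /u -(meval_horner _ (fun l => (x l)%:P * 'X^1)).
by rewrite (@meval_eq _ _ _ (fun i => z%:R * x i)) // => i; rewrite expr1 hornerCM hornerX mulrC.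
Qed.

(** * Degree and sparsity bounds from the circuit size *)

Section CircuitSizes.
Variables (n k s : nat) (c : circuit k n).
Hypothesis cs : (circuit_size c <= s)%N.

Lemma gate_size_le i : (gate_size (tnth c i) <= s)%N.
Proof. by apply: leq_trans cs; rewrite /circuit_size (bigD1 i) //= leq_addr. Qed.

Lemma factor_size_le i g : g \in tnth c i -> (sparsity g + tdeg g <= s)%N.
Proof.
move=> gi; apply: leq_trans (gate_size_le i); rewrite /gate_size (big_rem g) //=.
exact: leq_addr.
Qed.

Lemma factor_msize_le i g : g \in tnth c i -> (msize g <= s.+1)%N.
Proof.
by move/factor_size_le; rewrite /tdeg; move: (msize g) => d; lia.
Qed.

Lemma gate_msize_le i : (msize (gate_poly (tnth c i)) <= s.+1)%N.
Proof.
apply: leq_trans (_ : (gate_size (tnth c i)).+1 <= _)%N; last by rewrite ltnS gate_size_le.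
apply: msize_prod_bound => g _; rewrite /tdeg; move: (msize g) => d; lia.
Qed.

Lemma circuit_msize_le : (msize (circuit_poly c) <= s.+1)%N.
Proof. by apply: msize_sum_bound => i _; exact: gate_msize_le. Qed.

(** A nonzero factor has a monomial and counts at least one. The factor 0 has size 0, which is why
    the gate must be nonzero. *)
Lemma gate_factors_le i : gate_poly (tnth c i) != 0 -> (size (tnth c i) <= s)%N.
Proof.
move=> h; apply: leq_trans (gate_size_le i); rewrite -sum1_size /gate_size big_seq [X in (_ <= X)%N]big_seq.
apply: leq_sum => g gi; have g0 : g != 0.
  apply: contraNneq h => g0; rewrite /gate_poly (big_rem g) //= g0 mul0r //.
by rewrite /sparsity; case E: (msupp g) => [|a l] //; move: g0; rewrite -msupp_eq0 E.
Qed.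

Definition nonzero_factors : seq {mpoly rat[n]} :=
  flatten [seq [seq g <- tnth c i | g != 0] | i <- enum 'I_k].

Lemma mem_nonzero_factors g : reflect (g != 0 /\ exists i, g \in tnth c i) (g \in nonzero_factors).
Proof.
apply: (iffP flattenP) => [[l /mapP[i _ ->]]|[g0 [i gi]]].
  by rewrite mem_filter => /andP[g0 gi]; split=> //; exists i.
exists [seq g <- tnth c i | g != 0]; last by rewrite mem_filter g0.
by apply/mapP; exists i; rewrite ?mem_enum.
Qed.

Lemma nonzero_factors_sparsity :
  (\sum_(g <- nonzero_factors) size (msupp g) * size (msupp g) <= s * s)%N.
Proof.
apply: leq_trans (_ : \sum_(g <- nonzero_factors) s * (sparsity g) <= _)%N.
  rewrite big_seq [X in (_ <= X)%N]big_seq; apply: leq_sum => g /mem_nonzero_factors[_ [i /factor_size_le h]].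
  by rewrite leq_mul2r; apply/orP; right; apply: leq_trans h; rewrite leq_addr.
rewrite -big_distrr leq_mul2l; apply/orP; right; apply: leq_trans cs.
rewrite /nonzero_factors big_flatten big_map big_enum; apply: leq_sum => i _.
rewrite big_filter big_mkcond; apply: leq_sum => g _; case: ifP => // _; exact: leq_addr.
Qed.

End CircuitSizes.

(** * Integer seeds *)

Lemma expn_monol a b e : (a <= b)%N -> (a ^ e <= b ^ e)%N.
Proof. by case: e => // e ab; rewrite leq_exp2r. Qed.

Definition digit_code (b V : nat) (dig : nat -> nat) : nat := (\sum_(v < V) dig v * b ^ v)%N.

Lemma digit_code_lt b V dig : (0 < b)%N -> (forall v, (v < V)%N -> (dig v < b)%N) ->
  (digit_code b V dig < b ^ V)%N.
Proof.
move=> b0; elim: V => [|V IH] h; first by rewrite /digit_code big_ord0 expn0.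
rewrite /digit_code big_ord_recr /= -/(digit_code _ _ _) expnS.
have := IH (fun v vV => h v (leqW vV)); have := h V (ltnSn V).
move: (digit_code _ _ _) (b ^ V)%N => x y; nia.
Qed.

Lemma digit_codeE b V dig j : (0 < b)%N -> (forall v, (v < V)%N -> (dig v < b)%N) -> (j < V)%N ->
  ((digit_code b V dig %/ b ^ j) %% b = dig j)%N.
Proof.
move=> b0; elim: V dig j => [|V IH] dig j h jV //.
have -> : digit_code b V.+1 dig = (digit_code b V (fun v => dig v.+1) * b + dig 0)%N.
  rewrite /digit_code big_ord_recl expn0 muln1 addnC big_distrl /=; congr (_ + _)%N.
  by apply: eq_bigr => v _; rewrite -mulnA -expnSr.
case: j jV => [_|j jV]; first by rewrite expn0 divn1 modnMDl modn_small ?h.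
rewrite expnS divnMA divnMDl // [(dig 0 %/ b)%N]divn_small ?h // addn0.
by apply: (IH (fun v => dig v.+1)) => // v vV; exact: h.
Qed.

(* The base b digits of y are alternately a coordinate and the value put there. *)
Definition spike (b U y i : nat) : nat :=
  (\sum_(u < U) if (y %/ b ^ (2 * u)) %% b == i then (y %/ b ^ (2 * u).+1) %% b else 0)%N.

Lemma spike_onto b U (A : seq nat) (y : nat -> nat) : (0 < b)%N -> uniq A -> (size A <= U)%N ->
  (forall i, i \in A -> (i < b)%N /\ (y i < b)%N) ->
  exists2 c, (c < b ^ (2 * U))%N & forall i, spike b U c i = if i \in A then y i else 0%N.
Proof.
move=> b0 uA AU hA.
(* Pairs beyond the list put the value 0 at coordinate 0, which changes nothing. *)
pose dig v := (if v./2 < size A then if odd v then y (nth 0 A v./2) else nth 0 A v./2 else 0)%N.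
have hdig v : (v < 2 * U)%N -> (dig v < b)%N.
  by rewrite /dig; case: ifP => // lt _; have [] := hA _ (mem_nth 0%N lt); case: odd.
exists (digit_code b (2 * U) dig); first exact: digit_code_lt.
move=> i; rewrite /spike.
have d1 (u : 'I_U) : ((digit_code b (2 * U) dig %/ b ^ (2 * u)) %% b = dig (2 * u))%N.
  by rewrite digit_codeE // ltn_pmul2l.
have d2 (u : 'I_U) : ((digit_code b (2 * U) dig %/ b ^ (2 * u).+1) %% b = dig (2 * u).+1)%N.
  by rewrite digit_codeE //; have := ltn_ord u; lia.
under eq_bigr => u _ do rewrite d1 d2.
have e1 u : dig (2 * u)%N = (if u < size A then nth 0 A u else 0)%N.
  by rewrite /dig mul2n doubleK odd_double.
have e2 u : dig (2 * u).+1 = (if u < size A then y (nth 0 A u) else 0)%N.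
  by rewrite /dig mul2n /= uphalf_double odd_double.
under eq_bigr => u _ do rewrite e1 e2.
case: (boolP (i \in A)) => iA.
  have lt : (index i A < U)%N by apply: leq_trans AU; rewrite index_mem.
  rewrite (bigD1 (Ordinal lt)) //= index_mem iA nth_index // eqxx big1 ?addn0 // => u ui.
  case: (ltnP u (size A)) => uA'; last by case: ifP.
  by case: eqP => // e; case/eqP: ui; apply/val_inj; rewrite /= -e index_uniq.
rewrite big1 // => u _; case: (ltnP u (size A)) => uA'; last by case: ifP.
by case: eqP => // e; rewrite -e mem_nth in iA.
Qed.

(** The seed [p] stands for the modulus [p.+1], so that every natural seed is admissible. *)
Definition power_coord (s p tau i : nat) : nat := (tau ^ ((s ^ 4) ^ i %% p.+1))%N.

Lemma sixteen_pow s : (s ^ 4 <= 2 ^ (4 * s))%N.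
Proof. by rewrite mulnC expnM leq_exp2r // ltnW // ltn_expl. Qed.

Lemma jacobian_lowest n s k (c : circuit k n) : (0 < n <= s)%N -> (2 <= s)%N ->
  (circuit_size c <= s)%N ->
  exists (r : nat) (R : 'I_r -> 'I_k) (C : 'I_r -> 'I_n) (p : nat) (tau : rat) (D : nat) (a : rat),
    let T u := tnth c (R u) in let al i := tau ^+ ((s ^ 4) ^ i %% p.+1) in
    [/\ (r <= minn k n)%N /\ (p < s ^ 10)%N, injective C,
        (forall (R' : 'I_r.+1 -> 'I_k) (C' : 'I_r.+1 -> 'I_n),
           \det (\matrix_(u, v) (gate_poly (tnth c (R' u)))^`M(C' v)) = 0),
        (forall u, (size (T u) <= s)%N) &
        [/\ (D <= s * s)%N, a != 0,
            exists2 m, m \in msupp (shift al (jacobian T C)) & mdeg m = D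
          & forall m, mdeg m = D -> (shift al (jacobian T C))@_m = a * (log_jacobian al T C D)@_m]].
Proof.
move=> /andP[n0 ns] s2 cs.
have [r [R [C [RC rmax]]]] := maximal_minor (fun i => gate_poly (tnth c i)).
have [Rinj Cinj] := @minor_injective n k (fun i => gate_poly (tnth c i)) r R C RC.
(* [4 * s] bounds the bits of the base [s ^ 4], and [s * s] the squared sparsities. With [n.+1] they
   multiply to at most [s ^ 7], so the range [s ^ 9] is ample, and twice that is within [s ^ 10]. *)
have [||||p [tau [/andP[p0 pm] htau]]] := @common_nonroot_modulus n (nonzero_factors c) (s ^ 4) (4 * s) (s ^ 9) (s * s).
- exact: sixteen_pow.
- move=> g /mem_nonzero_factors[g0 [i gi]]; split=> //.
  apply: leq_trans (factor_msize_le cs gi) _; apply: leq_trans (_ : s ^ 2 <= _)%N; [nia|by rewrite leq_pexp2l //; lia].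
- exact: nonzero_factors_sparsity.
- have h4 : (4 <= s ^ 2)%N by nia.
  have hn : (n.+1 <= s ^ 2)%N by nia.
  apply: leq_ltn_trans (leq_mul (leq_mul (leq_mul h4 (leqnn s)) hn) (leqnn (s * s))) _.
  have -> : (s ^ 2 * s * s ^ 2 * (s * s) = s ^ 7)%N by rewrite !expnS expn0; lia.
  by rewrite ltn_exp2l.
(* A zero gate would give a zero row in the minor. Hence all factors of the chosen gates are nonzero
   and [htau] covers them. *)
have T0 u : gate_poly (tnth c (R u)) != 0.
  apply: contraNneq RC => e; rewrite (expand_det_row _ u) big1 // => v _.
  by rewrite mxE e mderiv0 mul0r.
have gT u g : g \in tnth c (R u) -> g \in nonzero_factors c.
  move=> gu; apply/mem_nonzero_factors; split; last by exists (R u).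
  by apply: contraNneq (T0 u) => g0; rewrite /gate_poly (big_rem g) //= g0 mul0r.
exists r, R, C, p.-1, tau; rewrite prednK //=.
have [|D [a [hD a0 hm hc]]] := @lowest_part n r (fun i => tau ^+ ((s ^ 4) ^ i %% p)) (fun u => tnth c (R u)) C _ RC.
  by move=> u g /gT /htau.
exists D, a; split=> //.
- split; last by rewrite (leq_trans _ (_ : 2 * s ^ 9 <= _)%N) ?expnS ?leq_mul2r ?s2 ?orbT //; lia.
  by have := leq_card _ Rinj; have := leq_card _ Cinj; rewrite !card_ord leq_min => -> ->.
- by move=> u; exact: (gate_factors_le cs (T0 u)).
split=> //; rewrite -ltnS; apply: leq_trans hD _.
apply: (@leq_trans (r * s).+1); last first.
  rewrite ltnS leq_mul2r; apply/orP; right; apply: leq_trans ns.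
  by have := leq_card _ Cinj; rewrite !card_ord.
apply: msize_sum_bound => sg _; rewrite -signr_odd.
have h : (msize (\prod_(i < r) (\matrix_(u, v) (\prod_(g <- tnth c (R u)) g)^`M(C v)) i (perm.fun_of_perm sg i)) <= (r * s).+1)%N.
  rewrite -[X in (X * _).+1]card_ord -sum_nat_const; apply: msize_prod_bound => u _.
  by rewrite mxE; apply: msize_deriv; exact: (gate_msize_le cs).
by case: (odd _); rewrite ?expr0 ?mul1r // expr1 mulN1r -scaleN1r; exact: msizeZ_bound.
Qed.

(** The bracket is the [m] of [small_support]: [2 ^ (3 + delta)] beats [5 * delta], and the
    remaining power of 2 covers [(s ^ 4) ^ k], a bound on the number of power products. The last [k]
    counts the coordinates of the slice. *)
Definition support_bound (s k delta : nat) : nat :=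
  (20 * delta * (3 + delta + 4 * k * (log2 s).+1) + k)%N.

Lemma rat_seeds n s U (f : {mpoly rat[n]}) (a : 'I_n -> rat) (Y : 'I_n -> rat) (A : {set 'I_n}) :
  (n <= s)%N -> (msize f <= s.+1)%N -> (#|A| <= U)%N -> (forall i, i \notin A -> Y i = 0) ->
  f.@[fun i => a i + Y i] != 0 ->
  exists2 y, (y < s.+1 ^ (2 * U))%N & f.@[fun i : 'I_n => a i + (spike s.+1 U y i)%:R] != 0.
Proof.
move=> ns fs AU hY hf; have [y [ys y0 hy]] := natural_grid fs hf.
pose l := [seq val i | i <- enum A]; pose yy i := if insub i is Some j then y j else 0%N.
have [|||c cb hc] := @spike_onto s.+1 U l yy (ltn0Sn s).
- by rewrite (map_inj_uniq val_inj) enum_uniq.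
- by rewrite size_map -cardE.
- by move=> i /mapP[j _ ->]; rewrite /yy valK !ltnS ys (leq_trans (ltnW (ltn_ord j)) ns).
exists c => //; rewrite (@meval_eq _ _ _ (fun i => a i + (y i)%:R)) // => i; rewrite hc.
rewrite (mem_map val_inj) mem_enum /yy valK; case: (boolP (i \in A)) => // /hY /y0 -> //.
Qed.

Lemma bounded_degree_seeds n s k delta (c : circuit k n) : (0 < n <= s)%N -> (2 <= s)%N ->
  (0 < k)%N -> (0 < delta)%N -> SigmaPiSigmaPi delta c -> (circuit_size c <= s)%N ->
  circuit_poly c != 0 ->
  let U := support_bound s (minn k n) delta in
  exists p tau y, [/\ (p < s ^ 12)%N, (tau < s ^ 12)%N, (y < s.+1 ^ (2 * U))%N &
    (circuit_poly c).@[fun i : 'I_n => (power_coord s p tau i + spike s.+1 U y i)%:R] != 0].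
Proof.
move=> hn s2 k0 d0 hc cs f0 U; have /andP[n0 ns] := hn.
have [r [R [C [p [tau [D [a [[rk ps] Cinj rmax Ts [Ds a0 [m mJ mD] hJ]]]]]]]]] := jacobian_lowest hn s2 cs.
pose T u := tnth c (R u); pose al (i : 'I_n) := tau ^+ ((s ^ 4) ^ i %% p.+1); pose kap := minn k n; rewrite -/kap in rk.
pose F := log_jacobian al T C D; have {}mJ : m \in msupp (shift al (jacobian T C)) := mJ.
have {}hJ : forall m, mdeg m = D -> (shift al (jacobian T C))@_m = a * F@_m := hJ.
have mF : m \in msupp F.
  by move: mJ; rewrite !mcoeff_msupp hJ // mulf_eq0 negb_or => /andP[].
pose mm := (3 + delta + 4 * kap * (log2 s).+1)%N.
have [||||||m0 [m0F m0D m0S]] := @small_support n r al T C D s delta mm Ts.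
- by move=> u g /hc; rewrite /tdeg; move: (msize g) => d; lia.
- exact: d0.
- by rewrite /mm.
- by rewrite /mm; apply: leq_trans rk _; nia.
- rewrite /mm !expnD; apply: leq_ltn_trans (_ : 5 * delta * (2 ^ (4 * kap * (log2 s).+1)) < _)%N.
    rewrite leq_mul2l; apply/orP; right.
    apply: leq_trans (_ : (s ^ 4) ^ r <= _)%N.
      by apply: expn_monol; rewrite !expnS expn0; nia.
    apply: leq_trans (_ : (s ^ 4) ^ kap <= _)%N; first by rewrite leq_pexp2l // expn_gt0; lia.
    rewrite -expnM [X in (_ <= X)%N](_ : _ = (2 ^ (log2 s).+1) ^ (4 * kap))%N; last by rewrite -expnM mulnC.
    by apply: expn_monol; rewrite ltnW // trunc_log_ltn.
  rewrite ltn_mul2r expn_gt0 /= -[(2 ^ 3)%N]/8%N; have := ltn_expl delta (ltnSn 1); nia.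
- by exists m.
pose S := [set i | m0 i != 0%N].
(* [m0] survives when the variables outside [S] are set to zero, so moving the coordinates in [S]
   alone hits the minor. *)
have K0 : kill S (shift al (jacobian T C)) != 0.
  apply/eqP => e; have := congr1 (mcoeff m0) e; rewrite mcoeff_kill mcoeff0 ifT.
    rewrite hJ // => /eqP; rewrite mulf_eq0 (negbTE a0) /=.
    by apply/negP; rewrite -mcoeff_msupp.
  by apply/forallP => i; rewrite inE negbK; apply/implyP.
have [x hx] := mpoly_nonroot K0; pose x' i := if i \in S then x i else 0.
have hx' : (jacobian T C).@[fun i => x' i + al i] != 0.
  rewrite -meval_shift; move: hx; rewrite /kill meval_comp.
  by rewrite (@meval_eq _ _ _ x') // => i; rewrite /x'; case: ifP; rewrite ?mevalXU ?meval0.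
have [Y [Y0 hY]] := jacobian_slice rmax hx' f0.
have fs := circuit_msize_le cs.
have hf : (circuit_poly c).@[fun i => ('X^((s ^ 4) ^ i %% p.+1) + (x' i + Y i)%:P).[tau]] != 0.
  rewrite (@meval_eq _ _ _ (fun i => x' i + al i + Y i)) // => i.
  by rewrite hornerD hornerXn hornerC addrCA addrA.
(* The free coordinates stay rational while [tau] is made natural. The exponents of [tau] are below
   [s ^ 10] and the degree is at most [s], so the new seed is at most [s ^ 11]. *)
have [|tn tns htn] := @natural_seed _ _ (fun i : 'I_n => 'X^((s ^ 4) ^ i %% p.+1) + (x' i + Y i)%:P) (s ^ 10) s tau _ fs hf.
  move=> i; apply: leq_trans (size_polyD _ _) _; rewrite size_polyXn size_polyC geq_max ltnS.
  apply/andP; split; last by case: (_ != _).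
  by apply: leq_trans (ltnW ps); rewrite -ltnS ltn_pmod.
have htn' : (circuit_poly c).@[fun i => (power_coord s p tn i)%:R + (x' i + Y i)] != 0.
  by rewrite -(@meval_eq _ _ (fun i => ('X^((s ^ 4) ^ i %% p.+1) + (x' i + Y i)%:P).[tn%:R])) // => i;
    rewrite hornerD hornerXn hornerC natrX.
have [||y yU hy] := @rat_seeds n s U _ _ _ (S :|: [set i in codom C]) ns fs _ _ htn'.
- apply: leq_trans (leq_card_setU _ _) _; rewrite /U /support_bound -/mm; apply: leq_add.
    exact: ltnW.
  by rewrite cardsE (leq_trans (card_size _)) // size_codom card_ord.
- move=> i; rewrite !inE negb_or => /andP[iS iC]; rewrite /x' inE (negbTE iS) add0r; exact: Y0.
exists p, tn, y; split=> //.
- by apply: leq_trans ps _; rewrite leq_pexp2l ?(ltnW s2).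
- by apply: leq_ltn_trans tns _; rewrite -expnS ltn_exp2l.
by rewrite -(@meval_eq _ _ (fun i => (power_coord s p tn i)%:R + (spike s.+1 U y i)%:R)) // => i; rewrite natrD.
Qed.

(* The exponents 90 and 96 leave room for the moduli p <= 2 s ^ (88 kap) of
   [isolating_levels] and for the weights they produce. *)
Definition level_count (s : nat) : nat := (3 * log2 (log2 s) + 12)%N.
Definition modulus_bound (s kap : nat) : nat := (s ^ (90 * kap))%N.
Definition level_base (s kap : nat) : nat := (s ^ (96 * kap))%N.
Definition code_count (s kap : nat) : nat := (modulus_bound s kap ^ (level_count s).+1)%N.

(** The digits are increased by one, so that every code yields positive moduli. *)
Definition code_moduli (s kap c : nat) : seq nat :=
  [seq ((c %/ modulus_bound s kap ^ l) %% modulus_bound s kap).+1 | l <- iota 0 (level_count s).+1].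

Definition code_weight (s kap c i : nat) : nat :=
  level_weight (s ^ 4) (level_base s kap) (code_moduli s kap c) i.

(** The shift of [concentrating_shift] over an arbitrary ring: it serves as a rational point and as
    a polynomial in the seeds, and [natr_spread] identifies it with what the program computes. *)
Definition spread (R : comNzRingType) (s kap : nat) (v t : R) (i : nat) : R :=
  \sum_(c < code_count s kap) t ^+ code_weight s kap c i *
    \prod_(c' < code_count s kap | c' != c) (v + (c' : nat)%:R).

Definition nat_spread (s kap v t i : nat) : nat :=
  (\sum_(c < code_count s kap) t ^ code_weight s kap c i *
    \prod_(c' < code_count s kap | c' != c) (v + c'))%N.

Definition nat_selector (n kap q : nat) (x : nat -> nat) (i : nat) : nat :=
  (\sum_(u < kap) x (2 * (kap * (i %% q) + u)) *
     \prod_(i' < n | (i' : nat) != i) (x (2 * (kap * (i %% q) + u)).+1 + i'))%N.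

Lemma moduli_onto s kap ps : (0 < s)%N -> size ps = (level_count s).+1 ->
  (forall p, p \in ps -> (0 < p <= modulus_bound s kap)%N) ->
  exists2 c, (c < code_count s kap)%N & code_moduli s kap c = ps.
Proof.
move=> s0 sz hps; have Q0 : (0 < modulus_bound s kap)%N by rewrite expn_gt0 s0.
pose dig v := (nth 0 ps v).-1%N.
have hd v : (v < (level_count s).+1)%N -> (dig v < modulus_bound s kap)%N.
  by rewrite -sz => /(mem_nth 0%N)/hps/andP[a b]; rewrite /dig prednK.
exists (digit_code (modulus_bound s kap) (level_count s).+1 dig); first exact: digit_code_lt.
apply: (@eq_from_nth _ 0%N); rewrite ?size_map ?size_iota // => l lt.
rewrite (nth_map 0%N) ?size_iota // nth_iota // add0n digit_codeE // /dig prednK //.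
by rewrite -sz in lt; have /andP[] := hps _ (mem_nth 0%N lt).
Qed.

Lemma level_weight_lt D N ps i : (forall p, p \in ps -> (0 < p <= N)%N) ->
  (level_weight D N ps i < N ^ size ps)%N.
Proof.
elim/last_ind: ps => [|ps p IH] h //; rewrite level_weight_rcons size_rcons expnSr.
have /andP[p0 pN] := h p (ltac:(by rewrite mem_rcons mem_head)).
have := IH (fun q hq => h q (ltac:(by rewrite mem_rcons inE hq orbT))).
have := ltn_pmod (D ^ i) p0; move: (_ %% p)%N (level_weight _ _ _ _) (N ^ _)%N => a b c; nia.
Qed.

Lemma code_weight_lt s kap c i : (0 < s)%N ->
  (code_weight s kap c i < level_base s kap ^ (level_count s).+1)%N.
Proof.
move=> s0; have e : size (code_moduli s kap c) = (level_count s).+1 by rewrite size_map size_iota.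
rewrite -e; apply: level_weight_lt => p /mapP[l _ ->]; apply: leq_trans (_ : modulus_bound s kap <= _)%N.
  by apply: ltn_pmod; rewrite expn_gt0 s0.
by rewrite leq_pexp2l // leq_mul2r orbT.
Qed.

Lemma rmorph_spread (R S : comNzRingType) (f : {rmorphism R -> S}) s kap v t i :
  f (spread s kap v t i) = spread s kap (f v) (f t) i.
Proof.
rewrite rmorph_sum; apply: eq_bigr => c _; rewrite rmorphM rmorphXn rmorph_prod; congr (_ * _).
by apply: eq_bigr => c' _; rewrite rmorphD rmorph_nat.
Qed.

Lemma rmorph_selector (R S : comNzRingType) (f : {rmorphism R -> S}) n kap q (x : nat -> R) i :
  f (selector n kap q x i) = selector n kap q (fun I => f (x I)) i.
Proof.
rewrite rmorph_sum; apply: eq_bigr => u _; rewrite rmorphM rmorph_prod; congr (_ * _).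
by apply: eq_bigr => i' _; rewrite rmorphD rmorph_nat.
Qed.

Lemma natr_spread s kap v t i : (nat_spread s kap v t i)%:R = spread s kap (v%:R : rat) t%:R i.
Proof.
rewrite natr_sum; apply: eq_bigr => c _; rewrite natrM natrX natr_prod; congr (_ * _).
by apply: eq_bigr => c' _; rewrite natrD.
Qed.

Lemma natr_selector n kap q x i :
  (nat_selector n kap q x i)%:R = selector n kap q (fun I => (x I)%:R : rat) i.
Proof.
rewrite natr_sum; apply: eq_bigr => u _; rewrite natrM natr_prod; congr (_ * _).
by apply: eq_bigr => i' _; rewrite natrD.
Qed.

Lemma log2_lt s : (0 < s)%N -> (log2 s < s)%N.
Proof. by move=> s0; apply: leq_trans (ltn_expl _ (ltnSn 1)) (trunc_logP _ s0). Qed.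

Lemma loglog_tower s : (4 <= s)%N -> (s < 2 ^ 2 ^ (log2 (log2 s)).+1)%N.
Proof.
move=> s4; apply: leq_trans (trunc_log_ltn _ (ltnSn 1)) _; rewrite leq_exp2l //.
exact: trunc_log_ltn.
Qed.

Lemma two_level_count s : (4 <= s)%N -> (2 ^ level_count s <= s ^ 9)%N.
Proof.
move=> s4; have s0 : (0 < s)%N by apply: leq_trans s4.
have l0 : (0 < log2 s)%N by rewrite trunc_log_gt0 (leq_trans _ s4).
have e x : (2 ^ (3 * x) = (2 ^ x) ^ 3)%N by rewrite -expnM mulnC.
rewrite /level_count expnD e mulnC (expnD s 6 3); apply: leq_mul.
  by rewrite (expnM 2 2 6); exact: expn_monol.
by apply: expn_monol; apply: leq_trans (trunc_logP _ l0) (ltnW (log2_lt s0)).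
Qed.

Lemma expn_split4 s a b c d e : (s ^ a * s ^ b * (s ^ c * (s ^ d * s ^ e)) = s ^ (a + b + (c + (d + e))))%N.
Proof. by rewrite !expnD. Qed.

(** The exponents add up to [23 + 64 * kap], which is below [88 * kap] for positive [kap]. *)
Lemma level_modulus s kap K : (4 <= s)%N -> (0 < kap)%N -> (K < s ^ 12)%N ->
  (4 * s * K.+1 * (2 ^ level_count s * (s ^ (32 * kap) * s ^ (32 * kap))) < s ^ (88 * kap))%N.
Proof.
move=> s4 k0 hK; have s1 : (1 < s)%N by apply: leq_trans s4.
have s0 : (0 < s)%N by apply: ltnW.
apply: leq_ltn_trans (_ : s ^ 2 * s ^ 12 * (s ^ 9 * (s ^ (32 * kap) * s ^ (32 * kap))) < _)%N.
  apply: leq_mul; last by rewrite leq_mul2r two_level_count ?orbT.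
  by apply: leq_mul => //; rewrite -mulnn leq_mul2r s4 orbT.
by rewrite expn_split4 ltn_exp2l //; move: k0; clear; lia.
Qed.

Lemma level_base_ge s kap : (4 <= s)%N -> (0 < kap)%N ->
  (s ^ 4 * (s ^ (88 * kap)).*2 <= level_base s kap)%N.
Proof.
move=> s4 k0; have s1 : (1 < s)%N by apply: leq_trans s4.
apply: leq_trans (_ : s ^ 4 * (s ^ 1 * s ^ (88 * kap)) <= _)%N.
  by rewrite leq_mul2l -mul2n leq_mul2r expn1 s1 !orbT.
by rewrite -!expnD leq_pexp2l ?(ltnW s1) //; move: k0; clear; lia.
Qed.

Lemma modulus_bound_ge s kap : (4 <= s)%N -> (0 < kap)%N ->
  ((s ^ (88 * kap)).*2 <= modulus_bound s kap)%N.
Proof.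
move=> s4 k0; have s1 : (1 < s)%N by apply: leq_trans s4.
apply: leq_trans (_ : s ^ 1 * s ^ (88 * kap) <= _)%N.
  by rewrite -mul2n leq_mul2r expn1 s1 !orbT.
by rewrite -!expnD leq_pexp2l ?(ltnW s1) //; move: k0; clear; lia.
Qed.

(** A size l with 2^l above [s ^ (16 * kap)], the separation width. Since
    [s < 2 ^ 2 ^ (log2 (log2 s)).+1], the summand 5 = 1 + 4 supplies the factor 16. *)
Definition hit_support (s kap : nat) : nat := (kap * 2 ^ (log2 (log2 s) + 5))%N.

Lemma sep_width s kap : (4 <= s)%N -> (0 < kap)%N -> (s ^ (16 * kap) < 2 ^ hit_support s kap)%N.
Proof.
move=> s4 k0; have -> : (2 ^ hit_support s kap = (2 ^ 2 ^ (log2 (log2 s)).+1) ^ (16 * kap))%N.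
  rewrite -expnM /hit_support; congr (2 ^ _)%N; rewrite expnS [(2 ^ (_ + 5))%N]expnD -[(2 ^ 5)%N]/32%N.
  by move: (2 ^ _)%N => x; clear; lia.
by rewrite ltn_exp2r ?loglog_tower // muln_gt0.
Qed.

Section SetLevels.
Variables (n s kap : nat) (S : {set 'I_n}).
Hypotheses (s4 : (4 <= s)%N) (k0 : (0 < kap)%N) (hS : #|S| = hit_support s kap).

(** The elements of [S] are numbered in blocks of [2 * kap]. All others get distinct indices behind
    the last block, so they form singleton blocks at level 0 and stay out of the top block 0. *)
Definition set_index (i : 'I_n) : nat :=
  (if i \in S then index i (enum S) %/ (2 * kap) else 2 ^ level_count s + i)%N.

Lemma set_index_lt i : i \in S -> (set_index i < 2 ^ level_count s)%N.
Proof.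
move=> iS; rewrite /set_index iS ltn_divLR ?muln_gt0 //.
apply: leq_trans (_ : #|S| <= _)%N; first by rewrite cardE index_mem mem_enum.
rewrite hS /hit_support mulnC; apply: leq_mul; last by rewrite leq_pmull.
by rewrite leq_pexp2l // /level_count; lia.
Qed.

Lemma set_index_block j : (#|[pred i | set_index i %/ 2 ^ 0 == j]| <= 2 * kap)%N.
Proof.
have p : (0 < 2 * kap)%N by rewrite muln_gt0.
pose g i := Ordinal (ltn_pmod (index i (enum S)) p).
rewrite -[X in (_ <= X)%N]card_ord; apply: (leq_card_in g) => i i'.
rewrite !inE expn0 !divn1 => /eqP e /eqP e' /(congr1 val) /= ge.
have {e e'}e : set_index i = set_index i' by rewrite e e'.
have := @set_index_lt i; have := @set_index_lt i'; move: e; rewrite /set_index.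
case: (boolP (i \in S)) => iS; case: (boolP (i' \in S)) => i'S e.
- move=> _ _; have ei : index i (enum S) = index i' (enum S).
    by rewrite (divn_eq (index i _) (2 * kap)) e ge -divn_eq.
  by rewrite -(nth_index i (s := enum S) (x := i)) ?mem_enum // ei nth_index ?mem_enum.
- by move=> _ /(_ isT); rewrite e ltnNge leq_addr.
- by move=> /(_ isT); rewrite -e ltnNge leq_addr.
- by move=> _ _; apply/val_inj/(addnI e).
Qed.

Lemma set_index_top : [pred i | set_index i %/ 2 ^ level_count s == 0]%N = [pred i in S] :> pred 'I_n.
Proof.
apply: functional_extensionality => i /=.
case: (boolP (i \in S)) => iS; first by rewrite divn_small ?set_index_lt.
by rewrite /set_index (negbTE iS) eqn0Ngt divn_gt0 ?expn_gt0 // leq_addr.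
Qed.

End SetLevels.

(** The codes contain an isolating weight for every set of [hit_support] coordinates, hence one
    shift concentrates the support of a monomial. A shift preserves the separation width, so the
    same code range also isolates the buckets afterwards. *)
Lemma spread_selector_hits n s kap (P : {mpoly rat[n]}) : (0 < n <= s)%N -> (4 <= s)%N ->
  (0 < kap <= n)%N -> P != 0 -> (msize P <= (s * s).+1)%N ->
  (forall A : {pred 'I_n}, sep A (s ^ (16 * kap)) P) ->
  exists (v t t' : rat) (q c : nat), [/\ (q < 2 ^ level_count s)%N, (c < code_count s kap)%N &
    P.@[fun i : 'I_n => selector n kap q.+1 (fun I => t' ^+ code_weight s kap c I) i +
                        spread s kap v t i] != 0].
Proof.
move=> /andP[n0 ns] s4 /andP[k0 kn] P0 sP hsep; have s1 : (1 < s)%N by apply: leq_trans s4.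
have s0 : (0 < s)%N by apply: ltnW.
have D0 : (0 < s ^ 4)%N by rewrite expn_gt0 s0.
have ss : ((s * s).+1 <= s ^ 4)%N.
  by apply: leq_trans (_ : s ^ 3 <= _)%N; [rewrite expnS -mulnn; nia|rewrite leq_pexp2l].
have X1 : ((s ^ 4) ^ (2 * kap) <= s ^ (32 * kap))%N.
  by rewrite -expnM leq_pexp2l //; move: k0; clear; lia.
have X2 : (s ^ (16 * kap) * s ^ (16 * kap) <= s ^ (32 * kap))%N.
  by rewrite -expnD leq_pexp2l //; move: k0; clear; lia.
have code (ps : seq nat) : size ps = (level_count s).+1 -> (forall p, p \in ps -> (0 < p <= (s ^ (88 * kap)).*2)%N) ->
    exists2 c, (c < code_count s kap)%N & code_moduli s kap c = ps.
  move=> sz h; apply: moduli_onto => // p /h /andP[-> /leq_trans]; apply.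
  exact: modulus_bound_ge.
have n12 : (n < s ^ 12)%N.
  by apply: leq_ltn_trans ns _; rewrite -[X in (X < _)%N]expn1 ltn_exp2l.
have [S hS|v [t [m [mP ms]]]] := @concentrating_shift n P (s ^ (16 * kap)) (hit_support s kap)
    (code_count s kap) (fun c i => code_weight s kap c i) P0 hsep (sep_width s4 k0).
  have [ps [sps hps iso]] := @isolating_levels n P (set_index s kap S) (s ^ 4) (4 * s)
    (level_base s kap) (s ^ (88 * kap)) (2 * kap) (s ^ (16 * kap)) (s ^ (32 * kap)) (level_count s)
    (sixteen_pow s) D0 (leq_trans sP ss) (set_index_block s4 k0 hS) (fun l j => hsep _) X1 X2
    (level_modulus s4 k0 n12) (level_base_ge s4 k0) _ (leqnn _).
  have [c cC ec] := code ps sps hps; exists c => //.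
  have := iso 0%N; rewrite subnn => /(_ isT).
  by rewrite (set_index_top s4 k0 hS) /code_weight ec.
set b := fun i => _ in mP; set P' := shift b P in mP.
have nd : (n <= 2 ^ 2 ^ (log2 (log2 s)).+1)%N by apply: leq_trans ns (ltnW (loglog_tower s4)).
have [|q [/andP[q0 qM] hq]] := @hash_modulus n [set i | m i != 0%N] _ (hit_support s kap) kap
    (2 ^ (3 * log2 (log2 s) + 11)) nd (ltnW ms).
  (* The range absorbs the powers of two from the squared support and from the bits of the
     coordinates; [kap * kap < kap * kap.+1] makes the inequality strict. *)
  rewrite /hit_support (_ : 2 ^ (3 * log2 (log2 s) + 11) = 2 ^ (log2 (log2 s)).+1 * (2 ^ (log2 (log2 s) + 5) * 2 ^ (log2 (log2 s) + 5)))%N.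
    have : (0 < 2 ^ (log2 (log2 s)).+1 * (2 ^ (log2 (log2 s) + 5) * 2 ^ (log2 (log2 s) + 5)))%N.
      by rewrite !muln_gt0 !expn_gt0.
    move: (2 ^ (log2 (log2 s)).+1)%N (2 ^ (log2 (log2 s) + 5))%N => A B AB0.
    rewrite (_ : A * _ = A * (B * B) * (kap * kap))%N; last by clear; lia.
    by rewrite ltn_pmul2l // ltn_pmul2l.
  by rewrite -!expnD; congr (2 ^ _)%N; lia.
(* The 12 in [level_count] is the 11 of the hash range plus the factor two in its bound. *)
have qL : (q <= 2 ^ level_count s)%N.
  have -> : level_count s = (3 * log2 (log2 s) + 11).+1 by rewrite /level_count -addnS.
  by rewrite expnSr muln2.
have [|x hx] := @selector_hits n kap q P' m q0 mP.
  move=> r; apply: leq_trans (hq r); apply: subset_leq_card; apply/subsetP => i.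
  by rewrite !inE.
have sD : (s * s * n < s ^ 4)%N.
  by apply: leq_ltn_trans (_ : s ^ 3 < _)%N; [rewrite expnSr -mulnn leq_mul2l ns orbT|rewrite ltn_exp2l].
have K12 : (2 * kap * 2 ^ level_count s < s ^ 12)%N.
  apply: leq_ltn_trans (_ : s ^ 2 * s ^ 9 < _)%N; last by rewrite -expnD ltn_exp2l.
  apply: leq_mul; last exact: two_level_count.
  by rewrite -mulnn; apply: leq_mul => //; apply: leq_trans kn ns.
have [|ps [sps hps [t' ht']]] := @bucket_isolation n P' kap (level_count s) q (s ^ 4) (4 * s)
    (level_base s kap) (s ^ (88 * kap)) (s ^ (16 * kap)) (s ^ (32 * kap)) (s * s) k0 q0 qL (sixteen_pow s)
    (shift_deriv_size _ sP) sD n0 (fun A => sep_shift _ (hsep A)) X1 X2 (level_modulus s4 k0 K12)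
    (level_base_ge s4 k0).
  by exists x.
have [c cC ec] := code ps sps hps; exists v, t, t', q.-1, c; split=> //; first by rewrite prednK.
move: ht'; rewrite /P' meval_shift prednK // /code_weight ec.
by rewrite (@meval_eq _ _ _ (fun i => selector n kap q (fun I => t' ^+ level_weight (s ^ 4) (level_base s kap) ps I) i + spread s kap v t i)).
Qed.

Lemma fact_le_expn r s : (r <= s)%N -> (r`! <= s ^ r)%N.
Proof.
elim: r => // r IH rs; rewrite factS expnS; apply: leq_mul => //; apply: IH; exact: ltnW.
Qed.

Lemma log_jacobian_width r s D : (r <= s)%N -> (2 <= s)%N -> (D <= s * s)%N ->
  (r`! * (s * (D.+1 * D.+1)) ^ r * D.+1 <= s ^ (8 * r + 3))%N.
Proof.
move=> rs s2 Ds; have s0 : (0 < s)%N by apply: ltnW.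
have h : (D.+1 <= s ^ 3)%N by rewrite !expnS expn0; nia.
have -> : (8 * r + 3 = r + 7 * r + 3)%N by lia.
rewrite (expnD s (r + 7 * r) 3) (expnD s r (7 * r)) (expnM s 7 r); apply: leq_mul => //.
apply: leq_mul; first exact: fact_le_expn.
apply: expn_monol; rewrite (expnD s 1 6) (expnD s 3 3) expn1.
by apply: leq_mul => //; exact: leq_mul.
Qed.

Definition seed_bound (s kap : nat) : nat := (level_base s kap ^ (level_count s).+2)%N.

(** [power_coord] is the point where the factors are inverted, selector and spread hit the
    homogeneous lowest part, and [z] scales along the ray. *)
Definition univariate_coord (n s kap p tau z v t q c t' i : nat) : nat :=
  (power_coord s p tau i +
   (nat_selector n kap q.+1 (fun I => t' ^ code_weight s kap c I) i + nat_spread s kap v t i) * z)%N.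

Lemma code_count_le s kap : (0 < s)%N -> (code_count s kap <= level_base s kap ^ (level_count s).+1)%N.
Proof. by move=> s0; apply: expn_monol; rewrite leq_pexp2l // leq_mul2r orbT. Qed.

Lemma msize_poly_spread N s kap (v t : {mpoly rat[N]}) i W :
  (msize v <= 2)%N -> (msize t <= 2)%N -> (forall c, code_weight s kap c i <= W)%N ->
  (msize (spread s kap v t i) <= (W + code_count s kap).+1)%N.
Proof.
move=> hv ht hW; apply: msize_sum_bound => c _; apply: msizeM_bound.
  apply: leq_trans (msizeXn_bound _ ht) _; by rewrite muln1 ltnS.
apply: leq_trans (_ : (\sum_(c' < code_count s kap | c' != c) 1).+1 <= _)%N.
  apply: (@msize_prod_bound _ _ _ _ _ (fun _ => 1%N)) => c' _; apply: msizeD_bound => //.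
  by rewrite -mpolyC_nat msizeC; case: (_ != _).
rewrite ltnS -[X in (_ <= X)%N]card_ord -sum1_card big_mkcond [X in (_ <= X)%N]big_mkcond.
by apply: leq_sum => c' _; case: ifP.
Qed.

Lemma msize_poly_selector N n kap q (x : nat -> {mpoly rat[N]}) i W : (i < n)%N ->
  (forall I, (msize (x I) <= W.+1)%N) -> (msize (selector n kap q x i) <= (n * W).+1)%N.
Proof.
move=> lt hx; apply: msize_sum_bound => u _.
have e : (W + \sum_(i' < n | (i' : nat) != i) W = n * W)%N.
  by rewrite -[n in RHS]card_ord -sum_nat_const [RHS](bigD1 (Ordinal lt)).
rewrite -e; apply: msizeM_bound; first exact: hx.
apply: (@msize_prod_bound _ _ _ _ _ (fun _ => W)) => i' _; apply: msizeD_bound; first exact: hx.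
by rewrite -mpolyC_nat msizeC; case: (_ != _).
Qed.

Lemma univariate_seeds n s k (c : circuit k n) : (0 < n <= s)%N -> (4 <= s)%N -> (0 < k)%N ->
  SigmaPiSigmaWedge c -> (circuit_size c <= s)%N -> circuit_poly c != 0 ->
  let kap := minn k n in let B := seed_bound s kap in
  exists p tau z v t q e t' y,
    [/\ [/\ (p < B)%N, (tau < B)%N & (z < B)%N],
        [/\ (v < B)%N, (t < B)%N & (q < B)%N],
        [/\ (e < B)%N, (t' < B)%N & (y < B)%N] &
    (circuit_poly c).@[fun i : 'I_n =>
      (univariate_coord n s kap p tau z v t q e t' i + spike s.+1 kap y i)%:R] != 0].
Proof.
move=> hn s4 k0 hc cs f0 kap B; have /andP[n0 ns] := hn.
have s1 : (1 < s)%N by apply: leq_trans s4.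
have s0 : (0 < s)%N by apply: ltnW.
have kap0 : (0 < kap)%N by rewrite leq_min k0 n0.
have kapn : (kap <= n)%N by rewrite geq_minr.
have [r [R [C [p [tau [D [a [[rk ps] Cinj rmax Ts [Ds a0 [m mJ mD] hJ]]]]]]]]] := jacobian_lowest hn s1 cs.
pose T u := tnth c (R u); pose al (i : 'I_n) := tau ^+ ((s ^ 4) ^ i %% p.+1); rewrite -/kap in rk.
pose F := log_jacobian al T C D; have {}mJ : m \in msupp (shift al (jacobian T C)) := mJ.
have {}hJ : forall m, mdeg m = D -> (shift al (jacobian T C))@_m = a * F@_m := hJ.
pose P := homog_part D F.
have P0 : P != 0.
  apply/eqP => /(congr1 (mcoeff m)); rewrite mcoeff_homog_part mD eqxx mcoeff0 => e.
  by move: mJ; rewrite mcoeff_msupp hJ // e mulr0 eqxx.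
have sP : (msize P <= (s * s).+1)%N.
  apply/msize_leP => m'; rewrite mcoeff_msupp mcoeff_homog_part.
  by case: (mdeg m' =P D) => [->|_]; [|rewrite eqxx].
have hsep (A : {pred 'I_n}) : sep A (s ^ (16 * kap)) P.
  apply: sep_le (sep_homog_part D (sep_log_jacobian al C D A Ts (fun u g gT => hc _ _ gT))).
  apply: leq_trans (log_jacobian_width (leq_trans rk (leq_trans kapn ns)) s1 Ds) _.
  by rewrite leq_pexp2l //; move: rk kap0; clear; lia.
have [v [t [t' [q [e [qL eC hP]]]]]] := spread_selector_hits hn s4 (introT andP (conj kap0 kapn)) P0 sP hsep.
have [z hz] := homogeneous_ray a0 hJ hP.
set x := fun i : 'I_n => _ in hP hz; rewrite meval_shift in hz.
have [Y [Y0 hY]] := jacobian_slice rmax hz f0.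
have fs := circuit_msize_le cs.
pose w (i : 'I_n) := ((s ^ 4) ^ i %% p.+1)%N.
(* The five rational parameters [tau], [z], [v], [t], [t'] become the variables 0 to 4, so that one
   use of [natural_grid] replaces them all. The slice coordinates [Y] remain rational constants
   until [rat_seeds]. *)
pose h (i : 'I_n) : {mpoly rat[5]} := mvar 5 0 ^+ w i + mvar 5 1 *
  (selector n kap q.+1 (fun I => mvar 5 4 ^+ code_weight s kap e I) i + spread s kap (mvar 5 2) (mvar 5 3) i)
  + (Y i)%:MP.
have hE (g : nat -> rat) i : (h i).@[fun j => g j] = g 0%N ^+ w i + g 1%N *
  (selector n kap q.+1 (fun I => g 4%N ^+ code_weight s kap e I) i + spread s kap (g 2%N) (g 3%N) i) + Y i.
  have mX (u : {mpoly rat[5]}) e' : (u ^+ e').@[fun j => g j] = u.@[fun j => g j] ^+ e' by exact: rmorphXn.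
  rewrite /h mevalD mevalC mevalD mevalM mevalD mX !meval_mvar //.
  rewrite (rmorph_selector (meval (fun j : 'I_5 => g j))) (rmorph_spread (meval (fun j : 'I_5 => g j))) /=.
  rewrite !meval_mvar //; congr (_ + _ * (_ + _) + _).
  apply: eq_bigr => u _; rewrite !mX !meval_mvar //; congr (_ * _).
pose NL := (level_base s kap ^ (level_count s).+1)%N.
have N0 : (0 < NL)%N by rewrite !expn_gt0 s0.
have wNL I : (code_weight s kap e I < NL)%N by exact: code_weight_lt.
have Nss : (s ^ 20 <= level_base s kap)%N by rewrite leq_pexp2l //; move: kap0; clear; lia.
have NNL : (level_base s kap <= NL)%N.
  by rewrite -[X in (X <= _)%N]expn1 leq_pexp2l // expn_gt0 s0.
have sNL : (s ^ 20 <= NL)%N by exact: leq_trans NNL.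
have hsz i : (msize (h i) <= (s * NL).+1)%N.
  have big : (NL.*2 <= s * NL)%N by rewrite -mul2n leq_mul2r s1 orbT.
  have n1 : (1 + n * NL.-1 <= s * NL)%N.
    apply: leq_trans (_ : n * NL <= _)%N; last by rewrite leq_mul2r ns orbT.
    by move: N0 n0; clear; move: NL => X; case: X => // X _ n0; rewrite mulnS /=; lia.
  apply: msizeD_bound; last by rewrite msizeC; case: (_ != _).
  apply: msizeD_bound.
    apply: leq_trans (msizeXn_bound _ (msize_mvar _ _)) _; rewrite muln1 ltnS.
    apply: leq_trans (_ : s ^ 20 <= _)%N; last by apply: leq_trans sNL _; rewrite leq_pmull.
    apply: leq_trans (_ : s ^ 10 <= _)%N; last by rewrite leq_pexp2l.
    by apply: leq_trans (ltnW ps); rewrite -ltnS ltn_pmod.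
  have -> : (s * NL).+1 = (1 + (s * NL).-1).+1 by rewrite add1n prednK // muln_gt0 s0.
  apply: msizeM_bound; first exact: msize_mvar.
  apply: msizeD_bound.
    apply: leq_trans (msize_poly_selector _ _ (W := NL.-1) _ _) _; first exact: ltn_ord.
      move=> I; apply: leq_trans (msizeXn_bound _ (msize_mvar _ _)) _.
      by rewrite muln1 ltnS -ltnS prednK.
    by rewrite ltnS -ltnS prednK ?muln_gt0 ?s0 // -add1n.
  apply: leq_trans (msize_poly_spread (W := NL.-1) (msize_mvar _ _) (msize_mvar _ _) _) _.
    by move=> c'; rewrite -ltnS prednK //; exact: code_weight_lt.
  rewrite ltnS -ltnS prednK ?muln_gt0 ?s0 // -addSn prednK //.
  apply: leq_trans big; rewrite -addnn leq_add2l; exact: code_count_le.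
pose G := comp h (circuit_poly c).
have sG : (msize G <= (s * (s * NL)).+1)%N by exact: msize_comp_bound.
pose g0 j := nth 0 [:: tau; z; v; t; t'] j.
have G0 : G.@[fun j => 0 + g0 j] != 0.
  rewrite (@meval_eq _ _ _ (fun j => g0 j)) => [|j]; last by rewrite add0r.
  rewrite /G meval_comp (@meval_eq _ _ _ (fun i => z * x i + al i + Y i)) // => i.
  by rewrite hE [z * x i + al i]addrC.
have [yy [yb _ hG]] := natural_grid sG G0.
pose g k := if insub k is Some j then yy j else 0%N.
have gb j : (g j <= s * (s * NL))%N by rewrite /g; case: insub => [j0|].
have hf : (circuit_poly c).@[fun i => (univariate_coord n s kap p (g 0) (g 1) (g 2) (g 3) q e (g 4) i)%:R + Y i] != 0.
  move: hG; rewrite (@meval_eq _ _ _ (fun j => (g j)%:R)) => [|j]; last by rewrite add0r /g valK.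
  rewrite meval_comp; congr (_ != _); apply: meval_eq => i; rewrite (hE (fun j => (g j)%:R)) /univariate_coord.
  rewrite natrD natrM natrD natrX natr_selector natr_spread mulrC; congr (_ + (_ + _) * _ + _).
  by apply: eq_bigr => u _; rewrite !natrX; congr (_ * _); apply: eq_bigr => i' _; rewrite natrX.
have [||y yU hy] := @rat_seeds n s kap _ _ _ [set i in codom C] ns fs _ _ hf.
- by rewrite cardsE (leq_trans (card_size _)) // size_codom card_ord.
- by move=> i; rewrite inE => iC; exact: Y0.
have Bge : (s ^ 20 * NL <= B)%N by rewrite /B /seed_bound expnS -/NL leq_mul2r Nss orbT.
have NLB : (NL <= B)%N by apply: leq_trans Bge; rewrite leq_pmull // expn_gt0 s0.
have gB j : (g j < B)%N.
  apply: leq_ltn_trans (gb j) _; apply: leq_trans Bge; rewrite mulnA ltn_pmul2r // mulnn ltn_exp2l //.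
exists p, (g 0), (g 1), (g 2), (g 3), q, e, (g 4), y; split; [split|split|split|] => //.
- apply: leq_trans ps _; apply: leq_trans NLB; apply: leq_trans sNL; by rewrite leq_pexp2l.
- apply: leq_trans qL _; apply: leq_trans (two_level_count s4) _.
  by apply: leq_trans NLB; apply: leq_trans sNL; rewrite leq_pexp2l.
- apply: leq_trans eC _; apply: leq_trans NLB; exact: code_count_le.
- apply: leq_trans yU _; apply: leq_trans NLB; apply: leq_trans NNL.
  rewrite expnM; apply: leq_trans (_ : (s ^ 4) ^ kap <= _)%N; last by rewrite -expnM leq_pexp2l // leq_mul2r orbT.
  by apply: expn_monol; rewrite (expnM s 2 2); apply: expn_monol; rewrite -mulnn; move: s1; clear; nia.
by move: hy; rewrite (@meval_eq _ _ _ (fun i => (univariate_coord n s kap p (g 0%N) (g 1%N) (g 2%N) (g 3%N) q e (g 4%N) i + spike s.+1 kap y i)%:R)) // => i; rewrite natrD.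
Qed.

(** * Programs computing the points *)

Section FlexibleDen.
Variables (B : nat) (B10 : (16 <= B)%N).

(** The variants below compute exponents as maxima by unification; comparison with a numeral is
    postponed to one final use of this lemma. *)
Lemma den_up_to j j' m M a v : den B j m M a v -> (j <= j')%N -> den B j' m M a v.
Proof. by move=> h jj; apply: (den_le (B_gt0 B10) jj h). Qed.

Lemma den_tconst m M c : den B 1 m M (tconst c) c. Proof. exact: den_const. Qed.

Lemma den_tadd j1 j2 m M a b x y : den B j1 m M a x -> den B j2 m M b y ->
  den B (maxn j1 j2).+1 m M (tadd a b) (x + y).
Proof.
by move=> ha hb; apply: (den_plus B10); [apply: den_up_to ha _|apply: den_up_to hb _]; lia.
Qed.

Lemma den_tsub j1 j2 m M a b x y : den B j1 m M a x -> den B j2 m M b y ->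
  den B (maxn j1 j2).+1 m M (tsub a b) (x - y).
Proof.
by move=> ha hb; apply: (den_minus B10); [apply: den_up_to ha _|apply: den_up_to hb _]; lia.
Qed.

Lemma den_tmul j1 j2 m M a b x y : den B j1 m M a x -> den B j2 m M b y -> (y <= B)%N ->
  den B (maxn j1 j2).+4 m M (tmul a b) (x * y).
Proof.
by move=> ha hb yB; apply: (den_mul B10) => //; [apply: den_up_to ha _|apply: den_up_to hb _]; lia.
Qed.

Lemma den_tpow j1 j2 m M a b x y : den B j1 m M a x -> den B j2 m M b y -> (x <= B)%N -> (y <= B)%N ->
  den B (maxn j1 j2).+4.+2 m M (tpow a b) (x ^ y).
Proof.
by move=> ha hb xB yB; apply: (den_pow B10) => //; [apply: den_up_to ha _|apply: den_up_to hb _]; lia.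
Qed.

Lemma den_tmod j1 j2 m M a b x y : den B j1 m M a x -> den B j2 m M b y -> (x <= B)%N -> (0 < y)%N ->
  den B (maxn j1 j2).+4.+3 m M (tmod a b) (x %% y).
Proof.
by move=> ha hb xB yB; apply: (den_mod B10) => //; [apply: den_up_to ha _|apply: den_up_to hb _]; lia.
Qed.

Lemma den_tdiv j1 j2 m M a b x y : den B j1 m M a x -> den B j2 m M b y -> (x <= B)%N -> (0 < y)%N ->
  den B (maxn j1 j2).+4.+4.+3 m M (tdiv a b) (x %/ y).
Proof.
by move=> ha hb xB yB; apply: (den_div B10) => //; [apply: den_up_to ha _|apply: den_up_to hb _]; lia.
Qed.

Lemma den_tlog j m M a s : den B j m M a s -> (0 < s <= B)%N -> den B j.+4.+4.+3 m M (tlog a) (log2 s).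
Proof. by move=> ha sB; apply: (den_log B10) => //; apply: den_up_to ha _; lia. Qed.

Lemma den_tifeq j1 j2 j3 j4 m M a b c d x y u w : den B j1 m M a x -> den B j2 m M b y ->
  den B j3 m M c u -> den B j4 m M d w ->
  den B (maxn (maxn j1 j2) (maxn j3 j4)).+3 m M (tifz (teq a b) c d) (if x == y then u else w).
Proof.
move=> ha hb hc hd; rewrite -(eq_sub0 B10); apply: (den_ifz B10).
- by apply: (den_eq B10); [apply: den_up_to ha _|apply: den_up_to hb _]; lia.
- by apply: den_up_to hc _; lia.
- by apply: den_up_to hd _; lia.
Qed.

Lemma den_trec j1 j2 j3 m M n a f N A F : den B j1 m M n N -> den B j2 m M a A -> (N <= B)%N ->
  (forall m' M' x y i acc, (m <= m')%N -> agree m M M' -> den B 1 m' M' x i -> den B 1 m' M' y acc ->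
     (i < N)%N -> acc = natrec i A F -> den B j3 m' M' (f x y) (F i acc)) ->
  den B (maxn (maxn j1 j2) j3).+2 m M (trec n a f) (natrec N A F).
Proof.
move=> hn ha NB hf; apply: (den_loop B10) => //; [by apply: den_up_to hn _; lia|by apply: den_up_to ha _; lia|].
by move=> m' M' x y i acc h1 h2 h3 h4 h5 h6; apply: den_up_to (hf _ _ _ _ _ _ h1 h2 h3 h4 h5 h6) _; lia.
Qed.

End FlexibleDen.

(** Follows the syntax of the term and leaves only the bounds on operands. *)
Ltac dn := lazymatch goal with
  | |- den _ _ _ _ (tconst _) _ => eapply den_tconst; [eassumption]
  | |- den _ _ _ _ (tadd _ _) _ => eapply den_tadd; [eassumption|dn|dn]
  | |- den _ _ _ _ (tsub _ _) _ => eapply den_tsub; [eassumption|dn|dn]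
  | |- den _ _ _ _ (tmul _ _) _ => eapply den_tmul; [eassumption|dn|dn|]
  | |- den _ _ _ _ (tpow _ _) _ => eapply den_tpow; [eassumption|dn|dn| |]
  | |- den _ _ _ _ (tmod _ _) _ => eapply den_tmod; [eassumption|dn|dn| |]
  | |- den _ _ _ _ (tdiv _ _) _ => eapply den_tdiv; [eassumption|dn|dn| |]
  | |- den _ _ _ _ (tlog _) _ => eapply den_tlog; [eassumption|dn|]
  | |- den _ _ _ _ (tifz (teq _ _) _ _) _ => eapply den_tifeq; [eassumption|dn|dn|dn|dn]
  | |- _ => try eassumption
  end.

(** Carries the [den] facts known on entry to a loop over to the memory of the current round. *)
Ltac transport mm ag := repeat match type of ag with agree ?m ?M ?M' =>
  match goal with H : den _ _ m M _ _ |- _ => move: (den_agree H mm ag) => {}H end end.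

Lemma natrec_sum N g : natrec N 0 (fun i acc => acc + g i)%N = (\sum_(i < N) g i)%N.
Proof. by elim: N => [|N IH]; rewrite ?big_ord0 // big_ord_recr /= IH. Qed.

Lemma natrec_prod N a c (g : nat -> nat) :
  natrec N a (fun i acc => if i == c then acc else acc * g i)%N =
  (a * \prod_(i < N | (i : nat) != c) g i)%N.
Proof.
elim: N => [|N IH] /=; first by rewrite big_ord0 muln1.
by rewrite IH [in RHS]big_mkcond big_ord_recr /= -big_mkcond /=; case: eqP; rewrite /= ?muln1 ?mulnA.
Qed.

Lemma natrec_foldl N a (F : nat -> nat -> nat) :
  natrec N a F = foldl (fun acc l => F l acc) a (iota 0 N).
Proof. by elim: N => // N IH; rewrite -addn1 iotaD foldl_cat /= addn1 /= IH. Qed.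

Lemma foldl_map T1 T2 T3 (f : T3 -> T2 -> T3) (g : T1 -> T2) a s :
  foldl f a (map g s) = foldl (fun acc l => f acc (g l)) a s.
Proof. by elim: s a => //= x s IH a. Qed.

Lemma natrec_mulpow N a t : natrec N a (fun _ acc => acc * t)%N = (a * t ^ N)%N.
Proof. by elim: N => [|N IH] /=; rewrite ?muln1 // IH expnSr mulnA. Qed.

Lemma natrec_modpow N p D : natrec N (1 %% p) (fun _ acc => (acc * D) %% p)%N = (D ^ N %% p)%N.
Proof. by elim: N => // N IH; rewrite /= IH modnMml expnSr. Qed.

(** Reducing in every round keeps the intermediate values below the product of modulus and base; the
    power itself may exceed [B], which bounds all loops. The start is 1 modulo [p], since the
    modulus may be 1. *)
Definition tmodpow (i p D : term) : term :=
  trec i (tmod (tconst 1) p) (fun _ acc => tmod (tmul acc D) p).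

Definition tpower_coord (p tau D i : term) : term := tpow tau (tmodpow i (tadd p (tconst 1)) D).

Definition tspike (b U y i : term) : term :=
  trec U (tconst 0) (fun u acc => tadd acc
    (tifz (teq (tmod (tdiv y (tpow b (tmul (tconst 2) u))) b) i)
          (tmod (tdiv y (tpow b (tadd (tmul (tconst 2) u) (tconst 1)))) b) (tconst 0))).

Definition tcode_weight (Q N D L1 c i : term) : term :=
  trec L1 (tconst 0) (fun l acc => tadd (tmul acc N)
    (tmodpow i (tadd (tmod (tdiv c (tpow Q l)) Q) (tconst 1)) D)).

Definition tspread (w : term -> term -> term) (C v t i : term) : term :=
  trec C (tconst 0) (fun c acc => tadd acc
    (trec C (tpow t (w c i)) (fun c' a => tifz (teq c' c) a (tmul a (tadd v c'))))).

(** The factor t^W + i' may exceed [B] and then cannot drive a multiplication. So the product is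
    formed as a t^W + a i', with the first summand obtained by multiplying by [t] repeatedly. *)
Definition tselector (w : term -> term -> term) (n kap q c t i : term) : term :=
  trec kap (tconst 0) (fun u acc => tadd acc
    (trec n (tpow t (w c (tmul (tadd (tmul (tmod i (tadd q (tconst 1))) kap) u) (tconst 2))))
       (fun i' a => tifz (teq i' i) a
         (tadd (trec (w c (tadd (tmul (tadd (tmul (tmod i (tadd q (tconst 1))) kap) u) (tconst 2)) (tconst 1)))
                  a (fun _ x => tmul x t)) (tmul a i'))))).

Section Coordinates.
Variables (B : nat) (B10 : (16 <= B)%N).

Lemma den_modpow j m M i p D vi vp vD : (0 < j)%N -> den B j m M i vi -> den B j m M p vp -> den B j m M D vD ->
  (vi <= B)%N -> (0 < vp)%N -> (vp * vD <= B)%N ->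
  den B (j + 20) m M (tmodpow i p D) (vD ^ vi %% vp).
Proof.
move=> j0 hi hp hD iB p0 pD; rewrite -natrec_modpow; eapply den_up_to; [exact B10| |].
  eapply den_trec; [exact B10|exact hi|dn; [by apply: leq_trans B10|by []]|exact iB|].
  move=> m' M' x y a acc mm ag hx hy _ eacc; transport mm ag; dn => //.
    have [->|D0] := posnP vD; first by [].
    by apply: leq_trans pD; rewrite leq_pmull.
  apply: leq_trans pD; rewrite leq_mul2r eacc natrec_modpow; apply/orP; right.
  by rewrite ltnW // ltn_pmod.
by lia.
Qed.

Lemma den_power_coord j m M p tau D i vp vtau s vi : (0 < j)%N -> den B j m M p vp ->
  den B j m M tau vtau -> den B j m M D (s ^ 4) -> den B j m M i vi -> (vi <= B)%N ->
  (vp.+1 * s ^ 4 <= B)%N -> (vp <= B)%N -> (vtau <= B)%N ->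
  den B (j + 30) m M (tpower_coord p tau D i) (power_coord s vp vtau vi).
Proof.
move=> j0 hp ht hD hi iB pD pB tB; rewrite /power_coord; eapply den_up_to; [exact B10| |].
  eapply den_tpow; [exact B10|exact ht| |exact tB|]; last first.
    by apply: leq_trans pB; rewrite -ltnS ltn_pmod.
  apply: (@den_modpow j.+1) => //; try by eapply den_up_to; [exact B10|eassumption|].
  by rewrite -[vp.+1]addn1; eapply den_up_to; [exact B10|dn|lia].
lia.
Qed.

Lemma den_spike j m M b U y i vb vU vy vi : (0 < j)%N -> den B j m M b vb -> den B j m M U vU ->
  den B j m M y vy -> den B j m M i vi -> (0 < vb <= B)%N -> (2 * vU <= B)%N -> (vy <= B)%N ->
  den B (j + 50) m M (tspike b U y i) (spike vb vU vy vi).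
Proof.
move=> j0 hb hU hy hi /andP[b0 bB] UB yB.
rewrite /spike -(natrec_sum _ (fun u => if (vy %/ vb ^ (2 * u)) %% vb == vi then (vy %/ vb ^ (2 * u).+1) %% vb else 0)%N).
eapply den_up_to; [exact B10| |].
  eapply den_trec; [exact B10|exact hU|dn|by apply: leq_trans UB; rewrite leq_pmull|].
  move=> m' M' x acc u vacc mm ag hx hacc uU _; transport mm ag; rewrite -[(2 * u).+1]addn1.
  have dB d : (vy %/ d <= B)%N by apply: leq_trans (leq_div _ _) yB.
  by dn => //; rewrite ?expn_gt0 ?b0 //; lia.
lia.
Qed.

Lemma den_code_weight j m M Q N D L1 c i s kap vc vi : (0 < j)%N -> (0 < s)%N ->
  den B j m M Q (modulus_bound s kap) -> den B j m M N (level_base s kap) ->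
  den B j m M D (s ^ 4) -> den B j m M L1 (level_count s).+1 -> den B j m M c vc -> den B j m M i vi ->
  (vi <= B)%N -> (vc <= B)%N -> (level_base s kap <= B)%N -> ((level_count s).+1 <= B)%N ->
  ((modulus_bound s kap).+1 * s ^ 4 <= B)%N ->
  den B (j + 70) m M (tcode_weight Q N D L1 c i) (code_weight s kap vc vi).
Proof.
move=> j0 s0 hQ hN hD hL hc hi iB cB NB LB QD.
have Q0 : (0 < modulus_bound s kap)%N by rewrite expn_gt0 s0.
have D0 : (0 < s ^ 4)%N by rewrite expn_gt0 s0.
have QB : (modulus_bound s kap <= B)%N.
  by apply: leq_trans (leqnSn _) (leq_trans _ QD); rewrite leq_pmulr.
have -> : code_weight s kap vc vi = natrec (level_count s).+1 0 (fun l acc =>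
    (acc * level_base s kap + (s ^ 4) ^ vi %% ((vc %/ modulus_bound s kap ^ l) %% modulus_bound s kap + 1))%N).
  rewrite natrec_foldl /code_weight /level_weight /code_moduli foldl_map.
  by congr foldl; apply: functional_extensionality => acc; apply: functional_extensionality => l; rewrite addn1.
eapply den_up_to; [exact B10| |].
  eapply den_trec; [exact B10|exact hL|dn|exact LB|].
  move=> m' M' x acc l vacc mm ag hx hacc lL _; transport mm ag.
  eapply den_tadd; [exact B10|dn => //|].
  apply: (@den_modpow (j + 30)) => //; try by eapply den_up_to; [exact B10|eassumption|lia].
  - lia.
  - eapply den_up_to; [exact B10| |].
      dn => //; [by apply: leq_trans (ltnW lL) LB|by rewrite expn_gt0 Q0|].
      exact: leq_trans (leq_div _ _) cB.
    lia.
  - by rewrite addn1.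
  - by apply: leq_trans QD; rewrite leq_mul2r addn1 ltnS ltnW ?orbT // ltn_pmod.
lia.
Qed.

Section Weights.
Variables (w : term -> term -> term) (W : nat -> nat -> nat) (j0 j m0 : nat) (M0 : mem) (Bd : nat).
Hypothesis jj : (0 < j0 <= j)%N.
Hypothesis hw : forall j m M c i vc vi, (j0 <= j)%N -> (m0 <= m)%N -> agree m0 M0 M ->
  den B j m M c vc -> den B j m M i vi ->
  (vc <= Bd)%N -> (vi <= Bd)%N -> den B (j + 70) m M (w c i) (W vc vi).
Hypothesis WB : forall c i, (W c i <= B)%N.

Lemma den_spread s kap C v t i vv vt vi : W =2 code_weight s kap ->
  den B j m0 M0 C (code_count s kap) -> den B j m0 M0 v vv -> den B j m0 M0 t vt -> den B j m0 M0 i vi ->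
  (vi <= Bd)%N -> (code_count s kap <= Bd)%N -> (vt <= B)%N -> (vv + code_count s kap <= B)%N ->
  den B (j + 90) m0 M0 (tspread w C v t i) (nat_spread s kap vv vt vi).
Proof.
move=> eW hC hv ht hi iB CB tB vB; have CB' : (code_count s kap <= B)%N by apply: leq_trans vB; rewrite leq_addl.
have -> : nat_spread s kap vv vt vi = natrec (code_count s kap) 0 (fun c acc => (acc +
    natrec (code_count s kap) (vt ^ W c vi) (fun c' a => if c' == c then a else a * (vv + c')))%N)%N.
  rewrite natrec_sum; apply: eq_bigr => c _; rewrite natrec_prod eW; congr (_ * _)%N.
eapply den_up_to; [exact B10| |].
  eapply den_trec; [exact B10|exact hC|dn|exact CB'|].
  move=> m1 M1 x acc c vacc mm ag hx hacc cC _; transport mm ag.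
  eapply den_tadd; [exact B10|exact hacc|].
  eapply den_trec; [exact B10|exact hC| |exact CB'|].
    eapply den_tpow; [exact B10|exact ht| |exact tB|exact: WB].
    apply: (hw (j := j)) => //; [by case/andP: jj|by eapply den_up_to; [exact B10|exact hx|lia]|].
    exact: leq_trans (ltnW cC) CB.
  move=> m2 M2 x2 acc2 c2 vacc2 mm2 ag2 hx2 hacc2 cC2 _; transport mm2 ag2.
  by dn => //; apply: leq_trans vB; rewrite leq_add2l ltnW.
lia.
Qed.

Lemma den_selector n kap q c t i vn vkap vq vc vt vi :
  den B j m0 M0 n vn -> den B j m0 M0 kap vkap -> den B j m0 M0 q vq -> den B j m0 M0 c vc ->
  den B j m0 M0 t vt -> den B j m0 M0 i vi ->
  (vn <= B)%N -> (vkap <= B)%N -> (vi <= B)%N -> (vc <= Bd)%N -> (vt <= B)%N ->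
  (2 * (vkap * vi + vkap) <= Bd)%N ->
  den B (j + 115) m0 M0 (tselector (fun c i => w c i) n kap q c t i)
    (nat_selector vn vkap vq.+1 (fun I => vt ^ W vc I)%N vi).
Proof. 
move=> hn hk hq hc ht hi nB kB iB cB tB IB.
have -> : nat_selector vn vkap vq.+1 (fun I => vt ^ W vc I)%N vi = natrec vkap 0 (fun u acc => (acc +
    natrec vn (vt ^ W vc ((vi %% (vq + 1) * vkap + u) * 2)) (fun i' a => if i' == vi then a else
      natrec (W vc ((vi %% (vq + 1) * vkap + u) * 2 + 1)) a (fun _ x => x * vt) + a * i'))%N)%N.
  rewrite natrec_sum; apply: eq_bigr => u _; rewrite !addn1.
  rewrite (_ : (fun i' a => _) = (fun i' a => if i' == vi then a else
      a * (vt ^ W vc ((vi %% vq.+1 * vkap + u) * 2 + 1) + i'))%N).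
    by rewrite natrec_prod [(vi %% _ * _)%N]mulnC [(_ * 2)%N]mulnC addn1.
  apply: functional_extensionality => i'; apply: functional_extensionality => a.
  by rewrite natrec_mulpow -mulnDr addn1.
pose idx u := ((vi %% (vq + 1) * vkap + u) * 2)%N.
have idxB u : (u < vkap)%N -> (idx u + 1 <= Bd)%N.
  move=> uk; apply: leq_trans IB; have : (vi %% (vq + 1) <= vi)%N by exact: leq_mod.
  by rewrite /idx; move: (vi %% _)%N => r; nia.
eapply den_up_to; [exact B10| |].
  eapply den_trec; [exact B10|exact hk|dn|exact kB|].
  move=> m1 M1 x acc u vacc mm ag hx hacc uk _; transport mm ag.
  eapply den_tadd; [exact B10|exact hacc|].
  have hI : den B (j + 20) m1 M1 (tmul (tadd (tmul (tmod i (tadd q (tconst 1))) kap) x) (tconst 2)) (idx u).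
    by eapply den_up_to; [exact B10|dn => //; [by rewrite addn1|exact: leq_trans B10]|lia].
  have hI' : den B (j + 21) m1 M1 (tadd (tmul (tadd (tmul (tmod i (tadd q (tconst 1))) kap) x) (tconst 2)) (tconst 1)) (idx u + 1).
    by eapply den_up_to; [exact B10|eapply den_tadd; [exact B10|exact hI|dn]|lia].
  have hc' : den B (j + 20) m1 M1 c vc by eapply den_up_to; [exact B10|exact hc|lia].
  have hc'' : den B (j + 21) m1 M1 c vc by eapply den_up_to; [exact B10|exact hc|lia].
  have h1 : den B (j + 20 + 70) m1 M1 (w c (tmul (tadd (tmul (tmod i (tadd q (tconst 1))) kap) x) (tconst 2))) (W vc (idx u)).
    apply: hw => //; [by case/andP: jj; lia|].
    by apply: leq_trans (idxB _ uk); rewrite leq_addr.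
  have h2 : den B (j + 21 + 70) m1 M1 (w c (tadd (tmul (tadd (tmul (tmod i (tadd q (tconst 1))) kap) x) (tconst 2)) (tconst 1))) (W vc (idx u + 1)).
    by apply: hw => //; [case/andP: jj; lia|exact: idxB].
  eapply den_trec; [exact B10|exact hn| |exact nB|].
    by eapply den_tpow; [exact B10|exact ht|exact h1|exact tB|exact: WB].
  move=> m2 M2 x2 acc2 i2 vacc2 mm2 ag2 hx2 hacc2 iC2 _; transport mm2 ag2.
  eapply den_tifeq; [exact B10|exact hx2|exact hi|exact hacc2|].
  eapply den_tadd; [exact B10| |by dn => //; apply: leq_trans (ltnW iC2) nB].
  eapply den_trec; [exact B10|exact h2|exact hacc2|exact: WB|].
  move=> m3 M3 x3 acc3 i3 vacc3 mm3 ag3 hx3 hacc3 iC3 _; transport mm3 ag3.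
  by dn.
lia.
Qed.

End Weights.
End Coordinates.

(** * Nested loops over all seeds *)

Fixpoint nest (d : nat) (tb : term) (f : seq term -> term) (xs : seq term) : term :=
  if d is d'.+1 then ofor tb (fun x => nest d' tb f (x :: xs)) else f xs.

Fixpoint nest_seq T (d Bd : nat) (F : seq nat -> seq T) (l : seq nat) : seq T :=
  if d is d'.+1 then flatten [seq nest_seq d' Bd F (i :: l) | i <- iota 0 Bd] else F l.

Lemma nest_seq_map T U (g : seq T -> seq U) d Bd F l : g [::] = [::] -> {morph g : x y / x ++ y} ->
  g (nest_seq d Bd F l) = nest_seq d Bd (fun l => g (F l)) l.
Proof.
move=> g0 gD; elim: d l => //= d IH l; elim: (iota 0 Bd) => //= i s IHs.
by rewrite gD IH IHs.
Qed.

Lemma mem_nest_seq (T : eqType) d Bd (F : seq nat -> seq T) l ds x :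
  size ds = d -> all (fun i => i < Bd)%N ds -> x \in F (catrev ds l) -> x \in nest_seq d Bd F l.
Proof.
elim: d l ds => [|d IH] l [|i ds] //= [sz] /andP[iB dsB] hx.
apply/flattenP; exists (nest_seq d Bd F (i :: l)); last exact: IH hx.
by apply/mapP; exists i; rewrite // mem_iota.
Qed.

Section Nest.
Variables (B : nat) (B10 : (16 <= B)%N).

Definition den_list m M (Bd : nat) (xs : seq term) (l : seq nat) :=
  size xs = size l /\ forall i, (i < size l)%N ->
    den B 1 m M (nth (tconst 0) xs i) (nth 0%N l i) /\ (nth 0%N l i < Bd)%N.

Lemma den_list_agree m m' M M' Bd xs l : den_list m M Bd xs l -> (m <= m')%N -> agree m M M' ->
  den_list m' M' Bd xs l.
Proof.
move=> [h1 h2] mm ag; split=> // i /h2[h3 h4]; split=> //; exact: den_agree h3 mm ag.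
Qed.

Lemma den_nest d j m M tb Bd f F xs l : den B j m M tb Bd -> (Bd <= B)%N ->
  (forall m' M' xs l, (m <= m')%N -> agree m M M' -> den_list m' M' Bd xs l ->
     den_out B j m' M' (f xs) (F l)) -> den_list m M Bd xs l ->
  den_out B (j + 2 * d) m M (nest d tb f xs) (nest_seq d Bd F l).
Proof.
elim: d m M xs l => [|d IH] m M xs l htb BB hf hl; first by rewrite addn0; apply: hf.
have -> : (j + 2 * d.+1 = (j + 2 * d).+2)%N by lia.
apply: (den_for B10) => //; first by apply: (den_up_to B10 htb); lia.
move=> m' M' x i mm ag hx iB; apply: IH.
- exact: den_agree htb mm ag.
- exact: BB.
- move=> m2 M2 xs2 l2 mm2 ag2 hl2; apply: hf => //; [exact: leq_trans mm mm2|exact: agree_trans ag (agree_le mm ag2)].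
have [h1 h2] := den_list_agree hl mm ag; split=> [|[|i'] il] //=; first by rewrite h1.
exact: h2.
Qed.

End Nest.

Definition nat_point n (g : nat -> nat) : n.-tuple rat := [tuple (g i)%:R | i < n].

Lemma encode_nat_point n g :
  encode_point (nat_point n g) = flatten [seq [:: Posz (g i); 1] | i <- iota 0 n].
Proof.
rewrite /encode_point -val_enum_ord -!map_comp; congr flatten; apply: eq_map => i /=.
by rewrite pmulrn numq_int denq_int.
Qed.

(** Register 0 holds [n]; the coordinates are natural numbers, printed with denominator 1. *)
Definition tcoords (coord : seq term -> term -> term) (xs : seq term) : term :=
  ofor (tvar 0) (fun i => oseq (oemit (coord xs i)) (oemit (tconst 1))).

Lemma den_list_nth B m M Bd xs l i : (16 <= B)%N -> (0 < Bd)%N -> den_list B m M Bd xs l ->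
  den B 1 m M (nth (tconst 0) xs i) (nth 0%N l i) /\ (nth 0%N l i < Bd)%N.
Proof.
move=> B10 Bd0 [sz h]; have [/h //|il] := ltnP i (size l).
by rewrite !nth_default ?sz //; split=> //; exact: den_tconst.
Qed.

(** Scratch registers start at 4, above the inputs. Printing a point adds 4 to the time exponent,
    and each of the [d] seed loops adds 2. *)
Lemma nest_outputs (d J B Bd n : nat) (inp : seq nat) (tb : term) (coord : seq term -> term -> term)
    (g : seq nat -> nat -> nat) :
  (16 <= B)%N -> (0 < Bd <= B)%N -> (n <= B)%N -> nth 0%N inp 0 = n -> (0 < J)%N ->
  den B J 4 (init_mem inp) tb Bd ->
  (forall m M xs l x i, (4 <= m)%N -> agree 4 (init_mem inp) M -> den_list B m M Bd xs l ->
     den B 1 m M x i -> (i < n)%N -> den B J m M (coord xs x) (g l i)) ->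
  exists2 t, (t <= B ^ (J + 4 + 2 * d))%N &
    outputs_in_time (nest d tb (tcoords coord) [::] 4) inp t
      (encode_points (nest_seq d Bd (fun l => [:: nat_point n (g l)]) [::])).
Proof.
move=> B10 /andP[Bd0 BdB] nB inp0 J0 htb hg.
have htb' : den B (J + 4) 4 (init_mem inp) tb Bd by apply: (den_up_to B10 htb); lia.
have [||t [M [e tB _]]] := @den_nest B B10 d (J + 4) 4 (init_mem inp) tb Bd (tcoords coord)
    (fun l => flatten [seq [:: Posz (g l i); 1] | i <- iota 0 n]) [::] [::] htb' BdB _ _ 4 (init_mem inp) (leqnn _) (@agree_refl _ _).
- move=> m M xs l m4 ag hl.
  have -> : (J + 4 = J.+2.+2)%N by lia.
  apply: (den_for B10 (out := fun i => [:: Posz (g l i); 1])) => //.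
    by apply: (den_up_to B10 (den_var B10 (v := n) _ _)); rewrite ?(leq_trans _ m4) // ag // /init_mem inp0.
  move=> m' M' x i mm ag' hx ni; apply: (den_oseq B10 (o1 := [:: _]) (o2 := [:: _])).
    apply: (den_emit B10); apply: hg => //; first exact: leq_trans m4 mm.
      exact: agree_trans ag (agree_le m4 ag').
    exact: den_list_agree hl mm ag'.
  apply: (den_emit B10 (v := 1%N)); apply: den_up_to J0 => //; exact: den_tconst.
- by split.
exists t; first exact: tB.
exists M; move: e; congr exec.
have gD : {morph (fun s : seq (n.-tuple rat) => encode_points s) : x y / x ++ y}.
  by move=> s s'; rewrite /encode_points map_cat flatten_cat.
rewrite (nest_seq_map d Bd (fun l => [:: nat_point n (g l)]) [::] _ gD) //.
congr nest_seq; apply: functional_extensionality => l.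
by rewrite /encode_points /= cats0 encode_nat_point.
Qed.

(** The minimum of [k] and [n] by truncated subtraction. *)
Definition tkap : term := tsub (tvar 2) (tsub (tvar 2) (tvar 0)).
Definition tfourth : term := tpow (tvar 1) (tconst 4).
Definition tlevels : term := tadd (tmul (tconst 3) (tlog (tlog (tvar 1)))) (tconst 13).
Definition tmodulus : term := tpow (tvar 1) (tmul (tconst 90) tkap).
Definition tbase : term := tpow (tvar 1) (tmul (tconst 96) tkap).
Definition tcodes : term := tpow tmodulus tlevels.
Definition tseeds : term := tpow tbase (tadd tlevels (tconst 1)).
Definition tweight : term -> term -> term := tcode_weight tmodulus tbase tfourth tlevels.

Definition tunivariate (xs : seq term) (i : term) : term :=
  let x j := nth (tconst 0) xs j in
  tadd (tadd (tpower_coord (x 8%N) (x 7%N) tfourth i)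
             (tmul (tadd (tselector (fun c i => tweight c i) (tvar 0) tkap (x 3%N) (x 2%N) (x 1%N) i)
                         (tspread tweight tcodes (x 5%N) (x 4%N) i)) (x 6%N)))
       (tspike (tadd (tvar 1) (tconst 1)) tkap (x 0%N) i).

(* The innermost loop variable comes first in the list of seeds. *)
Definition univariate_value (n s kap : nat) (l : seq nat) (i : nat) : nat :=
  let x j := nth 0%N l j in
  (univariate_coord n s kap (x 8) (x 7) (x 6) (x 5) (x 4) (x 3) (x 2) (x 1) i + spike s.+1 kap (x 0) i)%N.

Lemma minn_sub k n : (k - (k - n))%N = minn k n. Proof. by rewrite minnE. Qed.

Section UnivariateProgram.
Variables (n s k : nat).
Hypotheses (hn : (0 < n <= s)%N) (s4 : (4 <= s)%N) (k0 : (0 < k)%N).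
Let kap := minn k n.
Let Bd := seed_bound s kap.
(** Squaring the seed bound makes room for the product of a modulus with [s ^ 4] and for the sum of
    a seed and [code_count]. *)
Let B := (Bd * Bd)%N.

Lemma kap_bounds : (0 < kap <= s)%N.
Proof. by case/andP: hn => n0 ns; rewrite leq_min k0 n0 (leq_trans (geq_minr _ _) ns). Qed.

Lemma power_le_seed e : (e <= 96 * kap)%N -> (s ^ e <= Bd)%N.
Proof.
move=> he; have s0 : (0 < s)%N by apply: leq_trans s4.
apply: leq_trans (_ : level_base s kap <= _)%N; first by rewrite leq_pexp2l.
by rewrite -[X in (X <= _)%N]expn1 leq_pexp2l // expn_gt0 s0.
Qed.

Lemma univariate_bounds :
  [/\ (16 <= B)%N, (0 < Bd <= B)%N, (96 * kap <= B)%N, ((level_count s).+2 <= B)%N &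
  [/\ (s ^ 4 <= Bd)%N, (2 * (kap * s + kap) <= Bd)%N, (level_base s kap <= Bd)%N,
      (code_count s kap <= Bd)%N & ((modulus_bound s kap).+1 <= Bd)%N /\
      forall c i, (code_weight s kap c i <= Bd)%N]].
Proof.
have /andP[kap0 kaps] := kap_bounds; have s0 : (0 < s)%N by apply: leq_trans s4.
have s1 : (1 < s)%N by apply: leq_trans s4.
have p e : (e <= 96)%N -> (s ^ e <= Bd)%N.
  by move=> he; apply: power_le_seed; apply: leq_trans he _; rewrite leq_pmulr.
have Bd16 : (16 <= Bd)%N by exact: leq_trans (expn_monol 2 s4) (p 2 isT).
have Bd0 : (0 < Bd)%N by apply: leq_trans Bd16.
have BdB : (Bd <= B)%N by rewrite leq_pmulr.
have NL : (level_base s kap ^ (level_count s).+1 <= Bd)%N by rewrite leq_pexp2l // expn_gt0 s0.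
have s3 : (64 <= s ^ 3)%N by rewrite (expn_monol 3 s4).
have ll : (log2 (log2 s) < s)%N.
  have l0 : (0 < log2 s)%N by rewrite trunc_log_gt0 (leq_trans _ s4).
  exact: ltn_trans (log2_lt l0) (log2_lt s0).
split=> //; first exact: leq_trans BdB.
- by rewrite Bd0 BdB.
- apply: leq_trans BdB; apply: leq_trans (p 5 isT); rewrite !(expnS s) expn0; nia.
- apply: leq_trans BdB; apply: leq_trans (p 3 isT); rewrite /level_count !(expnS s) expn0; nia.
split=> //.
- exact: p.
- by apply: leq_trans (p 4 isT); rewrite !(expnS s) expn0; nia.
- by rewrite -[X in (X <= _)%N]expn1 leq_pexp2l // expn_gt0 s0.
- exact: leq_trans (code_count_le _ s0) NL.
split.
- by apply: leq_trans (power_le_seed (leqnn _)); rewrite ltn_exp2l // ltn_pmul2r.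
- by move=> c i; apply: leq_trans (ltnW (code_weight_lt _ _ _ s0)) NL.
Qed.

Let M0 := init_mem [:: n; s; k].

Lemma den_univariate_params m M : (4 <= m)%N -> agree 4 M0 M ->
  [/\ den B 1 m M (tvar 0) n, den B 1 m M (tvar 1) s, den B 40 m M tkap kap,
      den B 40 m M tfourth (s ^ 4) &
  [/\ den B 40 m M tlevels (level_count s).+1, den B 40 m M tmodulus (modulus_bound s kap),
      den B 40 m M tbase (level_base s kap), den B 40 m M tcodes (code_count s kap) &
      den B 40 m M tseeds Bd]].
Proof.
move=> m4 ag; have [B10 /andP[Bd0 BdB] kB lB [s4B _ NB CB [QB _]]] := univariate_bounds.
have /andP[kap0 kaps] := kap_bounds; have s0 : (0 < s)%N by apply: leq_trans s4.
have sB : (s <= B)%N.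
  by apply: leq_trans BdB; apply: leq_trans s4B; rewrite -[X in (X <= _)%N]expn1 leq_pexp2l.
have hn0 : den B 1 m M (tvar 0) n by apply: den_var => //; [exact: leq_trans m4|rewrite ag].
have hs0 : den B 1 m M (tvar 1) s by apply: den_var => //; [exact: leq_trans m4|rewrite ag].
have hk0 : den B 1 m M (tvar 2) k by apply: den_var => //; [exact: leq_trans m4|rewrite ag].
have hkap : den B 3 m M tkap kap by rewrite /kap -minn_sub; exact: (den_tsub B10 hk0 (den_tsub B10 hk0 hn0)).
have l0 : (0 < log2 s)%N by rewrite trunc_log_gt0 (leq_trans _ s4).
have hL : den B 30 m M tlevels (level_count s).+1.
  rewrite /tlevels /level_count -addnS; eapply den_up_to; [exact B10|dn|].
  - by rewrite s0 sB.
  - by rewrite l0 (leq_trans (ltnW (log2_lt s0)) sB).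
  - apply: leq_trans sB; exact: ltnW (ltn_trans (log2_lt l0) (log2_lt s0)).
  - by [].
have kB' : (kap <= B)%N by exact: leq_trans kaps sB.
have hQ : den B 20 m M tmodulus (modulus_bound s kap).
  rewrite /tmodulus; eapply den_up_to; [exact B10|dn|] => //.
  by apply: leq_trans kB; rewrite leq_mul2r orbT.
have hN : den B 20 m M tbase (level_base s kap) by rewrite /tbase; eapply den_up_to; [exact B10|dn|].
split=> //; try by eapply den_up_to; [exact B10|eassumption|].
  by rewrite /tfourth; eapply den_up_to; [exact B10|dn|] => //; exact: leq_trans B10.
split; try by eapply den_up_to; [exact B10|eassumption|].
- rewrite /tcodes; eapply den_up_to; [exact B10|dn|] => //; last exact: ltnW lB.
  by apply: leq_trans (leqW (leqnn _)) (leq_trans QB BdB).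
- rewrite /tseeds /Bd /seed_bound -[(level_count s).+2]addn1; eapply den_up_to; [exact B10|dn|] => //.
    exact: leq_trans NB BdB.
  by rewrite addn1.
Qed.

Lemma univariate_outputs : exists2 t, (t <= B ^ 222)%N &
  outputs_in_time (nest 9 tseeds (tcoords tunivariate) [::] 4) [:: n; s; k] t
    (encode_points (nest_seq 9 Bd (fun l => [:: nat_point n (univariate_value n s kap l)]) [::])).
Proof.
have [B10 /andP[Bd0 BdB] kB lB [s4B IB NB CB [QB WB]]] := univariate_bounds.
have /andP[n0 ns] := hn; have /andP[kap0 kaps] := kap_bounds.
have s0 : (0 < s)%N by apply: leq_trans s4.
have sB : (s.+1 <= B)%N.
  apply: leq_trans BdB; apply: leq_trans s4B; rewrite -[X in (X < _)%N]expn1 ltn_exp2l //.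
  exact: leq_trans s4.
have nB : (n <= B)%N by exact: leq_trans ns (ltnW sB).
(* The program for one coordinate fits into exponent 200, and 200 + 4 + 2 * 9 = 222. *)
have [|||||||t tB ot] := @nest_outputs 9 200 B Bd n [:: n; s; k] tseeds tunivariate (univariate_value n s kap) => //.
- by rewrite Bd0.
- have [_ _ _ _ [_ _ _ _ h]] := den_univariate_params (leqnn 4) (@agree_refl _ _).
  by apply: den_up_to h _.
- move=> m M xs l x i m4 ag hl hx ni.
  have [hn0 hs0 hkap hD [hL hQ hN hC _]] := den_univariate_params m4 ag.
  have hv j := den_list_nth j B10 Bd0 hl.
  have v40 j : den B 40 m M (nth (tconst 0) xs j) (nth 0%N l j) by apply: (den_up_to B10 (hv j).1).
  have vB j : (nth 0 l j <= B)%N by apply: leq_trans (ltnW (hv j).2) BdB.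
  have x40 : den B 40 m M x i by apply: den_up_to hx _.
  have iB : (i <= B)%N by apply: leq_trans (ltnW ni) nB.
  have n40 : den B 40 m M (tvar 0) n by apply: den_up_to hn0 _.
  have iBd : (i <= Bd)%N.
    apply: leq_trans (ltnW ni) (leq_trans ns (leq_trans _ s4B)).
    by rewrite -[X in (X <= _)%N]expn1 leq_pexp2l.
  have hw : forall j m' M' c i vc vi, (40 <= j)%N -> (m <= m')%N -> agree m M M' ->
      den B j m' M' c vc -> den B j m' M' i vi -> (vc <= Bd)%N -> (vi <= Bd)%N ->
      den B (j + 70) m' M' (tweight c i) (code_weight s kap vc vi).
    move=> j m' M' c i' vc vi j40 mm ag' hc hi cB iB'; transport mm ag'.
    apply: (den_code_weight B10) => //; try by apply: (den_up_to B10 _ j40).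
    - exact: leq_trans j40.
    - exact: leq_trans iB' BdB.
    - exact: leq_trans cB BdB.
    - exact: leq_trans NB BdB.
    - exact: ltnW.
    - exact: leq_mul.
  have WB' c' i' : (code_weight s kap c' i' <= B)%N by exact: leq_trans (WB c' i') BdB.
  eapply den_up_to; [exact B10| |].
    eapply den_tadd; [exact B10| |].
      eapply den_tadd; [exact B10| |].
        apply: (den_power_coord B10 (j := 40) (s := s)) => //.
        by rewrite /B; apply: leq_mul => //; exact: (hv 8%N).2.
      eapply den_tmul; [exact B10| |exact: (hv 6%N).1|exact: vB].
      eapply den_tadd; [exact B10| |].
        apply: (den_selector B10 (j0 := 40) (j := 40) (Bd := Bd) (W := code_weight s kap) _ hw WB') => //.
        + exact: leq_trans kaps (ltnW sB).
        + exact: ltnW (hv 2%N).2.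
        + apply: leq_trans IB; rewrite leq_mul2l /= leq_add2r leq_mul2l (leq_trans (ltnW ni) ns) orbT //.
      apply: (den_spread B10 (j0 := 40) (j := 40) (Bd := Bd) (W := code_weight s kap) _ hw WB') => //.
      apply: leq_trans (_ : Bd + Bd <= _)%N; first by apply: leq_add => //; exact: ltnW (hv 5%N).2.
      by rewrite addnn -mul2n /B leq_mul2r (leq_trans _ (leq_trans s4B (leqnn _))) ?orbT // (leq_trans (leq_trans (isT : 2 <= 4)%N s4)) // -[X in (X <= _)%N]expn1 leq_pexp2l.
    apply: (den_spike B10 (j := 40)) => //.
    + by eapply den_up_to; [exact B10|rewrite -[s.+1]addn1; dn|].
    + by apply: leq_trans kB; rewrite leq_mul2r orbT.
  by [].
by exists t.
Qed.

End UnivariateProgram.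

(** * The two hitting sets *)

Definition tsupport : term :=
  tadd (tmul (tmul (tconst 20) (tvar 3)) (tadd (tadd (tconst 3) (tvar 3))
    (tmul (tmul (tconst 4) tkap) (tadd (tlog (tvar 1)) (tconst 1))))) tkap.
Definition tgrid : term := tpow (tvar 1) (tmul (tconst 4) tsupport).

Definition tbounded (xs : seq term) (i : term) : term :=
  let x j := nth (tconst 0) xs j in
  tadd (tpower_coord (x 2%N) (x 1%N) tfourth i) (tspike (tadd (tvar 1) (tconst 1)) tsupport (x 0%N) i).

Definition bounded_value (s U : nat) (l : seq nat) (i : nat) : nat :=
  (power_coord s (nth 0 l 2) (nth 0 l 1) i + spike s.+1 U (nth 0 l 0) i)%N.

Section BoundedProgram.
Variables (n s k delta : nat).
Hypotheses (hn : (0 < n <= s)%N) (s2 : (2 <= s)%N) (k0 : (0 < k)%N) (d0 : (0 < delta)%N).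
Let kap := minn k n.
Let U := support_bound s kap delta.
(** Covers the spike seed, as [s.+1 <= s ^ 2], and the other two seeds below [s ^ 12], as [U] is at
    least 3. *)
Let Bd := (s ^ (4 * U))%N.
Let B := (Bd * Bd)%N.
Let M0 := init_mem [:: n; s; k; delta].

Lemma bounded_program_bounds :
  [/\ (16 <= B)%N, (s ^ 12 <= Bd)%N, (4 * U <= Bd)%N & [/\ (0 < Bd <= B)%N, (delta <= U)%N, (kap <= U)%N
    & (3 + delta + 4 * kap * (log2 s).+1 <= U)%N]].
Proof.
have s0 : (0 < s)%N by exact: ltnW.
have mU : (3 + delta + 4 * kap * (log2 s).+1 <= U)%N.
  rewrite /U /support_bound; move: (4 * kap * _)%N => X; nia.
have U3 : (3 <= U)%N by apply: leq_trans mU; rewrite -addnA leq_addr.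
have p12 : (s ^ 12 <= Bd)%N by rewrite leq_pexp2l // (leq_mul2l 4 3 U) U3 orbT.
have B16 : (16 <= Bd)%N.
  apply: leq_trans p12; apply: leq_trans (expn_monol 12 s2); exact: (@leq_pexp2l 2 4 12).
have Bd0 : (0 < Bd)%N by exact: leq_trans B16.
have BdB : (Bd <= B)%N by rewrite leq_pmulr.
split=> //; first exact: leq_trans BdB.
  by apply: leq_trans (ltnW (ltn_expl _ (ltnSn 1))) (expn_monol _ s2).
split=> //; first by rewrite Bd0.
- by apply: leq_trans mU; rewrite addnAC leq_addl.
- by rewrite /U /support_bound leq_addl.
Qed.

Lemma den_bounded_params m M : (4 <= m)%N -> agree 4 M0 M ->
  [/\ den B 1 m M (tvar 0) n, den B 1 m M (tvar 1) s, den B 60 m M tfourth (s ^ 4),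
      den B 60 m M tsupport U & den B 60 m M tgrid Bd].
Proof.
move=> m4 ag; have [B10 p12 UB [/andP[Bd0 BdB] dU kU mU]] := bounded_program_bounds.
have s0 : (0 < s)%N by exact: ltnW.
have UB' : (U <= B)%N by apply: leq_trans BdB; apply: leq_trans UB; rewrite leq_pmull.
have sB : (s <= B)%N.
  by apply: leq_trans BdB; apply: leq_trans p12; rewrite -[X in (X <= _)%N]expn1 leq_pexp2l.
have hn0 : den B 1 m M (tvar 0) n by apply: den_var => //; [exact: leq_trans m4|rewrite ag].
have hs0 : den B 1 m M (tvar 1) s by apply: den_var => //; [exact: leq_trans m4|rewrite ag].
have hk0 : den B 1 m M (tvar 2) k by apply: den_var => //; [exact: leq_trans m4|rewrite ag].
have hd0 : den B 1 m M (tvar 3) delta by apply: den_var => //; rewrite ag.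
have hkap : den B 3 m M tkap kap by rewrite /kap -minn_sub; exact: (den_tsub B10 hk0 (den_tsub B10 hk0 hn0)).
have hU : den B 40 m M tsupport U.
  rewrite /tsupport /U /support_bound -[(log2 s).+1]addn1; eapply den_up_to; [exact B10|dn|].
  - exact: leq_trans dU UB'.
  - exact: leq_trans kU UB'.
  - by rewrite s0.
  - by rewrite addn1; apply: leq_trans (log2_lt s0) sB.
  - by rewrite addn1; apply: leq_trans mU UB'.
  - by [].
split=> //; try by eapply den_up_to; [exact B10|eassumption|].
- by rewrite /tfourth; eapply den_up_to; [exact B10|dn|] => //; exact: leq_trans B10.
- rewrite /tgrid /Bd; eapply den_up_to; [exact B10|dn|] => //; exact: leq_trans UB BdB.
Qed.

Lemma bounded_outputs : exists2 t, (t <= B ^ 140)%N &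
  outputs_in_time (nest 3 tgrid (tcoords tbounded) [::] 4) [:: n; s; k; delta] t
    (encode_points (nest_seq 3 Bd (fun l => [:: nat_point n (bounded_value s U l)]) [::])).
Proof.
have [B10 p12 UB [/andP[Bd0 BdB] dU kU mU]] := bounded_program_bounds.
have /andP[n0 ns] := hn; have s0 : (0 < s)%N by exact: ltnW.
have sBd : (s ^ 2 <= Bd)%N by apply: leq_trans p12; rewrite leq_pexp2l.
have sB : (s.+1 <= B)%N.
  apply: leq_trans BdB; apply: leq_trans sBd; rewrite -[X in (X < _)%N]expn1 ltn_exp2l //.
have nB : (n <= B)%N by exact: leq_trans ns (ltnW sB).
have [|||t tB ot] := @nest_outputs 3 130 B Bd n [:: n; s; k; delta] tgrid tbounded (bounded_value s U) B10 _ nB erefl isT.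
- by rewrite Bd0.
- have [_ _ _ _ h] := den_bounded_params (leqnn 4) (@agree_refl _ _).
  by apply: (den_up_to B10 h).
- move=> m M xs l x i m4 ag hl hx ni.
  have [hn0 hs0 hD hU _] := den_bounded_params m4 ag.
  have hv j := den_list_nth j B10 Bd0 hl.
  have v60 j : den B 60 m M (nth (tconst 0) xs j) (nth 0%N l j) by apply: (den_up_to B10 (hv j).1).
  have vB j : (nth 0 l j <= B)%N by apply: leq_trans (ltnW (hv j).2) BdB.
  have x60 : den B 60 m M x i by apply: (den_up_to B10 hx).
  have iB : (i <= B)%N by apply: leq_trans (ltnW ni) nB.
  eapply den_up_to; [exact B10| |].
    eapply den_tadd; [exact B10| |].
      apply: (den_power_coord B10 (j := 60) (s := s)) => //.
      rewrite /B; apply: leq_mul; [exact: (hv 2%N).2|by apply: leq_trans p12; rewrite leq_pexp2l].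
    apply: (den_spike B10 (j := 60)) => //.
    + by eapply den_up_to; [exact B10|rewrite -[s.+1]addn1; dn|].
    + by apply: leq_trans BdB; apply: leq_trans UB; rewrite leq_mul2r orbT.
  by [].
by exists t.
Qed.

End BoundedProgram.

Lemma nat_point_nonroot n (f : {mpoly rat[n]}) (g : nat -> nat) :
  f.@[fun i : 'I_n => (g i)%:R] != 0 -> f.@[tnth (nat_point n g)] != 0.
Proof. by rewrite (@meval_eq _ _ _ (tnth (nat_point n g))) // => i; rewrite tnth_mktuple. Qed.

Lemma univariate_hitting : exists (A : cmd) (C : nat), forall n s k : nat,
  (0 < n <= s)%N -> (4 <= s)%N -> (0 < k)%N ->
  exists (H : seq (n.-tuple rat)) (t : nat),
    [/\ outputs_in_time A [:: n; s; k] t (encode_points H),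
        (t <= s ^ (C * (k * log2 (log2 s))))%N
      & hitting_set H (fun f => exists c : circuit k n,
          [/\ SigmaPiSigmaWedge c, (circuit_size c <= s)%N & f = circuit_poly c])].
Proof.
(* 96 comes from [level_base]; 17 from 3x + 14 <= 17x, where x is the iterated logarithm and is
   positive for [s >= 4]; 2 from squaring the seed bound; 222 is the time exponent. *)
exists (nest 9 tseeds (tcoords tunivariate) [::] 4), (96 * 17 * 2 * 222)%N => n s k hn s4 k0.
have [t tB ot] := univariate_outputs hn s4 k0; eexists; exists t; split; [exact: ot| |].
  apply: leq_trans tB _; rewrite /seed_bound /level_base -!expnM mulnn -!expnM.
  have s0 : (0 < s)%N by exact: leq_trans s4.
  rewrite leq_pexp2l // /level_count.
  have l1 : (0 < log2 (log2 s))%N.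
    by rewrite !trunc_log_gt0 /= (leq_trans (isT : 1 < log2 4)%N) // leq_trunc_log.
  have kk : (minn k n <= k)%N by exact: geq_minl.
  have h1 : ((3 * log2 (log2 s) + 12).+2 <= 17 * log2 (log2 s))%N by lia.
  have := leq_mul kk h1; move: (minn k n) (3 * log2 (log2 s) + 12).+2 (log2 (log2 s)) => x y z h; lia.
move=> f [c [hc cs ->]] f0.
have [p [tau [z [v [t0 [q [e [t' [y [[h1 h2 h3] [h4 h5 h6] [h7 h8 h9] hf]]]]]]]]]] :=
  univariate_seeds hn s4 k0 hc cs f0.
exists (nat_point n (univariate_value n s (minn k n) [:: y; t'; e; q; t0; v; z; tau; p])).
  apply: (@mem_nest_seq _ _ _ _ _ [:: p; tau; z; v; t0; q; e; t'; y]) => //=.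
    by rewrite h1 h2 h3 h4 h5 h6 h7 h8 h9.
  by rewrite inE.
exact: nat_point_nonroot hf.
Qed.

Lemma bounded_degree_hitting : exists (A : cmd) (C : nat), forall n s k delta : nat,
  (0 < n <= s)%N -> (2 <= s)%N -> (0 < k)%N -> (0 < delta)%N ->
  exists (H : seq (n.-tuple rat)) (t : nat),
    [/\ outputs_in_time A [:: n; s; k; delta] t (encode_points H),
        (t <= s ^ (C * (delta ^ 2 * k * log2 s)))%N
      & hitting_set H (fun f => exists c : circuit k n,
          [/\ SigmaPiSigmaPi delta c, (circuit_size c <= s)%N & f = circuit_poly c])].
Proof.
(* 4 is in the exponent of the seed range, 241 = 60 + 20 + 160 + 1 bounds the terms of
   [support_bound], 2 comes from squaring, and 140 is the time exponent. *)
exists (nest 3 tgrid (tcoords tbounded) [::] 4), (4 * 241 * 2 * 140)%N => n s k delta hn s2 k0 d0.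
have s0 : (0 < s)%N by exact: ltnW.
have [t tB ot] := bounded_outputs hn s2 k0 d0; eexists; exists t; split; [exact: ot| |].
  apply: leq_trans tB _; rewrite mulnn -!expnM leq_pexp2l //.
  have l1 : (0 < log2 s)%N by rewrite trunc_log_gt0.
  have kk : (minn k n <= k)%N by exact: geq_minl.
  suff : (support_bound s (minn k n) delta <= 241 * (delta ^ 2 * k * log2 s))%N by lia.
  rewrite /support_bound; move: kk l1; move: (minn k n) (log2 s) => x l kk l1.
  have dd : (delta <= delta ^ 2)%N by rewrite -mulnn leq_pmulr.
  have kl : (0 < k * l)%N by rewrite muln_gt0 k0.
  have e1 : (x * l.+1 <= 2 * (k * l))%N.
    by apply: leq_trans (leq_mul kk (_ : l.+1 <= 2 * l)%N) _; lia.
  have e2 : (x <= k * l)%N by apply: leq_trans kk _; rewrite leq_pmulr.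
  have e3 : (delta <= delta ^ 2 * (k * l))%N by apply: leq_trans dd _; rewrite leq_pmulr.
  have e4 : (delta * delta <= delta ^ 2 * (k * l))%N by rewrite mulnn leq_pmulr.
  have e5 : (delta * (x * l.+1) <= 2 * (delta ^ 2 * (k * l)))%N by rewrite [X in (_ <= X)%N]mulnCA; exact: leq_mul.
  have e6 : (x <= delta ^ 2 * (k * l))%N by apply: leq_trans e2 _; rewrite leq_pmull // expn_gt0 d0.
  rewrite -(mulnA (delta ^ 2)%N); move: e3 e4 e5 e6; move: (delta ^ 2 * (k * l))%N => X; lia.
move=> f [c [hc cs ->]] f0.
have [p [tau [y [h1 h2 h3 hf]]]] := bounded_degree_seeds hn s2 k0 d0 hc cs f0.
have [_ p12 _ _] := bounded_program_bounds hn s2 k0 d0.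
exists (nat_point n (bounded_value s (support_bound s (minn k n) delta) [:: y; tau; p])).
  apply: (@mem_nest_seq _ _ _ _ _ [:: p; tau; y]) => //=; last by rewrite inE.
  rewrite (leq_trans h1 p12) (leq_trans h2 p12) /= andbT; apply: leq_trans h3 _.
  rewrite [(4 * _)%N](_ : _ = 2 * (2 * support_bound s (minn k n) delta))%N; last by lia.
  by rewrite [(s ^ _)%N]expnM; apply: expn_monol; rewrite -mulnn; nia.
exact: nat_point_nonroot hf.
Qed.

Local Close Scope ring_scope.

Theorem theorem1p2 :
  (exists (A : cmd) (C : nat), forall n s k : nat,
      0 < n <= s -> 4 <= s -> 0 < k ->
      exists (H : seq (n.-tuple rat)) (t : nat),
        [/\ outputs_in_time A [:: n; s; k] t (encode_points H),
            t <= s ^ (C * (k * log2 (log2 s)))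
          & hitting_set H (fun f => exists c : circuit k n,
              [/\ SigmaPiSigmaWedge c, circuit_size c <= s
                & f = circuit_poly c])])
  /\
  (exists (A : cmd) (C : nat), forall n s k delta : nat,
      0 < n <= s -> 2 <= s -> 0 < k -> 0 < delta ->
      exists (H : seq (n.-tuple rat)) (t : nat),
        [/\ outputs_in_time A [:: n; s; k; delta] t (encode_points H),
            t <= s ^ (C * (delta ^ 2 * k * log2 s))
          & hitting_set H (fun f => exists c : circuit k n,
              [/\ SigmaPiSigmaPi delta c, circuit_size c <= s
                & f = circuit_poly c])]).
Proof. by split; [exact: univariate_hitting|exact: bounded_degree_hitting]. Qed.
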